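(* Let $d\ge3$, $\theta\in(0,1)$ and $M>0$. There exists a constant $c_2(\theta,M)>0$ (depending only on $\theta$, $M$ and $d$) such that the following hold. (i) For every $\mathcal{G}\in\{\mathbb{Z}^d\}\cup\{\mathbb{T}_L:L\ge1\}$, every finite non-empty $K\subset\mathcal{G}$, every increasing $A\subset\{0,1\}^K$ and every $h\in(-M,M)$, $$-\frac{d\,\mathbb{P}_\theta^{\mathcal{G}}[A^h]}{dh}\ \ge\ c_2(\theta,M)\cdot \mathrm{Var}^{\mathbb{P}_\theta^{\mathcal{G}}}(1_{A^h})\,\log\Big(\frac{1}{2\max_{x\in K}I_\theta^{\mathcal{G}}(A^h,x)}\Big).$$ (ii) For every integer $L\ge1$, every $h\in(-M,M)$ and every increasing, translation invariant event $\mathcal{A}\subset\{0,1\}^{\mathbb{T}_L}$, $$-\frac{d\,\mathbb{P}_\theta^{\mathbb{T}_L}[\mathcal{A}^h]}{dh}\ \ge\ c_2(\theta,M)\cdot\mathrm{Var}^{\mathbb{P}_\theta^{\mathbb{T}_L}}(1_{\mathcal{A}^h})\,\log|\mathbb{T}_L|.$$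
   Context: $\mathbb{T}_L=(\mathbb{Z}/2L\mathbb{Z})^d$, for integers $L\ge1$; $\mathcal{G}$ stands for $\mathbb{Z}^d$ or some $\mathbb{T}_L$, with the nearest-neighbor graph structure. For $\theta\in(0,1)$, $P_\theta^x$ is the law of the Markov chain $(X_n)_{n\ge0}$ on $\mathcal{G}\cup\{\Delta\}$ started at $x\in\mathcal{G}$, where $\Delta$ is an absorbing cemetery state: from $y\in\mathcal{G}$ the chain jumps to $\Delta$ with probability $\theta$, and with probability $1-\theta$ it makes a simple random walk step on $\mathcal{G}$, i.e. moves to $y\pm e_i$, each of these $2d$ choices ($1\le i\le d$, sign $\pm$) having probability $\frac{1-\theta}{2d}$. The Green function is $g_\theta(x,y)=\sum_{n\ge0}P_\theta^x[X_n=y]$. $\mathbb{P}_\theta^{\mathcal{G}}$ is the law on $\mathbb{R}^{\mathcal{G}}$ under which the canonical coordinates $\varphi=(\varphi_x)_{x\in\mathcal{G}}$ form a centered Gaussian field with covariance $g_\theta(\cdot,\cdot)$; $\mathrm{Var}^{\mathbb{P}_\theta^{\mathcal{G}}}$ is the variance under it. For finite $K\subset\mathcal{G}$, $A\subset\{0,1\}^K$ and $h\in\mathbb{R}$, $A^h=\{(1\{\varphi_x\ge h\})_{x\in K}\in A\}$. $A$ is increasing if $\omega\in A$ and $\omega\le\omega'$ coordinatewise imply $\omega'\in A$. The conditional influence of $x\in K$ on $A^h$ (non-negative for increasing $A$) is $$I_\theta^{\mathcal{G}}(A^h,x)=\mathbb{P}_\theta^{\mathcal{G}}[A^h\mid\varphi_x\ge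 h]-\mathbb{P}_\theta^{\mathcal{G}}[A^h\mid\varphi_x<h].$$ If all influences vanish, then $\mathrm{Var}(1_{A^h})=0$ and the right-hand side in (i) is read as $0$. $\mathcal{A}\subset\{0,1\}^{\mathbb{T}_L}$ is translation invariant if $\mathcal{A}=\{\tau_x\omega:\omega\in\mathcal{A}\}$ for all $x\in\mathbb{T}_L$, where $(\tau_x\omega)(y)=\omega(x+y)$. *)

(* Defs.v *)
From mathcomp Require Import all_boot all_order all_algebra finmap.
From mathcomp Require Import all_classical all_reals all_analysis.

Set Implicit Arguments.
Unset Strict Implicit.
Unset Printing Implicit Defensive.

Import Order.TTheory GRing.Theory Num.Theory.
Import numFieldNormedType.Exports.

Local Open Scope classical_set_scope.
Local Open Scope ring_scope.

(* [Lattice] is Z^d and [Torus _] is (Z/2LZ)^d, L >= 1; both are row vectors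
   over [coord_ring G]. Since 2 * L >= 2, 'Z_(2 * L) is really Z/2LZ. *)
Inductive graph := Lattice | Torus (L : nat) of (0 < L)%N.

Definition coord_ring (G : graph) : nzRingType :=
  match G with
  | Lattice => int
  | Torus L _ => 'Z_(2 * L)
  end.

Section KilledWalk.
Context {R : realType} {Z : nzRingType} {d : nat} (theta : R).
Local Notation V := 'rV[Z]_d.

Definition unit_vec (i : 'I_d) : V := delta_mx 0 i.

(* Transition operator of the chain on V + {Delta}, Delta being [None]:
   [killed_step f v] is the mean of f(X_1) for the chain started at v. The sum
   is over the 2d signed directions and not over the set of neighbors: on the
   torus with L = 1, y + e_i and y - e_i coincide. *)
Definition killed_step (f : option V -> R) (v : option V) : R :=
  if v is Some y then
    theta * f None +
    \sum_(i < d) ((1 - theta) / (2 * d)%:R * f (Some (y + unit_vec i)) +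
                  (1 - theta) / (2 * d)%:R * f (Some (y - unit_vec i)))
  else f None.

(* P_theta^x[X_n = y] *)
Definition killed_walk_prob (n : nat) (x y : V) : R :=
  iter n killed_step (fun v => (v == Some y)%:R) (Some x).

Definition green (x y : V) : R :=
  limn (series (fun n => killed_walk_prob n x y)).

End KilledWalk.

Section GaussianField.
Context {R : realType} {V : choiceType}.

Definition cylinders : set (set (V -> R)) :=
  [set B | exists (x : V) (U : set R),
     measurable U /\ B = [set phi : V -> R | U (phi x)]].

(* R^V with the sigma-algebra generated by the coordinates *)
Definition field_space := g_sigma_algebraType cylinders.

(* [normal_prob 0 0] is not the Dirac mass at 0, hence the case distinction. *)
Definition centered_normal (v : R) (B : set R) : \bar R :=
  if v == 0 then \d_(0 : R) B else normal_prob 0 (Num.sqrt v) B.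

(* Under P the coordinates form a centered Gaussian field with covariance C:
   every finite linear combination of them is centered normal, with the
   variance prescribed by C. *)
Definition centered_gaussian_field (C : V -> V -> R)
    (P : probability field_space R) : Prop :=
  forall (K : {fset V}) (a : V -> R) (B : set R), measurable B ->
    P [set phi : field_space | B (\sum_(x <- K) a x * phi x)] =
    centered_normal (\sum_(x <- K) \sum_(y <- K) a x * a y * C x y) B.

End GaussianField.
Arguments field_space : clear implicits.

Section Events.
Context {R : realType} {V : choiceType} {T : finType}.

Definition increasing (A : {set {ffun T -> bool}}) : Prop :=
  forall w w' : {ffun T -> bool},
    w \in A -> (forall x, w x ==> w' x) -> w' \in A.

(* The event A^h. The map [site] places the index set T of A in V: it is the
   inclusion for T = K a finite subset of V, the identity for T = V. *)
Definition level_event (site : T -> V) (A : {set {ffun T -> bool}}) (h : R) :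
    set (field_space R V) :=
  [set phi : field_space R V | [ffun x : T => h <= phi (site x)] \in A].

Variable P : probability (field_space R V) R.

Definition cond_prob (E F : set (field_space R V)) : R :=
  fine (P (E `&` F)) / fine (P F).

Definition influence (E : set (field_space R V)) (h : R) (x : V) : R :=
  cond_prob E [set phi : field_space R V | h <= phi x] -
  cond_prob E [set phi : field_space R V | phi x < h].

(* Influences of increasing events are nonnegative, so that starting the
   maximum over a nonempty T at 0 is harmless. *)
Definition max_influence (site : T -> V) (A : {set {ffun T -> bool}}) (h : R)
    : R :=
  \big[Num.max/0]_(x : T) influence (level_event site A h) h (site x).

Definition var_indicator (E : set (field_space R V)) : R :=
  fine ('V_P[(\1_E : field_space R V -> R)])%E.

Definition level_prob (site : T -> V) (A : {set {ffun T -> bool}}) (h : R) : R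
  := fine (P (level_event site A h)).

End Events.

Definition shift {V : finZmodType} (x : V) (w : {ffun V -> bool}) :
  {ffun V -> bool} := [ffun y => w (x + y)].

Definition translation_invariant {V : finZmodType}
    (A : {set {ffun V -> bool}}) : Prop :=
  forall x : V, A = [set shift x w | w in A]%SET.

(* Main.v *)
(* Let Q be the inverse of the covariance on K (on the sites of the event).
   It is an M-matrix, and killing makes its row sums s_x at least theta. The
   variable Z = (sum_x s_x phi_x) / (sum_x s_x) is independent of phi - Z, so
   lowering h translates Z only, and Stein's identity gives
     - dP[A^h]/dh = sum_x s_x E[1_{A^h} phi_x].
   Since Q is an M-matrix, the field satisfies the four functions theorem.
   Positive association on {phi_x >= h} and on {phi_x < h} bounds
   E[1_{A^h} phi_x] from below by I(A^h, x) E[phi_x; phi_x >= h], and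
   E[phi_x; phi_x >= h] is bounded below for |h| < M because
   1 <= g(x, x) <= 1 / theta. Hence - dP[A^h]/dh >= c sum_x I(A^h, x).

   To compare the sum of the influences with the variance, reveal the bits
   1{phi_x >= h} one site at a time. Their conditional laws increase with the
   bits already revealed, again by the four functions theorem, so that two
   configurations differing at one site can be coupled monotonically from then
   on. The entropy of a function telescopes along this exploration, which gives
   a log-Sobolev inequality; applied to the martingale differences of 1_{A^h},
   as in Falik and Samorodnitsky's argument, it yields
     Var(1_{A^h}) ln(4 / max_x I) <= 2 sum_x I(A^h, x).
   On the torus all influences are equal by translation invariance. Either
   their common value exceeds |T_L|^{-1/2} and the sum is at least |T_L|^{1/2},
   or the logarithm is at least (ln |T_L|) / 2. *)
Require Import Defs.
From HB Require Import structures.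
From mathcomp Require Import all_boot all_order all_algebra finmap.
From mathcomp Require Import all_classical all_reals all_analysis.
From mathcomp Require Import measurable_realfun.
From mathcomp Require Import ring lra.
Set Implicit Arguments.
Unset Strict Implicit.
Unset Printing Implicit Defensive.
Import Order.TTheory GRing.Theory Num.Theory.
Import numFieldNormedType.Exports.
Local Open Scope classical_set_scope.
Local Open Scope ring_scope.

(** * Log-Sobolev and influence inequalities on a binary tree *)

(** Two obstacles shape the proof. The bits are dependent, so one cannot flip a bit and keep the
    others, as in the argument for product measures; [energy] measures a flip through the monotone
    coupling of the two continuations. Each marginal of the coupling is the exploration itself,
    which makes this energy additive over martingale differences ([energy_mart]) and, for an
    increasing event, equal to a sum of mean pivotalities ([energy_pivotality]). The 4 in the
    logarithm comes from E|X| <= J / 2 for a martingale difference X of mean pivotality J. Second,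
    the field is known only through the laws of its finite linear forms. Independence is therefore
    obtained from characteristic functions, and the four functions theorem is proved without a joint
    density: one coordinate of K at a time is integrated against its conditional normal law, the
    precision matrix being replaced by a Schur complement, which has the same sign pattern. The
    signs and row sums of Q come from a maximum principle for the killed walk. *)

Lemma ln_le_subr1 {R : realType} (x : R) : 0 < x -> ln x <= x - 1.
Proof.
by move=> x0; rewrite -[x in ln x](subrKC 1) le_ln1Dx// ltrBDl subrr.
Qed.

Section Tree.
Context {R : realType} (p : seq bool -> R).
Implicit Types (w v : seq bool) (f g : seq bool -> R) (n : nat).

(** [p w] stands for the probability that the next bit is true given the revealed bits [w], listed
    from the latest to the earliest. *)
Fixpoint tree_mean n w f : R :=
  if n is n'.+1 then
    p w * tree_mean n' (true :: w) f + (1 - p w) * tree_mean n' (false :: w) f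
  else f w.

(** Mean under the monotone coupling of the explorations from [w] and [w'], as if one uniform
    variable decided both next bits. The pair (false, true) never occurs, and the weight
    [p w - p w'] is nonnegative once [w] dominates [w'] and [p] is monotone. *)
Fixpoint pair_mean n w w' (F : seq bool -> seq bool -> R) : R :=
  if n is n'.+1 then
    p w' * pair_mean n' (true :: w) (true :: w') F +
    (p w - p w') * pair_mean n' (true :: w) (false :: w') F +
    (1 - p w) * pair_mean n' (false :: w) (false :: w') F
  else F w w'.

(** At each node the two values of the next bit are continued jointly by the coupling. No factor
    [p w * (1 - p w)] is attached to the node, so that the energy of an increasing indicator is
    exactly a sum of pivotalities. *)
Fixpoint energy n w f : R :=
  if n is n'.+1 then
    pair_mean n' (true :: w) (false :: w) (fun v v' => (f v - f v') ^+ 2) +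
    (p w * energy n' (true :: w) f + (1 - p w) * energy n' (false :: w) f)
  else 0.

Definition dominates w w' := all2 (fun b b' => b' ==> b) w w'.

Lemma dominates_size w w' : dominates w w' -> size w = size w'.
Proof. by rewrite /dominates all2E => /andP[/eqP]. Qed.

Lemma dominates_refl w : dominates w w.
Proof. by elim: w => //= b w IH; rewrite implybb. Qed.

Lemma eq_tree_mean n w f g :
  (forall v, size v = (n + size w)%N -> f v = g v) ->
  tree_mean n w f = tree_mean n w g.
Proof.
elim: n w => [|n IH] w fg /=; first exact: fg.
by rewrite !IH// => v sv; apply: fg; rewrite sv /= addnS.
Qed.

Lemma tree_meanZ n w c f :
  tree_mean n w (fun v => c * f v) = c * tree_mean n w f.
Proof. by elim: n w => //= n IH w; rewrite !IH; ring. Qed.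

Lemma tree_meanB n w f g :
  tree_mean n w (fun v => f v - g v) = tree_mean n w f - tree_mean n w g.
Proof. by elim: n w => //= n IH w; rewrite !IH; ring. Qed.

Lemma tree_mean_cst n w c : tree_mean n w (fun=> c) = c.
Proof. by elim: n w => //= n IH w; rewrite !IH; ring. Qed.

Lemma pair_meanD n w w' F G :
  pair_mean n w w' (fun v v' => F v v' + G v v') =
  pair_mean n w w' F + pair_mean n w w' G.
Proof. by elim: n w w' => //= n IH w w'; rewrite !IH; ring. Qed.

Lemma pair_meanB n w w' F G :
  pair_mean n w w' (fun v v' => F v v' - G v v') =
  pair_mean n w w' F - pair_mean n w w' G.
Proof. by elim: n w w' => //= n IH w w'; rewrite !IH; ring. Qed.

Lemma pair_meanZ n w w' c F :
  pair_mean n w w' (fun v v' => c * F v v') = c * pair_mean n w w' F.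
Proof. by elim: n w w' => //= n IH w w'; rewrite !IH; ring. Qed.

Lemma pair_mean_fst n w w' f :
  pair_mean n w w' (fun v _ => f v) = tree_mean n w f.
Proof. by elim: n w w' => //= n IH w w'; rewrite !IH; ring. Qed.

Lemma pair_mean_snd n w w' f :
  pair_mean n w w' (fun _ v' => f v') = tree_mean n w' f.
Proof. by elim: n w w' => //= n IH w w'; rewrite !IH; ring. Qed.

Lemma sum_pair_meanS n w w' F :
  \sum_(i < n) pair_mean i.+1 w w' F =
  p w' * (\sum_(i < n) pair_mean i (true :: w) (true :: w') F) +
  (p w - p w') * (\sum_(i < n) pair_mean i (true :: w) (false :: w') F) +
  (1 - p w) * (\sum_(i < n) pair_mean i (false :: w) (false :: w') F).
Proof. by rewrite !mulr_sumr -!big_split. Qed.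

Lemma sum_tree_meanS n w f :
  \sum_(i < n) tree_mean i.+1 w f =
  p w * (\sum_(i < n) tree_mean i (true :: w) f) +
  (1 - p w) * (\sum_(i < n) tree_mean i (false :: w) f).
Proof. by rewrite !mulr_sumr -!big_split. Qed.

Hypothesis p01 : forall w, 0 <= p w <= 1.
Hypothesis p_mono : forall w w', dominates w w' -> p w' <= p w.

Let p_ge0 w : 0 <= p w. Proof. by case/andP: (p01 w). Qed.
Let q_ge0 w : 0 <= 1 - p w. Proof. by rewrite subr_ge0; case/andP: (p01 w). Qed.

Let p_le1 w : p w <= 1. Proof. by case/andP: (p01 w). Qed.

Lemma ler_tree_mean n w f g :
  (forall v, size v = (n + size w)%N -> f v <= g v) ->
  tree_mean n w f <= tree_mean n w g.
Proof.
elim: n w => [|n IH] w fg /=; first exact: fg.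
by rewrite lerD// ler_wpM2l// IH// => v sv; apply: fg; rewrite sv /= addnS.
Qed.

Lemma ler_pair_mean n w w' F G : dominates w w' ->
  (forall v v', dominates v v' -> size v = (n + size w)%N -> F v v' <= G v v') ->
  pair_mean n w w' F <= pair_mean n w w' G.
Proof.
elim: n w w' => [|n IH] w w' ww' FG /=; first exact: FG.
rewrite !lerD// ler_wpM2l ?subr_ge0 ?p_mono ?p_le1 ?p_ge0// ?IH//=;
  by move=> v v' vv' sv; apply: FG => //; rewrite sv /= addnS.
Qed.

Lemma eq_pair_mean n w w' F G : dominates w w' ->
  (forall v v', dominates v v' -> size v = (n + size w)%N -> F v v' = G v v') ->
  pair_mean n w w' F = pair_mean n w w' G.
Proof.
by move=> ww' FG; apply/eqP; rewrite eq_le !ler_pair_mean// => v v' vv' sv;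
  rewrite FG.
Qed.

Lemma pair_mean_ge0 n w w' F : dominates w w' ->
  (forall v v', dominates v v' -> 0 <= F v v') ->
  0 <= pair_mean n w w' F.
Proof.
move=> ww' F0; have <- : pair_mean n w w' (fun _ _ => 0) = 0.
  by rewrite pair_mean_fst tree_mean_cst.
by apply: ler_pair_mean => // *; exact: F0.
Qed.

Lemma ler_tree_mean_dom n w w' f : dominates w w' ->
  (forall v v', dominates v v' -> size v = (n + size w)%N -> f v' <= f v) ->
  tree_mean n w' f <= tree_mean n w f.
Proof.
move=> ww' f_incr; rewrite -(pair_mean_fst n w w') -(pair_mean_snd n w w').
exact: ler_pair_mean.
Qed.

Definition entropy n w f : R :=
  tree_mean n w (fun v => f v * ln (f v)) - tree_mean n w f * ln (tree_mean n w f).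

(** This is the tangent of [ln] at [m]; the factor [x] extends the bound to [x = 0]. *)
Lemma xlnx_le (x m : R) : 0 <= x -> 0 < m -> x * ln x <= x * (ln m + x / m - 1).
Proof.
rewrite le_eqVlt => /predU1P[<-|x0] m0; first by rewrite !mul0r.
rewrite ler_pM2l//.
have : ln (x / m) <= x / m - 1.
  by apply: ln_le_subr1; rewrite divr_gt0.
by rewrite ln_div ?posrE//; lra.
Qed.

(** Entropy is at most variance over mean, here t (1 - t) (a - b)^2 / m. The last hypothesis is
    Cauchy-Schwarz, (a - b)^2 <= D S, written as positivity of a quadratic form; combined with t (1
    - t) S <= m it leaves D. *)
Lemma two_point_entropy (t a b D S : R) : 0 <= t <= 1 -> 0 <= a -> 0 <= b ->
  0 <= D -> t * (1 - t) * S <= t * a + (1 - t) * b ->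
  (forall c e : R, 0 <= c ^+ 2 * D - 2 * c * e * (a - b) + e ^+ 2 * S) ->
  t * (a * ln a) + (1 - t) * (b * ln b) -
    (t * a + (1 - t) * b) * ln (t * a + (1 - t) * b) <= D.
Proof.
move=> t01 a0 b0 D0; set m := t * a + (1 - t) * b => Sm disc.
case/andP: t01 => t0; rewrite -subr_ge0 => q0.
have : 0 <= m by rewrite addr_ge0 ?mulr_ge0.
rewrite le_eqVlt => /predU1P[m0|m0].
  have /eqP : m = 0 by [].
  rewrite paddr_eq0 ?mulr_ge0// => /andP[/eqP ta /eqP qb].
  by rewrite -m0 !mulrA ta qb !mul0r subr0 addr0.
have Ha := xlnx_le a0 m0; have Hb := xlnx_le b0 m0.
(* Both logarithms are replaced by their tangents at the mean [m], and the terms in [ln m]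
   cancel. *)
apply: (@le_trans _ _ (t * (1 - t) * (a - b) ^+ 2 / m)).
  apply: le_trans (_ : t * (a * (ln m + a / m - 1)) +
      (1 - t) * (b * (ln m + b / m - 1)) - m * ln m <= _).
    by rewrite lerD2r lerD// ler_wpM2l.
  rewrite le_eqVlt; apply/orP; left; apply/eqP.
  have -> : t * (1 - t) * (a - b) ^+ 2 = t * a ^+ 2 + (1 - t) * b ^+ 2 - m ^+ 2.
    by rewrite /m; ring.
  have mu : m != 0 by rewrite gt_eqF.
  transitivity (m * ln m + (t * a ^+ 2 + (1 - t) * b ^+ 2) / m - m - m * ln m).
    by rewrite {4}/m {1}/m /m; field.
  by field.
rewrite ler_pdivrMr//.
(* With these coefficients, bounding t (1 - t) S by m turns the form into m (D m - t (1 - t) (a -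
   b)^2). *)
have := disc m (t * (1 - t) * (a - b)).
set r := a - b; set s := t * (1 - t) in Sm *.
have s0 : 0 <= s by rewrite mulr_ge0.
move=> H.
suff : 0 <= m * (D * m - s * r ^+ 2) by rewrite pmulr_rge0// subr_ge0.
apply: le_trans H _.
have : s * r ^+ 2 * (s * S) <= s * r ^+ 2 * m by rewrite ler_wpM2l// mulr_ge0 ?sqr_ge0.
by nra.
Qed.

(** Under the coupling, a - b is the mean of (g v - g v') (g v + g v'), which gives the
    Cauchy-Schwarz hypothesis with S the mean of (g v + g v')^2. The bound on S holds pointwise, the
    defect being the square of t g v - (1 - t) g v'. *)
Lemma pair_mean_entropy n w w' (t a b : R) g : 0 <= t <= 1 -> dominates w w' ->
  a = tree_mean n w (fun v => g v ^+ 2) ->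
  b = tree_mean n w' (fun v => g v ^+ 2) ->
  t * (a * ln a) + (1 - t) * (b * ln b) -
    (t * a + (1 - t) * b) * ln (t * a + (1 - t) * b)
  <= pair_mean n w w' (fun v v' => (g v - g v') ^+ 2).
Proof.
move=> t01 ww' aE bE.
have a0 : 0 <= a.
  by rewrite aE -(tree_mean_cst n w 0) ler_tree_mean// => v _; exact: sqr_ge0.
have b0 : 0 <= b.
  by rewrite bE -(tree_mean_cst n w' 0) ler_tree_mean// => v _; exact: sqr_ge0.
apply: (@two_point_entropy t a b _
    (pair_mean n w w' (fun v v' => (g v + g v') ^+ 2))) => //.
- by apply: pair_mean_ge0 => // *; exact: sqr_ge0.
- rewrite aE bE -(pair_mean_fst n w w') -(pair_mean_snd n w w') -!pair_meanZ.
  rewrite -pair_meanD; apply: ler_pair_mean => // v v' _ _.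
  rewrite -subr_ge0.
  have -> : t * g v ^+ 2 + (1 - t) * g v' ^+ 2 - t * (1 - t) * (g v + g v') ^+ 2
      = (t * g v - (1 - t) * g v') ^+ 2 by ring.
  exact: sqr_ge0.
- move=> c e; rewrite aE bE -(pair_mean_fst n w w') -(pair_mean_snd n w w').
  rewrite -pair_meanB -!pair_meanZ -pair_meanB -pair_meanD.
  apply: pair_mean_ge0 => // v v' _.
  have -> : c ^+ 2 * (g v - g v') ^+ 2 - 2 * c * e * (g v ^+ 2 - g v' ^+ 2)
     + e ^+ 2 * (g v + g v') ^+ 2 = (c * (g v - g v') - e * (g v + g v')) ^+ 2 by ring.
  exact: sqr_ge0.
Qed.

(* Log-Sobolev inequality: the entropy telescopes along the tree, and each
   two-point entropy is bounded through the monotone coupling. *)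
Lemma log_sobolev n w g : entropy n w (fun v => g v ^+ 2) <= energy n w g.
Proof.
rewrite /entropy; elim: n w => [|n IH] w /=; first by rewrite subrr.
have dw : dominates (true :: w) (false :: w) by rewrite /= dominates_refl.
have H := pair_mean_entropy (p01 w) dw (erefl _) (erefl _) (n := n) (g := g).
have H1 := ler_wpM2l (p_ge0 w) (IH (true :: w)).
have H0 := ler_wpM2l (q_ge0 w) (IH (false :: w)).
by rewrite !mulrBr in H1 H0; lra.
Qed.

(** Induction on the tree: the means over the two branches are ordered in the same way for [f] and
    [g], by the coupling, so the covariance created by the first bit is p (1 - p) times a product of
    two nonnegative numbers. *)
Lemma tree_mean_association n w f g :
  (forall v v', dominates v v' -> size v = (n + size w)%N -> f v' <= f v) ->
  (forall v v', dominates v v' -> size v = (n + size w)%N -> g v' <= g v) ->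
  tree_mean n w f * tree_mean n w g <= tree_mean n w (fun v => f v * g v).
Proof.
elim: n w => [|n IH] w fi gi //=.
have fi' b v v' : dominates v v' -> size v = (n + size (b :: w))%N -> f v' <= f v.
  by move=> vv' sv; apply: fi => //; rewrite sv /= addnS.
have gi' b v v' : dominates v v' -> size v = (n + size (b :: w))%N -> g v' <= g v.
  by move=> vv' sv; apply: gi => //; rewrite sv /= addnS.
have dw : dominates (true :: w) (false :: w) by rewrite /= dominates_refl.
have f10 := ler_tree_mean_dom dw (fi' true).
have g10 := ler_tree_mean_dom dw (gi' true).
have I1 := ler_wpM2l (p_ge0 w) (IH (true :: w) (fi' true) (gi' true)).
have I0 := ler_wpM2l (q_ge0 w) (IH (false :: w) (fi' false) (gi' false)).
apply: le_trans (lerD I1 I0); rewrite -subr_ge0.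
set f1 := tree_mean n (true :: w) f in f10 *; set f0 := tree_mean n (false :: w) f in f10 *.
set g1 := tree_mean n (true :: w) g in g10 *; set g0 := tree_mean n (false :: w) g in g10 *.
have -> : p w * (f1 * g1) + (1 - p w) * (f0 * g0) -
  (p w * f1 + (1 - p w) * f0) * (p w * g1 + (1 - p w) * g0) =
  p w * (1 - p w) * ((f1 - f0) * (g1 - g0)) by ring.
by rewrite !mulr_ge0// subr_ge0.
Qed.

(** * Martingale differences of an increasing event along the tree *)

Section Martingale.
Variables (N : nat) (f : seq bool -> R).

Definition mart w := tree_mean (N - size w) w f.
(** Increment due to the latest bit, the head of the list; at the root it vanishes, since [behead
    [::]] is [[::]]. *)
Definition mart_diff w := mart w - mart (behead w).

Lemma mart_step w : (size w < N)%N ->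
  mart w = p w * mart (true :: w) + (1 - p w) * mart (false :: w).
Proof. by move=> wN; rewrite /mart /= subnS; case: (N - size w)%N (subn_gt0 (size w) N); rewrite ?wN. Qed.

(** Pythagoras for the coupled pair: both marginals of the coupling are the exploration, so the
    differences of [mart_diff] are martingale increments of the pair and are orthogonal. *)
Lemma pair_mean_mart n v v' : (n + size v = N)%N -> size v = size v' ->
  pair_mean n v v' (fun u u' => (f u - f u') ^+ 2) =
  (mart v - mart v') ^+ 2 +
  \sum_(i < n) pair_mean i.+1 v v' (fun u u' => (mart_diff u - mart_diff u') ^+ 2).
Proof.
elim: n v v' => [|n IH] v v' nN vv'.
  by rewrite big_ord0 addr0 /mart -vv' -nN add0n subnn.
have vN : (size v < N)%N by rewrite -nN addSn ltnS leq_addl.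
have v'N : (size v' < N)%N by rewrite -vv'.
have nN' : (n + (size v).+1 = N)%N by rewrite addnS.
rewrite [LHS]/= sum_pair_meanS !(big_ord_recl n).
rewrite !IH /= -?vv' //.
rewrite /mart_diff /= (mart_step vN) (mart_step v'N).
by ring.
Qed.

(** Each flipped bit contributes a coupled square, which [pair_mean_mart] splits over the later
    levels; regrouping by level yields the energies of the martingale differences. This additivity
    lets the log-Sobolev inequality be used level by level without loss. *)
Lemma energy_mart n w : (n + size w = N)%N ->
  \sum_(i < n) energy i.+1 w mart_diff = energy n w f.
Proof.
elim: n w => [|n IH] w nN; first by rewrite big_ord0.
have E b : \sum_(i < n.+1) energy i (b :: w) mart_diff = energy n (b :: w) f.
  by rewrite big_ord_recl add0r -(IH (b :: w)) //= addnS.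
rewrite /= !big_split /= -!mulr_sumr !E; congr (_ + _).
rewrite pair_mean_mart /= ?addnS// big_ord_recl; congr (_ + _).
by rewrite /= /mart_diff /=; ring.
Qed.

Lemma variance_mart n w : (n + size w = N)%N ->
  tree_mean n w (fun v => f v ^+ 2) =
  mart w ^+ 2 + \sum_(i < n) tree_mean i.+1 w (fun v => mart_diff v ^+ 2).
Proof.
elim: n w => [|n IH] w nN; first by rewrite big_ord0 /mart -nN subnn addr0.
have wN : (size w < N)%N by rewrite -nN addSn ltnS leq_addl.
have nN' : (n + (size w).+1 = N)%N by rewrite addnS.
rewrite [LHS]/= sum_tree_meanS !(big_ord_recl n) !IH //.
by rewrite /= /mart_diff /= (mart_step wN); ring.
Qed.

Hypothesis f01 : forall v, f v = 0 \/ f v = 1.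
Hypothesis f_mono : forall v v', dominates v v' -> f v' <= f v.

Lemma mart_mono w w' : dominates w w' -> mart w' <= mart w.
Proof.
move=> ww'; rewrite /mart (dominates_size ww').
by apply: ler_tree_mean_dom => // *; exact: f_mono.
Qed.

Lemma mart01 w : 0 <= mart w <= 1.
Proof.
rewrite -{1}(tree_mean_cst (N - size w) w 0) -(tree_mean_cst (N - size w) w 1).
by apply/andP; split; apply: ler_tree_mean => // v _; case: (f01 v) => ->.
Qed.

Definition pivotality w := mart (true :: w) - mart (false :: w).

Lemma pivotality_ge0 w : 0 <= pivotality w.
Proof. by rewrite subr_ge0 mart_mono//= dominates_refl. Qed.

(** Along the monotone coupling [f v - f v'] is 0 or 1, hence equal to its square; the energy
    becomes linear in [f] and only the marginals of the coupling matter. *)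
Lemma energy_pivotality n w : (n + size w = N)%N ->
  energy n w f = \sum_(i < n) tree_mean i w pivotality.
Proof.
elim: n w => [|n IH] w nN; first by rewrite big_ord0.
rewrite /= !IH ?addnS// big_ord_recl /= big_split /= -!mulr_sumr; congr (_ + _).
have dw : dominates (true :: w) (false :: w) by rewrite /= dominates_refl.
have -> : pivotality w = pair_mean n (true :: w) (false :: w) (fun v v' => f v - f v').
  rewrite pair_meanB pair_mean_fst pair_mean_snd /pivotality /mart /=.
  by have -> : (N - (size w).+1 = n)%N by rewrite -nN addSnnS addnK.
apply: eq_pair_mean => // v v' vv' _; have := f_mono vv'.
case: (f01 v) => ->; case: (f01 v') => ->; rewrite ?subrr ?expr0n ?subr0 ?expr1n//.
by rewrite ler10.
Qed.

(** Given the past, the increment is (1 - p) J with probability p and - p J otherwise, J being the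
    pivotality. Its mean absolute value is 2 p (1 - p) J, and 4 p (1 - p) <= 1. *)
Lemma mart_diff_l1 i w : (i + size w < N)%N ->
  tree_mean i.+1 w (fun v => `|mart_diff v|) <= 2^-1 * tree_mean i w pivotality.
Proof.
elim: i w => [|i IH] w iN.
  have wN : (size w < N)%N by [].
  rewrite /= /mart_diff /= (mart_step wN).
  have := pivotality_ge0 w; rewrite /pivotality.
  set x := mart _; set y := mart _; have := p_ge0 w; have := q_ge0 w.
  set t := p w => q0 t0 xy.
  have -> : x - (t * x + (1 - t) * y) = (1 - t) * (x - y) by ring.
  have -> : y - (t * x + (1 - t) * y) = - (t * (x - y)) by ring.
  rewrite normrN !normrM !(ger0_norm q0) !(ger0_norm t0) !(ger0_norm xy).
  have : 0 <= (2 * t - 1) ^+ 2 * (x - y) by rewrite mulr_ge0 ?sqr_ge0.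
  by nra.
have H b := IH (b :: w); move: H; rewrite /= addnS -addSn => H.
have H1 := ler_wpM2l (p_ge0 w) (H true iN).
have H0 := ler_wpM2l (q_ge0 w) (H false iN).
by apply: le_trans (lerD H1 H0) _; rewrite /=; lra.
Qed.

(** A variable whose first absolute moment is much smaller than its second moment has a large
    entropy. Here the first moment is at most J / 2 by [mart_diff_l1], and J <= m. *)
Lemma entropy_lower i (m v : R) : (i < N)%N -> 0 < m ->
  tree_mean i [::] pivotality <= m ->
  v = tree_mean i.+1 [::] (fun u => mart_diff u ^+ 2) ->
  v * ln (4 / m) + v - tree_mean i [::] pivotality <=
  entropy i.+1 [::] (fun u => mart_diff u ^+ 2).
Proof.
move=> iN m0; set J := tree_mean i [::] pivotality => Jm vE.
set e := tree_mean i.+1 [::] (fun u => `|mart_diff u|).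
have e0 : 0 <= e by rewrite /e -(tree_mean_cst i.+1 [::] 0) ler_tree_mean.
have eJ : e <= 2^-1 * J by apply: mart_diff_l1; rewrite addn0.
have v0 : 0 <= v.
  by rewrite vE -(tree_mean_cst i.+1 [::] 0) ler_tree_mean// => *; exact: sqr_ge0.
(* For x = |mart_diff u|, the tangent of x ln x at [c] is multiplied by 2 x and averaged; [c] is
   chosen later. *)
have lower c : 0 < c -> 2 * (v * ln c + v - c * e) <=
    tree_mean i.+1 [::] (fun u => mart_diff u ^+ 2 * ln (mart_diff u ^+ 2)).
  move=> c0; have -> : 2 * (v * ln c + v - c * e) = tree_mean i.+1 [::]
      (fun u => 2 * ((ln c + 1) * mart_diff u ^+ 2 - c * `|mart_diff u|)).
    by rewrite tree_meanZ tree_meanB !tree_meanZ -vE -/e; ring.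
  apply: ler_tree_mean => u _.
  have [->|u0] := eqVneq (mart_diff u) 0.
    by rewrite expr0n normr0 /= !mulr0 subr0 mulr0 mul0r.
  rewrite -real_normK ?num_real//; set x := `|mart_diff u|.
  have x0 : 0 < x by rewrite normr_gt0.
  rewrite expr2 lnM ?posrE//.
  suff : (ln c + 1) * x - c <= x * ln x by nra.
  have : ln (c / x) <= c / x - 1.
    by apply: ln_le_subr1; rewrite divr_gt0.
  rewrite ln_div ?posrE// => H.
  have := ler_wpM2l (ltW x0) H; rewrite mulrBr [x * (c / x - 1)]mulrBr mulrCA divff ?gt_eqF//.
  by nra.
rewrite /entropy -vE.
have [v00|vn0] := eqVneq v 0.
  by have := lower 1 ltr01; rewrite v00 ln1; lra.
have vp : 0 < v by rewrite lt_def vn0.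
(* Increments lie in [-1, 1], so the second moment [v] is at most [e]. *)
have ep : 0 < e.
  rewrite lt_def e0 andbT; apply/eqP => e00.
  suff : v <= 0 by rewrite leNgt vp.
  have := lower (v / (m + 1)) (divr_gt0 vp (addr_gt0 m0 ltr01)).
  move=> _; rewrite -e00 vE; apply: ler_tree_mean => u _.
  rewrite -real_normK ?num_real//.
  have : `|mart_diff u| <= 1.
    have := mart01 u; have := mart01 (behead u); rewrite /mart_diff ler_norml; lra.
  by have := normr_ge0 (mart_diff u); nra.
have Jp : 0 < J by lra.
set eps := 2^-1 * J in eJ.
have epsp : 0 < eps by rewrite mulr_gt0.
(* The best [c] is v / e; the upper bound [eps] = J / 2 replaces [e], and this half, inside 2 v ln
   c, is the source of ln 4. *)
have := lower (v / eps) (divr_gt0 vp epsp).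
have ce : v / eps * e <= v by rewrite mulrAC ler_pdivrMr// ler_pM2l.
rewrite ln_div ?posrE//.
have le1 : ln eps = ln J - ln 2 by rewrite /eps lnM ?posrE// lnV ?posrE//; lra.
have l4 : ln (4 / m) = 2 * ln 2 - ln m.
  rewrite ln_div ?posrE//; have -> : (4 : R) = 2 * 2 by lra.
  by rewrite lnM ?posrE//; lra.
have lJm : ln J <= ln m by rewrite ler_ln ?posrE.
have lJv : ln J - ln v <= J / v - 1.
  rewrite -ln_div ?posrE//.
  by apply: ln_le_subr1; rewrite divr_gt0.
rewrite le1 l4.
have := ler_wpM2l v0 lJv; have := ler_wpM2l v0 lJm.
have -> : v * (J / v - 1) = J - v by field.
set lm := ln m; set lJ := ln J; set lv := ln v; set l2 := ln 2.
move=> H1 H2 H3; lra.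
Qed.

(** Summed over the levels, the entropies are at least Var ln (4 / m) minus the sum of the mean
    pivotalities, and by [log_sobolev] at most the total energy, which is that same sum: hence the
    factor 2. Since [f] takes the values 0 and 1, Var is mart - mart^2 at the root. *)
Theorem influence_sum (m : R) : 0 < m ->
  (forall i, (i < N)%N -> tree_mean i [::] pivotality <= m) ->
  (mart [::] - mart [::] ^+ 2) * ln (4 / m) <=
  2 * \sum_(i < N) tree_mean i [::] pivotality.
Proof.
move=> m0 Jm.
have fV : tree_mean N [::] (fun v => f v ^+ 2) = mart [::].
  rewrite /mart subn0; apply: eq_tree_mean => v _.
  by case: (f01 v) => ->; rewrite ?expr0n ?expr1n.
have nN : (N + size (@nil bool) = N)%N by rewrite addn0.
have := @variance_mart N [::] nN; rewrite fV => V.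
have -> : mart [::] - mart [::] ^+ 2 =
    \sum_(i < N) tree_mean i.+1 [::] (fun v => mart_diff v ^+ 2) by rewrite {1}V; ring.
have v0 (i : 'I_N) : 0 <= tree_mean i.+1 [::] (fun v => mart_diff v ^+ 2).
  by rewrite -(tree_mean_cst i.+1 [::] 0) ler_tree_mean// => *; exact: sqr_ge0.
have : \sum_(i < N) (tree_mean i.+1 [::] (fun v => mart_diff v ^+ 2) * ln (4 / m) -
     tree_mean i [::] pivotality) <= \sum_(i < N) tree_mean i [::] pivotality.
  rewrite -energy_pivotality// -energy_mart//; apply: ler_sum => i _.
  apply: le_trans (log_sobolev _ _ _).
  apply: le_trans (entropy_lower (ltn_ord i) m0 (Jm _ (ltn_ord i)) (erefl _)).
  by rewrite lerB// lerDl.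
by rewrite sumrB -mulr_suml; lra.
Qed.

(* Conditioning on the last bit also tilts the earlier ones, in the same
   direction, by positive association. *)
Lemma pivotality_le_influence k :
  let t := tree_mean k [::] p in 0 < t < 1 ->
  tree_mean k [::] pivotality <=
  tree_mean k [::] (fun w => p w * mart (true :: w)) / t -
  tree_mean k [::] (fun w => (1 - p w) * mart (false :: w)) / (1 - t).
Proof.
move=> t /andP[t0 t1]; rewrite tree_meanB.
have M b v v' : dominates v v' -> mart (b :: v') <= mart (b :: v).
  by move=> vv'; apply: mart_mono; rewrite /= implybb.
have := @tree_mean_association k [::] p (fun w => mart (true :: w))
  (fun v v' vv' _ => p_mono vv') (fun v v' vv' _ => M true _ _ vv').
have := @tree_mean_association k [::] p (fun w => mart (false :: w))
  (fun v v' vv' _ => p_mono vv') (fun v v' vv' _ => M false _ _ vv').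
rewrite -/t => H0 H1; apply: lerB.
  by rewrite ler_pdivlMr// mulrC.
rewrite ler_pdivrMr ?subr_gt0//.
have -> : tree_mean k [::] (fun w => (1 - p w) * mart (false :: w)) =
  tree_mean k [::] (fun w => mart (false :: w)) -
  tree_mean k [::] (fun w => p w * mart (false :: w)).
  by rewrite -tree_meanB; apply: eq_tree_mean => v _; ring.
lra.
Qed.

End Martingale.
End Tree.

(** * Normal densities *)

Section Density.
Context d (T : measurableType d) (R : realType).
Variables (mu nu : {measure set T -> \bar R}) (g : T -> R).
Hypothesis mg : measurable_fun setT g.
Hypothesis g0 : forall x, 0 <= g x.
Hypothesis nuE : forall A, measurable A -> nu A = (\int[mu]_(x in A) (g x)%:E)%E.

Import HBNNSimple.

Let integral_density_nnsfun (f : {nnsfun T >-> R}) :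
  (\int[nu]_x (f x)%:E = \int[mu]_x ((f x)%:E * (g x)%:E))%E.
Proof.
under [LHS]eq_integral do rewrite fimfunE -fsumEFin//.
rewrite [LHS]ge0_integral_fsum//; last 2 first.
  - by move=> r; exact/measurable_EFinP/measurableT_comp.
  - by move=> n x _; rewrite EFinM nnfun_muleindic_ge0.
under [RHS]eq_integral.
  move=> x xD; rewrite fimfunE -fsumEFin// muleC ge0_mule_fsumr; last first.
    by move=> r; rewrite EFinM nnfun_muleindic_ge0.
  over.
rewrite [RHS]ge0_integral_fsum//; last 2 first.
  - move=> r; apply: emeasurable_funM; first exact/measurable_EFinP.
    by apply/measurable_EFinP; apply: measurableT_comp.
  - move=> n x _; rewrite EFinM mule_ge0//; first by rewrite lee_fin.
    by rewrite nnfun_muleindic_ge0.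
apply: eq_fsbigr => r _.
rewrite integralZl_indic_nnsfun//= integral_indic//= setIT nuE//.
under [RHS]eq_integral do rewrite EFinM muleCA.
have [r0|r0] := ltP r 0.
  have -> : f @^-1` [set r] = set0.
    by rewrite -subset0 => x /= fxr; have : 0 <= f x by []; rewrite fxr leNgt r0.
  rewrite integral_set0 mule0; apply/esym/integral0_eq => x _.
  by rewrite indic0 mule0 mule0.
rewrite ge0_integralZl//=; last 2 first.
  - apply: emeasurable_funM; first exact/measurable_EFinP.
    by apply/measurable_EFinP; apply: measurable_indic; apply: measurable_sfunP.
  - by move=> x _; rewrite mule_ge0// lee_fin.
congr (_ * _)%E; rewrite integral_mkcond; apply: eq_integral => x _.
by rewrite patchE indicE; case: ifP => _; rewrite ?mule1 ?mule0.
Qed.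

Let ge0_integral_density (f : T -> \bar R) :
  measurable_fun setT f -> (forall x, 0 <= f x)%E ->
  (\int[nu]_x f x = \int[mu]_x (f x * (g x)%:E))%E.
Proof.
move=> mf f0; pose f_ := nnsfun_approx measurableT mf.
transitivity (lim (\int[nu]_x (f_ n x)%:E @[n --> \oo])%E).
  rewrite -monotone_convergence//=.
  - apply: eq_integral => ? /[!inE] xD; apply/esym/cvg_lim => //=.
    exact: cvg_nnsfun_approx.
  - by move=> n; exact/measurable_EFinP/measurable_funTS.
  - by move=> n ? _; rewrite lee_fin.
  - by move=> ? _ ? ? mn; rewrite lee_fin; exact/lefP/nd_nnsfun_approx.
transitivity (lim (\int[mu]_x ((f_ n x)%:E * (g x)%:E) @[n --> \oo])%E).
  by apply: congr_lim; apply/funext => n /=; exact: integral_density_nnsfun.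
rewrite -monotone_convergence//=.
- apply: eq_integral => x _; apply/cvg_lim => //.
  by apply: cvgeZr => //; exact: cvg_nnsfun_approx.
- by move=> n; apply: emeasurable_funM; exact/measurable_EFinP.
- by move=> n x _; rewrite mule_ge0// lee_fin.
- move=> x _ m n mn; rewrite lee_wpmul2r// ?lee_fin//.
  exact/lefP/nd_nnsfun_approx.
Qed.

Lemma integral_density (f : T -> \bar R) : measurable_fun setT f ->
  (\int[nu]_x f x = \int[mu]_x (f x * (g x)%:E))%E.
Proof.
move=> mf; rewrite integralE [RHS]integralE; congr (_ - _)%E.
  rewrite ge0_integral_density//; last exact: measurable_funepos.
  apply: eq_integral => x _.
  by rewrite !funeposE maxe_pMl ?mul0e ?lee_fin.
rewrite ge0_integral_density//; last exact: measurable_funeneg.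
apply: eq_integral => x _.
by rewrite !funenegE -mulNe maxe_pMl ?mul0e ?lee_fin.
Qed.

End Density.

Section Translation.
Context {R : realType}.
Local Notation mu := (@lebesgue_measure R).

Lemma measurable_addr (c : R) :
  measurable_fun setT ((fun x => x + c) : measurableTypeR R -> measurableTypeR R).
Proof. exact: measurable_funD. Qed.

Lemma lebesgue_measure_translation (c : R) (A : set R) : measurable A ->
  pushforward mu ((fun x => x + c) : _ -> measurableTypeR R) A = mu A.
Proof.
move=> mA; apply/esym/lebesgue_measure_unique => //=.
  exact: measurable_addr.
move=> ? _ [[a b]] _ <-.
rewrite /pushforward.
have -> : (fun x => x + c) @^-1` `]a, b]%classic = `]a - c, b - c]%classic.
  by apply/seteqP; split => x /=; rewrite !in_itv /= ltrBlDr lerBrDr.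
rewrite !lebesgue_measure_itv/= !lte_fin ltrD2r -!EFinB.
by have -> : b - c - (a - c) = b - a by ring.
Qed.

Lemma integral_translation (c : R) (f : R -> \bar R) : measurable_fun setT f ->
  (\int[mu]_x f (x + c)%R = \int[mu]_x f x)%E.
Proof.
move=> mf; have ge0 (h : R -> \bar R) : measurable_fun setT h ->
    (forall x, 0 <= h x)%E -> (\int[mu]_x h (x + c)%R = \int[mu]_x h x)%E.
  move=> mh h0; have mc := measurable_addr c.
  rewrite -[LHS](@ge0_integral_pushforward _ _ _ _ _ _ mc mu setT h)//.
  by apply: eq_measure_integral => //= A mA _; exact: lebesgue_measure_translation.
rewrite integralE [RHS]integralE; congr (_ - _)%E.
  rewrite -(ge0 _ (measurable_funepos mf) (funepos_ge0 f)).
  by apply: eq_integral => x _; rewrite !funeposE.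
rewrite -(ge0 _ (measurable_funeneg mf) (funeneg_ge0 f)).
by apply: eq_integral => x _; rewrite !funenegE.
Qed.

End Translation.

Section BoundedExpectation.
Context d (T : measurableType d) (R : realType).

Definition bounded_measurable (f : T -> R) :=
  measurable_fun setT f /\ exists C : R, forall x, `|f x| <= C.

Lemma bounded_measurable_cst (c : R) : bounded_measurable (fun=> c).
Proof. by split; [exact: measurable_cst|exists `|c|]. Qed.

Lemma bounded_measurableD f g : bounded_measurable f -> bounded_measurable g ->
  bounded_measurable (fun x => f x + g x).
Proof.
move=> [mf [C fC]] [mg [D gD]]; split; first exact: measurable_funD.
by exists (C + D) => x; rewrite (le_trans (ler_normD _ _))// lerD.
Qed.

Lemma bounded_measurableM f g : bounded_measurable f -> bounded_measurable g ->
  bounded_measurable (fun x => f x * g x).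
Proof.
move=> [mf [C fC]] [mg [D gD]]; split; first exact: measurable_funM.
by exists (C * D) => x; rewrite normrM ler_pM.
Qed.

Lemma bounded_measurableN f : bounded_measurable f ->
  bounded_measurable (fun x => - f x).
Proof.
move=> [mf [C fC]]; split; first exact: measurableT_comp.
by exists C => x; rewrite normrN.
Qed.

Lemma bounded_measurableB f g : bounded_measurable f -> bounded_measurable g ->
  bounded_measurable (fun x => f x - g x).
Proof. by move=> bf bg; apply: bounded_measurableD => //; exact: bounded_measurableN. Qed.

Lemma bounded_measurable_indic (A : set T) : measurable A ->
  bounded_measurable (\1_A : T -> R).
Proof.
move=> mA; split; first exact: measurable_indic.
by exists 1 => x; rewrite indicE; case: (_ \in _); rewrite /= ?normr1 ?normr0.
Qed.

Variable P : probability T R.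

Lemma bounded_measurable_integrable f : bounded_measurable f ->
  P.-integrable setT (EFin \o f).
Proof.
move=> [mf [C fC]]; apply: measurable_bounded_integrable => //=.
  by rewrite probability_setT ltry.
by exists C; split; [rewrite num_real|move=> x Cx y _; exact: le_trans (fC y) (ltW Cx)].
Qed.

Lemma bounded_cvg_Rintegral (f_ : nat -> T -> R) (f : T -> R) (C : R) :
  (forall n, measurable_fun setT (f_ n)) ->
  (forall n x, `|f_ n x| <= C) ->
  (forall x, f_ ^~ x @ \oo --> f x) ->
  \int[P]_x f_ n x @[n --> \oo] --> \int[P]_x f x.
Proof.
move=> mf fC ff.
have mfl : measurable_fun setT (EFin \o f).
  apply: (emeasurable_fun_cvg (fun n x => (f_ n x)%:E)) => [n|x _].
    exact/measurable_EFinP.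
  by apply: cvg_EFin; [exact: nearW|exact: ff].
have [||||_ _] := @dominated_convergence _ T R P setT measurableT
  (fun n x => (f_ n x)%:E) (EFin \o f) (cst C%:E) _ mfl _ _ _.
- by move=> n; exact/measurable_EFinP.
- by apply: aeW => x _; apply: cvg_EFin; [exact: nearW|exact: ff].
- exact: (bounded_measurable_integrable (bounded_measurable_cst C)).
- by apply: aeW => x n _; rewrite lee_fin.
rewrite /Rintegral => H; apply: (@fine_cvg _ _ _ _ (fun n => \int[P]_x (f_ n x)%:E)%E) => //.
rewrite fineK//; apply: integrable_fin_num => //.
apply: bounded_measurable_integrable; split; first exact/measurable_EFinP.
exists C => x; apply: (cvgr_to_le (cvg_norm (ff x))).
exact: nearW.
Qed.

End BoundedExpectation.

Section NormalMeasure.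
Context {R : realType} (s : R).
Hypothesis s0 : 0 < s.
Local Notation mu := (@lebesgue_measure R).
Local Notation N := (normal_prob (0 : R) s).
Local Notation pdf := (normal_pdf 0 s).

Let sn0 : s != 0. Proof. by rewrite gt_eqF. Qed.

Lemma integral_normal (f : R -> \bar R) : measurable_fun setT f ->
  (\int[N]_x f x = \int[mu]_x (f x * (pdf x)%:E))%E.
Proof.
apply: (@integral_density _ _ _ mu N pdf) => //; first exact: measurable_normal_pdf.
by move=> x; exact: normal_pdf_ge0.
Qed.

Lemma Rintegral_normal (f : R -> R) : measurable_fun setT f ->
  \int[N]_x f x = \int[mu]_x (f x * pdf x).
Proof.
move=> mf; rewrite /Rintegral integral_normal; last exact/measurable_EFinP.
by congr fine; apply: eq_integral => x _; rewrite EFinM.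
Qed.

Lemma Rintegral_translation (c : R) (f : R -> R) : measurable_fun setT f ->
  \int[mu]_x f (x + c) = \int[mu]_x f x.
Proof.
move=> mf; congr fine; apply: (@integral_translation _ c (EFin \o f)).
exact/measurable_EFinP.
Qed.

Lemma normal_pdfE0 x : pdf x = normal_peak s * expR (- x ^+ 2 / (s ^+ 2 *+ 2)).
Proof. by rewrite normal_pdfE// /normal_fun subr0. Qed.

(** Since e^u >= 1 + u, it suffices that s + x^2 / (4 s) - |x| = (|x| - 2 s)^2 / (4 s) is
    nonnegative. *)
Lemma normr_expR_sqr (x : R) : `|x| * expR (- x ^+ 2 / (4 * s ^+ 2)) <= s.
Proof.
rewrite mulNr expRN ler_pdivrMr ?expR_gt0//.
apply: le_trans (_ : s * (1 + x ^+ 2 / (4 * s ^+ 2)) <= _); last first.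
  by rewrite ler_pM2l// expR_ge1Dx.
have -> : s * (1 + x ^+ 2 / (4 * s ^+ 2)) = s + x ^+ 2 / (4 * s) by field.
rewrite -subr_ge0 -(real_normK (num_real x)).
have -> : s + `|x| ^+ 2 / (4 * s) - `|x| = (`|x| - 2 * s) ^+ 2 / (4 * s) by field.
by rewrite divr_ge0 ?sqr_ge0// mulr_ge0// ltW.
Qed.

(* The right-hand side dominates the difference quotients of the translated
   density. *)
Lemma normr_pdf_le (x a h : R) : `|h - a| <= 1 ->
  `|x + h| * pdf (x + h) <=
  s * normal_peak s * expR (1 / (4 * s ^+ 2)) * normal_fun (- a) (2 * s) x.
Proof.
move=> ha; rewrite normal_pdfE0 /normal_fun opprK.
(* One half of the exponent absorbs [|x + h|]. The other is compared with a Gaussian of deviation 2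
   s that does not depend on [h], through (x + a)^2 <= 2 (x + h)^2 + 2 (h - a)^2. *)
have -> : - (x + h) ^+ 2 / (s ^+ 2 *+ 2) =
    - (x + h) ^+ 2 / (4 * s ^+ 2) + - (x + h) ^+ 2 / (4 * s ^+ 2).
  by rewrite -mulr_natl; field.
rewrite expRD.
have -> : `|x + h| * (normal_peak s * (expR (- (x + h) ^+ 2 / (4 * s ^+ 2)) *
    expR (- (x + h) ^+ 2 / (4 * s ^+ 2)))) =
  (`|x + h| * expR (- (x + h) ^+ 2 / (4 * s ^+ 2))) * normal_peak s *
    expR (- (x + h) ^+ 2 / (4 * s ^+ 2)) by ring.
rewrite -[leRHS]mulrA ler_pM ?mulr_ge0 ?expR_ge0 ?normal_peak_ge0//.
  by rewrite ler_wpM2r ?normal_peak_ge0// normr_expR_sqr.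
rewrite -expRD ler_expR.
have -> : - (x + a) ^+ 2 / ((2 * s) ^+ 2 *+ 2) = - ((x + a) ^+ 2 / 2) / (4 * s ^+ 2).
  by rewrite -mulr_natl; field.
rewrite -mulrDl ler_pM2r ?invr_gt0 ?mulr_gt0 ?exprn_gt0//.
have : (h - a) ^+ 2 <= 1 by rewrite -real_normK ?num_real// expr_le1.
have := sqr_ge0 (x + h - (a - h)); nra.
Qed.

Lemma integrable_normal_fun (m t : R) : 0 < t ->
  mu.-integrable setT (EFin \o normal_fun m t).
Proof.
move=> t0; have tn0 : t != 0 by rewrite gt_eqF.
have := integrableZl measurableT (normal_peak t)^-1 (integrable_normal_pdf m t).
apply: eq_integrable => // x _ /=.
by rewrite normal_pdfE// -EFinM mulKf// gt_eqF// normal_peak_gt0.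
Qed.

Lemma integrable_normal (f : R -> R) : measurable_fun setT f ->
  mu.-integrable setT (fun x => (f x * pdf x)%:E) ->
  (N : measure _ R).-integrable setT (EFin \o f).
Proof.
move=> mf /integrableP[_ fi]; apply/integrableP; split; first exact/measurable_EFinP.
rewrite integral_normal; last first.
  by apply: measurableT_comp => //; exact/measurable_EFinP.
apply: le_lt_trans fi; rewrite le_eqVlt; apply/orP; left; apply/eqP.
apply: eq_integral => x _ /=.
by rewrite -EFinM normrM (ger0_norm (normal_pdf_ge0 _ _ _)).
Qed.

Lemma normal_integrable_id : (N : measure _ R).-integrable setT (EFin \o (fun x : R => x)).
Proof.
apply: integrable_normal; first exact: measurable_id.
have s20 : 0 < 2 * s by rewrite mulr_gt0.
have I := integrableZl measurableT
  (s * normal_peak s * expR (1 / (4 * s ^+ 2))) (integrable_normal_fun (- 0) s20).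
apply: le_integrable I => //.
  apply/measurable_EFinP; apply: measurable_funM => //; exact: measurable_normal_pdf.
move=> x _ /=; rewrite !lee_fin normrM (ger0_norm (normal_pdf_ge0 _ _ _)).
rewrite [leRHS]ger0_norm; last first.
  by rewrite !mulr_ge0 ?expR_ge0 ?normal_peak_ge0 ?normal_fun_ge0// ltW.
by have := @normr_pdf_le x 0 0; rewrite subrr normr0 ler01 !addr0; apply.
Qed.

Lemma bounded_measurableM_integrable (F : R -> R) : bounded_measurable F ->
  (N : measure _ R).-integrable setT (EFin \o (fun x : R => F x * x)).
Proof.
move=> [mF [C FC]].
have I := integrableZl measurableT C normal_integrable_id.
apply: le_integrable I => //.
  by apply/measurable_EFinP; apply: measurable_funM => //; exact: measurable_id.
move=> x _ /=; rewrite !lee_fin !normrM ler_wpM2r//.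
exact: le_trans (FC x) (ler_norm _).
Qed.

Lemma is_derive_pdf (x : R) : is_derive x 1 pdf (- x / s ^+ 2 * pdf x).
Proof.
have -> : pdf = (fun x => normal_peak s * expR (- x ^+ 2 / (s ^+ 2 *+ 2))).
  by apply/funext => y; rewrite normal_pdfE0.
apply: is_derive_eq.
rewrite /GRing.scale /= mulr0 add0r !mulr1; set E := expR _; set c := normal_peak s.
by rewrite -[s ^+ 2 *+ 2]mulr_natl; field.
Qed.

End NormalMeasure.

Section NormalShift.
Context {R : realType} (s : R).
Hypothesis s0 : 0 < s.
Local Notation mu := (@lebesgue_measure R).
Local Notation N := (normal_prob (0 : R) s).
Local Notation pdf := (normal_pdf 0 s).

Let sn0 : s != 0. Proof. by rewrite gt_eqF. Qed.

Lemma bounded_measurable_shift (F : R -> R) (c : R) : bounded_measurable F ->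
  bounded_measurable (fun t : R => F (t + c)).
Proof.
move=> [mF [C FC]]; split; last by exists C.
by apply: measurableT_comp => //; exact: measurable_addr.
Qed.

(** [F] is merely bounded and measurable, so the shift is first moved from [F] to the smooth density
    by a change of variables; the derivative is then taken under the integral, and the variables are
    changed back. *)
Lemma is_derive_normal_shift (F : R -> R) (h : R) : bounded_measurable F ->
  is_derive h 1 (fun h => \int[N]_t F (t - h))
    (- (s ^- 2) * \int[N]_t (F (t - h) * t)).
Proof.
move=> bF; have [mF [C FC]] := bF.
pose f h t := F t * pdf (t + h).
have mpdf c : measurable_fun setT (fun t : R => pdf (t + c)).
  by apply: measurableT_comp; [exact: measurable_normal_pdf|exact: measurable_addr].
have fE : (fun h => \int[N]_t F (t - h)) = (fun h => \int[mu]_t f h t).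
  apply/funext => k; have [mk _] := bounded_measurable_shift (- k) bF.
  have mg : measurable_fun setT (fun t : R => F (t - k) * pdf t).
    by apply: measurable_funM => //; exact: measurable_normal_pdf.
  rewrite (Rintegral_normal s mk).
  rewrite -(Rintegral_translation k mg).
  by apply: eq_Rintegral => t _; rewrite addrK.
have df (x y : R) : is_derive x 1 (f ^~ y) (F y * (- (y + x) / s ^+ 2 * pdf (y + x))).
  have dp := is_derive_pdf s0 (y + x).
  have ds : is_derive x 1 (fun x : R => y + x) 1.
    by apply: is_derive_eq; rewrite add0r mulr1.
  have := @is_derive1_comp _ pdf (fun x => y + x) x _ _ dp ds => dc.
  by apply: is_derive_eq; rewrite /GRing.scale /= mulr1.
have d1f (x y : R) : partial1of2 f x y = F y * (- (y + x) / s ^+ 2 * pdf (y + x)).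
  by rewrite partial1of2E; exact: derive_val.
pose G (t : R) := `|C| * s ^- 2 * (s * normal_peak s * expR (1 / (4 * s ^+ 2)) *
  normal_fun (- h) (2 * s) t).
have G0 (t : R) : 0 <= G t.
  by rewrite !mulr_ge0 ?expR_ge0 ?normal_peak_ge0 ?normal_fun_ge0 ?invr_ge0 ?exprn_ge0// ltW.
have s20 : 0 < 2 * s by rewrite mulr_gt0.
have iG : mu.-integrable setT (EFin \o G).
  have I := integrableZl measurableT
    (`|C| * s ^- 2 * (s * normal_peak s * expR (1 / (4 * s ^+ 2))))
    (integrable_normal_fun (- h) s20).
  apply: eq_integrable I => // t _ /=.
  by rewrite /G -EFinM !mulrA.
have intf (x : R) : `]h - 1, h + 1[%classic x -> mu.-integrable setT (EFin \o f x).
  move=> _; have I := integrableZl measurableT `|C| (integrable_normal_pdf (- x) s).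
  apply: le_integrable I => //.
    by apply/measurable_EFinP; apply: measurable_funM; [exact: mF|exact: mpdf].
  move=> t _; rewrite /= lee_fin /f !normrM normr_id.
  rewrite ler_pM//; first by exact: le_trans (FC t) (ler_norm _).
  rewrite !ger0_norm ?normal_pdf_ge0//.
  by rewrite !normal_pdfE// /normal_fun subr0 opprK.
have dom (x y : R) : `]h - 1, h + 1[%classic x -> setT y -> `|partial1of2 f x y| <= G y.
  rewrite /= in_itv /= => /andP[hx xh] _; rewrite d1f normrM /G -[leRHS]mulrA.
  rewrite ler_pM//; first by exact: le_trans (FC y) (ler_norm _).
  rewrite mulrAC normrM normrM normrN (ger0_norm (normal_pdf_ge0 _ _ _)).
  rewrite ger0_norm ?invr_ge0 ?exprn_ge0 ?(ltW s0)// mulrC.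
  rewrite ler_wpM2l ?invr_ge0 ?exprn_ge0 ?(ltW s0)//.
  by apply: normr_pdf_le => //; rewrite ler_norml; lra.
have Ih : `]h - 1, h + 1[%classic h by rewrite /= in_itv /= gtrBl ltrDl ltr01.
have D := @derivable_under_integral _ _ _ mu f setT measurableT h (h - 1) (h + 1)
  Ih intf (fun x y _ _ => @ex_derive _ _ _ _ _ _ _ (df x y)) G G0 iG dom.
have V := @differentiation_under_integral _ _ _ mu f setT measurableT h (h - 1) (h + 1)
  Ih intf (fun x y _ _ => @ex_derive _ _ _ _ _ _ _ (df x y)) G G0 iG dom.
rewrite fE; apply: DeriveDef => //.
rewrite -derive1E V.
have [mh _] := bounded_measurable_shift (- h) bF.
have mFh : measurable_fun setT (fun t : R => F (t - h) * t).
  by apply: measurable_funM => //; exact: measurable_id.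
rewrite -RintegralZl//; last exact: (bounded_measurableM_integrable s0 (bounded_measurable_shift (- h) bF)).
have mZ : measurable_fun setT (fun t : R => - s ^- 2 * (F (t - h) * t)).
  by apply: measurable_funM.
rewrite (Rintegral_normal s mZ).
have mg : measurable_fun setT (fun t : R => - s ^- 2 * (F (t - h) * t) * pdf t).
  by apply: measurable_funM => //; exact: measurable_normal_pdf.
rewrite -[RHS](Rintegral_translation h mg).
apply: eq_Rintegral => t _; rewrite d1f addrK.
by rewrite mulNr; ring.
Qed.

Lemma bounded_measurable_cos (t b : R) : bounded_measurable (fun x : R => cos (t * x + b)).
Proof.
split; last by exists 1 => x; rewrite ler_norml cos_geN1 cos_le1.
apply: measurableT_comp; first exact: (continuous_measurable_fun (@continuous_cos R)).
by apply: measurable_funD => //; apply: measurable_funM.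
Qed.

Lemma bounded_measurable_sin (t b : R) : bounded_measurable (fun x : R => sin (t * x + b)).
Proof.
split; last by exists 1 => x; rewrite ler_norml sin_geN1 sin_le1.
apply: measurableT_comp; first exact: (continuous_measurable_fun (@continuous_sin R)).
by apply: measurable_funD => //; apply: measurable_funM.
Qed.

(* Differentiating the translates of [sin (t x + b)] gives Stein's identity. *)
Lemma normal_stein_sin (t b : R) :
  \int[N]_x (sin (t * x + b) * x) = s ^+ 2 * t * \int[N]_x cos (t * x + b).
Proof.
have D' : is_derive (0 : R) 1 (fun h => cos (t * h) * \int[N]_x sin (t * x + b) -
    sin (t * h) * \int[N]_x cos (t * x + b)) (- t * \int[N]_x cos (t * x + b)).
  have dt : is_derive (0 : R) 1 (fun h => t * h) t.
    by apply: is_derive_eq; rewrite /GRing.scale /= mulr1.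
  have dc := @is_derive1_comp _ (@cos R) (fun h => t * h) 0 _ _ (is_derive_cos _) dt.
  have dn := @is_derive1_comp _ (@sin R) (fun h => t * h) 0 _ _ (is_derive_sin _) dt.
  by apply: is_derive_eq; rewrite /GRing.scale /= !mulr0 sin0 cos0; ring.
have D := is_derive_normal_shift 0 (bounded_measurable_sin t b).
have HE : (fun h => \int[N]_x sin (t * (x - h) + b)) =
    (fun h => cos (t * h) * \int[N]_x sin (t * x + b) -
              sin (t * h) * \int[N]_x cos (t * x + b)).
  apply/funext => h.
  have bc := bounded_measurable_integrable N (bounded_measurable_cos t b).
  have bs := bounded_measurable_integrable N (bounded_measurable_sin t b).
  rewrite -!RintegralZl// -RintegralB//; last 2 first.
  - apply: bounded_measurable_integrable; apply: bounded_measurableM (bounded_measurable_sin t b).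
    exact: bounded_measurable_cst.
  - apply: bounded_measurable_integrable; apply: bounded_measurableM (bounded_measurable_cos t b).
    exact: bounded_measurable_cst.
  apply: eq_Rintegral => x _.
  have -> : t * (x - h) + b = (t * x + b) - t * h by ring.
  by rewrite sinB; ring.
rewrite HE in D.
have E0 : \int[N]_x (sin (t * (x - 0) + b) * x) = \int[N]_x (sin (t * x + b) * x).
  by apply: eq_Rintegral => x _; rewrite subr0.
have := @derive_val _ _ _ _ _ _ _ D; rewrite (@derive_val _ _ _ _ _ _ _ D') E0 => E.
have -> : s ^+ 2 * t * \int[N]_x cos (t * x + b) =
  - (s ^+ 2 * (- t * \int[N]_x cos (t * x + b))) by ring.
by rewrite E; field.
Qed.

Lemma is_derive_normal_cos (t b : R) :
  is_derive t 1 (fun t => \int[N]_x cos (t * x + b))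
    (- \int[N]_x (sin (t * x + b) * x)).
Proof.
pose f (t x : R) := cos (t * x + b).
have df (t' x : R) : is_derive t' 1 (f ^~ x) (- (sin (t' * x + b) * x)).
  have dt : is_derive t' 1 (fun t => t * x + b) x.
    by apply: is_derive_eq; rewrite /GRing.scale /=; ring.
  have := @is_derive1_comp _ (@cos R) (fun t => t * x + b) t' _ _ (is_derive_cos _) dt.
  by rewrite mulNr.
have d1f (t' x : R) : partial1of2 f t' x = - (sin (t' * x + b) * x).
  by rewrite partial1of2E; exact: derive_val.
have iG : (N : measure _ R).-integrable setT (EFin \o (fun x : R => `|x|)).
  exact: (integrable_abse (normal_integrable_id s0)).
have intf (x : R) : `]t - 1, t + 1[%classic x -> (N : measure _ R).-integrable setT (EFin \o f x).
  by move=> _; apply: bounded_measurable_integrable; exact: bounded_measurable_cos.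
have dom (x y : R) : `]t - 1, t + 1[%classic x -> setT y -> `|partial1of2 f x y| <= `|y|.
  move=> _ _; rewrite d1f normrN normrM ler_piMl//.
  by rewrite ler_norml sin_geN1 sin_le1.
have It : `]t - 1, t + 1[%classic t by rewrite /= in_itv /= gtrBl ltrDl ltr01.
have D := @derivable_under_integral _ _ _ (N : measure _ R) f setT measurableT t (t - 1) (t + 1)
  It intf (fun x y _ _ => @ex_derive _ _ _ _ _ _ _ (df x y)) _ (@normr_ge0 _ _) iG dom.
have V := @differentiation_under_integral _ _ _ (N : measure _ R) f setT measurableT t (t - 1) (t + 1)
  It intf (fun x y _ _ => @ex_derive _ _ _ _ _ _ _ (df x y)) _ (@normr_ge0 _ _) iG dom.
apply: DeriveDef => //; rewrite -derive1E V.
rewrite -mulN1r -RintegralZl//; last first.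
  exact: (bounded_measurableM_integrable s0 (bounded_measurable_sin t b)).
by apply: eq_Rintegral => x _; rewrite d1f mulN1r.
Qed.

(** By Stein's identity the left side K satisfies K' = - s^2 t K, so K exp(s^2 t^2 / 2) is constant.
    The phase [b] makes this real formula carry the whole characteristic function. *)
Lemma Rintegral_normal_cos (t b : R) :
  \int[N]_x cos (t * x + b) = cos b * expR (- (s ^+ 2 * t ^+ 2) / 2).
Proof.
pose K t := \int[N]_x cos (t * x + b).
pose G t := K t * expR (s ^+ 2 * t ^+ 2 / 2).
have dG (u : R) : is_derive u 1 G 0.
  have dK := is_derive_normal_cos u b.
  have dq : is_derive u 1 (fun t => s ^+ 2 * t ^+ 2 / 2) (s ^+ 2 * u).
    by apply: is_derive_eq; rewrite /GRing.scale /= !mulr0 ?addr0 ?add0r; field.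
  have de := @is_derive1_comp _ (@expR R) (fun t => s ^+ 2 * t ^+ 2 / 2) u _ _ (is_derive_expR _) dq.
  apply: is_derive_eq; rewrite /GRing.scale /= normal_stein_sin /K; ring.
have : G t = G 0 by apply: is_derive_0_is_cst.
rewrite /G /K expr0n /= mulr0 mul0r expR0 mulr1.
have -> : \int[N]_x cos (0 * x + b) = cos b.
  under eq_Rintegral do rewrite mul0r add0r.
  by rewrite Rintegral_cst//= probability_setT mulr1.
move=> <-; rewrite -[RHS]mulrA -expRD.
have -> : s ^+ 2 * t ^+ 2 / 2 + - (s ^+ 2 * t ^+ 2) / 2 = 0 by field.
by rewrite expR0 mulr1.
Qed.

End NormalShift.

(** * Trigonometric uniqueness of laws on R^V *)

Section FieldMeasurability.
Context {R : realType} {W : choiceType}.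

Lemma measurable_coord (w : W) :
  measurable_fun setT (fun phi : field_space R W => phi w : R).
Proof.
move=> _ U mU; rewrite setTI; apply: sub_sigma_algebra.
by exists w, U; split.
Qed.

Lemma measurable_to_field d (T : measurableType d) (f : T -> field_space R W) :
  (forall w, measurable_fun setT (fun t => f t w : R)) -> measurable_fun setT f.
Proof.
move=> mf; apply: (@measurability _ _ _ (field_space R W) setT f cylinders) => //.
move=> _ [_ [w [U [mU ->]]] <-]; rewrite setTI.
by have := mf w measurableT U mU; rewrite setTI.
Qed.

Definition linear_form (l : seq (R * W)) (phi : field_space R W) : R :=
  \sum_(i <- l) i.1 * phi i.2.

Lemma measurable_linear_form l : measurable_fun setT (linear_form l).
Proof.
by apply: measurable_sum => i; apply: measurable_funM => //; exact: measurable_coord.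
Qed.

Lemma bounded_measurable_cos_form l b :
  bounded_measurable (fun phi => cos (linear_form l phi + b)).
Proof.
have [m [C bC]] := @bounded_measurable_cos R 1 b; split; last first.
  by exists C => phi; have := bC (linear_form l phi); rewrite mul1r.
apply: measurableT_comp; first exact: (continuous_measurable_fun (@continuous_cos R)).
by apply: measurable_funD => //; exact: measurable_linear_form.
Qed.

(** The phases make sines and constants instances of [trig_cos], and the product-to-sum formula
    makes the class an algebra. The mean of every member is determined by the means of the
    cosines. *)
Inductive trig_poly : (field_space R W -> R) -> Prop :=
| trig_cos l b : trig_poly (fun phi => cos (linear_form l phi + b))
| trig_add f g : trig_poly f -> trig_poly g -> trig_poly (fun phi => f phi + g phi)
| trig_scale c f : trig_poly f -> trig_poly (fun phi => c * f phi).

Lemma trig_mul f g : trig_poly f -> trig_poly g -> trig_poly (fun phi => f phi * g phi).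
Proof.
elim=> {f}[l b|f1 f2 _ I1 _ I2|c f _ IH] Tg; last 2 first.
- under [X in trig_poly X]funext do rewrite mulrDl.
  by apply: trig_add; [exact: I1|exact: I2].
- under [X in trig_poly X]funext do rewrite -mulrA.
  by apply: trig_scale; exact: IH.
elim: Tg => {g}[m c|g1 g2 _ I1 _ I2|c g _ IH]; last 2 first.
- by under [X in trig_poly X]funext do rewrite mulrDr; exact: trig_add.
- by under [X in trig_poly X]funext do rewrite mulrCA; exact: trig_scale.
have -> : (fun phi => cos (linear_form l phi + b) * cos (linear_form m phi + c)) =
  (fun phi => 2^-1 * cos (linear_form (l ++ m) phi + (b + c)) +
   2^-1 * cos (linear_form (l ++ [seq (- i.1, i.2) | i <- m]) phi + (b - c))).
  apply/funext => phi; rewrite /linear_form !big_cat /= big_map /=.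
  under [X in _ + X + (b - c)]eq_bigr do rewrite mulNr.
  rewrite sumrN -/(linear_form l phi) -/(linear_form m phi).
  set u := linear_form l phi; set v := linear_form m phi.
  have -> : u + v + (b + c) = (u + b) + (v + c) by ring.
  have -> : u - v + (b - c) = (u + b) - (v + c) by ring.
  by move: (u + b) (v + c) => x y; rewrite cosD cosB; field.
by apply: trig_add; apply: trig_scale; exact: trig_cos.
Qed.

Lemma trig_const c : trig_poly (fun=> c).
Proof.
have := @trig_scale c _ (trig_cos [::] 0).
rewrite /linear_form; under [X in trig_poly X -> _]funext do rewrite big_nil addr0 cos0 mulr1.
by [].
Qed.

Lemma trig_sin l b : trig_poly (fun phi => sin (linear_form l phi + b)).
Proof.
have := trig_cos l (b - pi / 2).
under [X in trig_poly X -> _]funext => phi do rewrite addrA cosB cos_pihalf sin_pihalf mulr0 add0r mulr1.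
by [].
Qed.

Lemma trig_prod (I : Type) (s : seq I) (f : I -> field_space R W -> R) :
  (forall i, trig_poly (f i)) -> trig_poly (fun phi => \prod_(i <- s) f i phi).
Proof.
move=> Tf; elim: s => [|i s IH].
  by under [X in trig_poly X]funext do rewrite big_nil; exact: trig_const.
by under [X in trig_poly X]funext do rewrite big_cons; exact: trig_mul.
Qed.

Lemma trig_bounded_measurable f : trig_poly f -> bounded_measurable f.
Proof.
elim=> {f}[l b|f g _ bf _ bg|c f _ bf].
- exact: bounded_measurable_cos_form.
- exact: bounded_measurableD.
- by apply: bounded_measurableM => //; exact: bounded_measurable_cst.
Qed.

End FieldMeasurability.

Section SignApproximation.
Context {R : realType}.

(* The iterates of [s |-> (3 s - s^3) / 2] converge to the sign on [-1, 1]. *)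
Definition sign_step (s : R) := (3 * s - s ^+ 3) / 2.

Lemma sign_step_ge (s : R) : 0 <= s <= 1 -> s <= sign_step s <= 1.
Proof.
move=> /andP[s0 s1]; rewrite /sign_step; apply/andP; split.
  rewrite -subr_ge0; have -> : (3 * s - s ^+ 3) / 2 - s = s * (1 - s) * (1 + s) / 2 by field.
  by rewrite divr_ge0// !mulr_ge0//; [rewrite subr_ge0|rewrite addr_ge0].
rewrite -subr_ge0; have -> : 1 - (3 * s - s ^+ 3) / 2 = (1 - s) ^+ 2 * (2 + s) / 2 by field.
by rewrite divr_ge0// mulr_ge0 ?sqr_ge0// addr_ge0.
Qed.

Lemma sign_stepN s : sign_step (- s) = - sign_step s.
Proof. by rewrite /sign_step; field. Qed.

Lemma iter_sign_step_ge n (s : R) : 0 <= s <= 1 -> s <= iter n sign_step s <= 1.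
Proof.
move=> /andP[s0 s1]; elim: n => [|n /andP[IH1 IH2]] /=; first by rewrite lexx.
have /andP[H1 H2] : iter n sign_step s <= sign_step (iter n sign_step s) <= 1.
  by apply: sign_step_ge; rewrite (le_trans s0 IH1).
by rewrite (le_trans IH1 H1).
Qed.

Lemma iter_sign_stepN n s : iter n sign_step (- s) = - iter n sign_step s.
Proof. by elim: n => //= n ->; rewrite sign_stepN. Qed.

Lemma iter_sign_step_norm n (s : R) : `|s| <= 1 -> `|iter n sign_step s| <= 1.
Proof.
have [s0|s0] := leP 0 s.
  move=> s1; have /andP[H1 H2] : s <= iter n sign_step s <= 1.
    by apply: iter_sign_step_ge; rewrite s0 (le_trans (ler_norm s)).
  by rewrite ger0_norm// (le_trans s0 H1).
move=> s1; rewrite -(opprK s) iter_sign_stepN normrN.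
have /andP[H1 H2] : - s <= iter n sign_step (- s) <= 1.
  by apply: iter_sign_step_ge; rewrite oppr_ge0 ltW//= (le_trans (ler_norm _))// normrN.
by rewrite ger0_norm ?(le_trans _ H1)// oppr_ge0 ltW.
Qed.

(** One step multiplies 1 - x by 1 - (x + x^2) / 2. The iterates never fall below [s], so this
    factor is at most 1 - s / 2. *)
Lemma sign_step_geometric n (s : R) : 0 <= s <= 1 ->
  1 - iter n sign_step s <= (1 - s / 2) ^+ n.
Proof.
move=> s01; have /andP[s0 s1] := s01.
elim: n => [|n IH]; first by rewrite expr0 /=; lra.
rewrite iterS exprS; have /andP[] := iter_sign_step_ge n s01.
set x := iter n sign_step s in IH *; move=> sx x1.
have -> : 1 - sign_step x = (1 - (x + x ^+ 2) / 2) * (1 - x).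
  by rewrite /sign_step; field.
have x2 := sqr_ge0 x.
apply: ler_pM => //; nra.
Qed.

Lemma cvg_iter_sign_step (s : R) : `|s| <= 1 ->
  iter n sign_step s @[n --> \oo] --> Num.sg s.
Proof.
have pos (x : R) : 0 < x -> x <= 1 -> iter n sign_step x @[n --> \oo] --> (1 : R).
  move=> x0 x1; have x01 : 0 <= x <= 1 by rewrite x1 ltW.
  apply: (@squeeze_cvgr _ _ _ _ (fun n => 1 - (1 - x / 2) ^+ n) (fun=> 1)).
  - apply: nearW => n; have := sign_step_geometric n x01.
    by have /andP[_ ->] := iter_sign_step_ge n x01; rewrite andbT lerBlDr -lerBlDl.
  - rewrite -[X in _ --> X]subr0; apply: cvgB; first exact: cvg_cst.
    by apply: cvg_expr; rewrite ger0_norm; lra.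
  - exact: cvg_cst.
have [s0|s0|->] := ltgtP s 0.
- rewrite ltr0_sg// ltr0_norm// => s1.
  have -> : (fun n => iter n sign_step s) = (fun n => - iter n sign_step (- s)).
    by apply/funext => n; rewrite iter_sign_stepN opprK.
  by apply: cvgN; apply: pos => //; rewrite oppr_gt0.
- move=> s1; rewrite gtr0_sg//; apply: pos => //; exact: le_trans (ler_norm s) s1.
- move=> _; rewrite sgr0.
  have -> : (fun n => iter n sign_step (0 : R)) = fun=> 0.
    by apply/funext; elim=> //= n ->; rewrite /sign_step; field.
  exact: cvg_cst.
Qed.

(** Dividing by m + 1 brings the argument into (-pi, pi), where the sine has the sign of its
    argument; the added 1 / (m + 1) makes [y = 0] count as positive, as the closed half-lines of
    level events require. *)
Lemma near_sg_sin (y : R) :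
  \forall m \near \oo, Num.sg (sin ((y + m.+1%:R^-1) / m.+1%:R)) = if 0 <= y then 1 else -1.
Proof.
have m0 m : 0 < m.+1%:R :> R by rewrite ltr0n.
have L : \forall m \near \oo, (`|y| + 1) < m.+1%:R.
  near=> m; rewrite -natr1 ltrD2r; near: m; exact: nbhs_infty_gtr.
have pi1 : 1 < pi :> R.
  by have := @pi_ge2 R; lra.
have bnd m : `|y| + 1 < m.+1%:R -> `|(y + m.+1%:R^-1) / m.+1%:R| < pi.
  move=> ym; rewrite normrM [X in _ * X]ger0_norm ?invr_ge0// ltr_pdivrMr//.
  apply: le_lt_trans (ler_normD _ _) _.
  rewrite [X in _ + X]ger0_norm ?invr_ge0//.
  have H1 : m.+1%:R^-1 <= 1 :> R by rewrite invf_le1// ler1n.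
  have H2 : m.+1%:R < pi * m.+1%:R :> R by rewrite ltr_pMl.
  by apply: le_lt_trans (lt_trans ym H2); rewrite lerD2l.
have [y0|y0] := leP 0 y.
  near=> m; rewrite gtr0_sg// sin_gt0_pi//; apply/andP; split.
    by rewrite divr_gt0// ltr_wpDl// invr_gt0.
  by apply: le_lt_trans (ler_norm _) (bnd _ _); near: m.
near=> m.
have ym : `|y| + 1 < m.+1%:R by near: m.
have yn : y + m.+1%:R^-1 < 0.
  rewrite -ltrBrDl sub0r -[X in _ < X]invrK ltf_pV2 ?posrE ?invr_gt0 ?oppr_gt0//.
  by near: m; near=> m; apply: (@lt_trans _ _ m%:R); [near: m; exact: nbhs_infty_gtr|rewrite ltr_nat].
rewrite ltr0_sg// -oppr_gt0 -sinN sin_gt0_pi//; apply/andP; split.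
  by rewrite oppr_gt0 pmulr_llt0// invr_gt0.
by apply: le_lt_trans (ler_norm _) _; rewrite normrN bnd.
Unshelve. all: end_near. Qed.

End SignApproximation.

Lemma cvg_prod_seq {R : realType} (I : Type) (s : seq I) (f_ : nat -> I -> R) (f : I -> R) :
  (forall i, f_ n i @[n --> \oo] --> f i) ->
  \prod_(i <- s) f_ n i @[n --> \oo] --> \prod_(i <- s) f i.
Proof.
move=> cf; elim: s => [|i s IH].
  rewrite big_nil; under [X in X @ _]funext do rewrite big_nil; exact: cvg_cst.
rewrite big_cons; under [X in X @ _]funext do rewrite big_cons.
exact: cvgM.
Qed.

Section Uniqueness.
Context {R : realType} {W : choiceType}.
Local Notation F := (field_space R W).

Definition upper_orthant (L : seq (W * R)) : set F :=
  [set phi | all (fun p => p.2 <= phi p.1) L].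

Lemma measurable_upper_orthant L : measurable (upper_orthant L).
Proof.
elim: L => [|p L IH]; first by rewrite (_ : upper_orthant _ = setT)// -subTset.
have -> : upper_orthant (p :: L) = [set phi | p.2 <= phi p.1] `&` upper_orthant L.
  by apply/seteqP; split => phi /=; rewrite /upper_orthant /= => /andP.
apply: measurableI => //.
have := measurable_coord p.1 measurableT (measurable_itv `[p.2, +oo[).
by rewrite setTI; congr measurable; apply/seteqP; split => phi /=; rewrite in_itv /= andbT.
Qed.

Lemma trig_iter_sign_step n (f : F -> R) :
  trig_poly f -> trig_poly (fun phi => iter n sign_step (f phi)).
Proof.
move=> Tf; elim: n => [//|n IH] /=.
have -> : (fun phi => sign_step (iter n sign_step (f phi))) =
  (fun phi => (3 / 2) * iter n sign_step (f phi) + (- 2^-1) * (iter n sign_step (f phi) *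
   (iter n sign_step (f phi) * iter n sign_step (f phi)))).
  by apply/funext => phi; rewrite /sign_step; field.
by apply: trig_add; apply: trig_scale => //; do 2 apply: trig_mul => //.
Qed.

(** Two successive limits give the indicator of the orthant: [n] turns the sine into its sign, then
    [m] turns that sign into the sign of the coordinate minus its threshold. *)
Let approx (L : seq (W * R)) m n (phi : F) : R :=
  \prod_(p <- L) ((1 + iter n sign_step
    (sin ((phi p.1 - p.2 + m.+1%:R^-1) / m.+1%:R))) / 2).

Let trig_approx L m n : trig_poly (approx L m n).
Proof.
apply: trig_prod => p.
set c := m.+1%:R : R.
have T : trig_poly (fun phi : F => sin ((phi p.1 - p.2 + c^-1) / c)).
  have -> : (fun phi : F => sin ((phi p.1 - p.2 + c^-1) / c)) =
      (fun phi => sin (linear_form [:: (c^-1, p.1)] phi + (- p.2 + c^-1) / c)).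
    by apply/funext => phi; rewrite /linear_form big_seq1 /=; congr sin; ring.
  exact: trig_sin.
have -> : (fun phi : F => (1 + iter n sign_step (sin ((phi p.1 - p.2 + c^-1) / c))) / 2) =
   (fun phi => 2^-1 + 2^-1 * iter n sign_step (sin ((phi p.1 - p.2 + c^-1) / c))).
  by apply/funext => phi; field.
apply: trig_add; first exact: trig_const.
by apply: trig_scale; exact: trig_iter_sign_step.
Qed.

Let approx_le1 L m n phi : `|approx L m n phi| <= 1.
Proof.
rewrite /approx normr_prod; elim: L => [|p L IH]; first by rewrite big_nil.
rewrite big_cons mulr_ile1//.
  by apply: prodr_ge0 => *.
have : `|iter n sign_step (sin ((phi p.1 - p.2 + m.+1%:R^-1) / m.+1%:R))| <= 1.
  by apply: iter_sign_step_norm; rewrite ler_norml sin_geN1 sin_le1.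
rewrite !ler_norml; lra.
Qed.

Let approx_oo L m (phi : F) : R :=
  \prod_(p <- L) ((1 + Num.sg (sin ((phi p.1 - p.2 + m.+1%:R^-1) / m.+1%:R))) / 2).

Let cvg_approx L m (phi : F) : approx L m n phi @[n --> \oo] --> approx_oo L m phi.
Proof.
apply: cvg_prod_seq => p; apply: cvgM; last exact: cvg_cst.
apply: cvgD; first exact: cvg_cst.
by apply: cvg_iter_sign_step; rewrite ler_norml sin_geN1 sin_le1.
Qed.

Let cvg_approx_oo L (phi : F) :
  approx_oo L m phi @[m --> \oo] --> (\1_(upper_orthant L) phi : R).
Proof.
have -> : (\1_(upper_orthant L) phi : R) =
    \prod_(p <- L) ((1 + (if 0 <= phi p.1 - p.2 then 1 else -1)) / 2).
  rewrite indicE; elim: L => [|p L IH].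
    by rewrite big_nil mem_set.
  rewrite big_cons -IH subr_ge0.
  have [pp|pp] /= := boolP (p.2 <= phi p.1).
    rewrite -[1 + 1]/2%:R divff ?mul1r ?pnatr_eq0//.
    have [a|a] := boolP (all (fun p => p.2 <= phi p.1) L).
      by rewrite !mem_set//=; apply/andP.
    by rewrite !memNset//=; [exact/negP|apply/negP; rewrite negb_and a orbT].
  by rewrite subrr !mul0r memNset//=; apply/negP; rewrite negb_and pp.
apply: cvg_prod_seq => p; apply: cvgM; last exact: cvg_cst.
apply: cvgD; first exact: cvg_cst.
apply: cvg_near_cst; exact: near_sg_sin.
Qed.

Variables mu1 mu2 : probability F R.
Hypothesis same_trig : forall (l : seq (R * W)) (b : R),
  \int[mu1]_phi cos (linear_form l phi + b) = \int[mu2]_phi cos (linear_form l phi + b).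

Let same_trig_poly f : trig_poly f -> \int[mu1]_phi f phi = \int[mu2]_phi f phi.
Proof.
elim=> {f}[l b|f g Tf If Tg Ig|c f Tf If]; first exact: same_trig.
- have bf := trig_bounded_measurable Tf; have bg := trig_bounded_measurable Tg.
  by rewrite !RintegralD ?If ?Ig//; exact: bounded_measurable_integrable.
- have bf := trig_bounded_measurable Tf.
  by rewrite !RintegralZl ?If//; exact: bounded_measurable_integrable.
Qed.

Let same_approx_oo L m : \int[mu1]_phi approx_oo L m phi = \int[mu2]_phi approx_oo L m phi.
Proof.
have C (mu : probability F R) :
    \int[mu]_phi approx L m n phi @[n --> \oo] --> \int[mu]_phi approx_oo L m phi.
  apply: (@bounded_cvg_Rintegral _ _ _ mu _ _ 1) => // n.
  by have [] := trig_bounded_measurable (trig_approx L m n).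
apply: (cvg_unique _ (C mu1)) => //.
have -> : (fun n => \int[mu1]_phi approx L m n phi) = (fun n => \int[mu2]_phi approx L m n phi).
  by apply/funext => n; exact/same_trig_poly/trig_approx.
exact: C.
Qed.

Let same_orthant L : mu1 (upper_orthant L) = mu2 (upper_orthant L).
Proof.
have C (mu : probability F R) :
    \int[mu]_phi approx_oo L m phi @[m --> \oo] --> fine (mu (upper_orthant L)).
  have -> : fine (mu (upper_orthant L)) = \int[mu]_phi (\1_(upper_orthant L) phi).
    by rewrite /Rintegral integral_indic ?setIT//; exact: measurable_upper_orthant.
  apply: (@bounded_cvg_Rintegral _ _ _ mu _ _ 1) => [m|m phi|//].
    apply/measurable_EFinP; apply: (emeasurable_fun_cvg (fun n phi => (approx L m n phi)%:E)).
      by move=> n; have [? _] := trig_bounded_measurable (trig_approx L m n); exact/measurable_EFinP.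
    by move=> phi _; apply: cvg_EFin; [exact: nearW|exact: cvg_approx].
  by apply: (cvgr_to_le (cvg_norm (@cvg_approx L m phi))); exact: nearW.
suff : fine (mu1 (upper_orthant L)) = fine (mu2 (upper_orthant L)).
  move=> E; rewrite -[LHS]fineK ?fin_num_measure//; last exact: measurable_upper_orthant.
  by rewrite E fineK// fin_num_measure//; exact: measurable_upper_orthant.
apply: (cvg_unique _ (C mu1)) => //.
have -> : (fun m => \int[mu1]_phi approx_oo L m phi) = (fun m => \int[mu2]_phi approx_oo L m phi).
  by apply/funext => m; exact: same_approx_oo.
exact: C.
Qed.

Let orthants : set (set F) := [set B | exists L, B = upper_orthant L].

Let orthants_generate : @measurable _ F `<=` <<s orthants >>.
Proof.
apply: smallest_sub; first exact: smallest_sigma_algebra.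
move=> _ [w [U [mU ->]]].
have mw : measurable_fun setT
    (fun phi : g_sigma_algebraType orthants => (phi : W -> R) w : R).
  apply: (measurability _ (RGenCInfty.measurableE R)).
  move=> _ [_ [h ->] <-]; rewrite setTI; apply: sub_sigma_algebra.
  exists [:: (w, h)]; apply/seteqP; split => phi /=;
    by rewrite /upper_orthant /= in_itv /= !andbT.
by have := mw measurableT U mU; rewrite setTI.
Qed.

(* Products of half-line indicators are bounded limits of trigonometric
   polynomials, and upper orthants form a generating pi-system. *)
Theorem field_measure_unique A : measurable A -> mu1 A = mu2 A.
Proof.
move=> mA; apply: (@g_sigma_algebra_measure_unique _ R F orthants _ (fun=> setT)) => //.
- by move=> _ [L ->]; exact: measurable_upper_orthant.
- by move=> _; exists [::]; apply/esym; rewrite -subTset.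
- by rewrite bigcup_const.
- move=> _ _ [L ->] [M ->]; exists (L ++ M); apply/seteqP; split => phi;
    by rewrite /upper_orthant /= all_cat => /andP.
- by move=> _ [L ->]; exact: same_orthant.
- by move=> _; rewrite /= probability_setT ltry.
- exact: orthants_generate.
Qed.

End Uniqueness.

(** * Gaussian fields *)

Section ImageProbability.
Context d1 d2 (T1 : measurableType d1) (T2 : measurableType d2) (R : realType).
Variables (P : probability T1 R) (f : T1 -> T2).
Hypothesis mf : measurable_fun setT f.

Let f_mixin := isMeasurableFun.Build _ _ _ _ _ mf.
Let f_pack : {mfun T1 >-> T2} := HB.pack f f_mixin.

Definition image_prob : probability T2 R := distribution P f_pack.

Lemma image_probE A : image_prob A = P (f @^-1` A).
Proof. by []. Qed.

Lemma ge0_integral_image_prob (g : T2 -> \bar R) :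
  measurable_fun setT g -> (forall y, (0 <= g y)%E) ->
  (\int[image_prob]_y g y = \int[P]_x g (f x))%E.
Proof. by move=> mg g0; rewrite /image_prob ge0_integral_distribution. Qed.

Lemma Rintegral_image_prob (g : T2 -> R) : bounded_measurable g ->
  \int[image_prob]_y g y = \int[P]_x g (f x).
Proof.
move=> [mg [C gC]]; rewrite /Rintegral /image_prob integral_distribution//.
  exact/measurable_EFinP.
apply: bounded_measurable_integrable; split; last by exists C => x; exact: gC.
exact: measurableT_comp.
Qed.

End ImageProbability.

Lemma Rintegral_prod d1 d2 (T1 : measurableType d1) (T2 : measurableType d2)
  (R : realType) (P : probability T1 R) (Q : probability T2 R) (f : T1 * T2 -> R) :
  bounded_measurable f ->
  \int[(P \x Q)%E]_z f z = \int[P]_x \int[Q]_y f (x, y).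
Proof.
move=> bf; have [mf [C fC]] := bf.
have I := bounded_measurable_integrable ((P \x Q)%E : probability _ R) bf.
rewrite {1}/Rintegral -(integral12_prod_meas1 I) /Rintegral; congr fine.
apply: eq_integral => x _; rewrite /fubini_F fineK//.
apply: integrable_fin_num => //.
apply: (@bounded_measurable_integrable _ _ _ Q (fun y => f (x, y))).
split; last by exists C.
exact: measurableT_comp.
Qed.

Section GaussianVector.
Context {R : realType} {V : choiceType} (C : V -> V -> R).
Variable P : probability (field_space R V) R.
Hypothesis gaussP : centered_gaussian_field C P.
Hypothesis C_sym : forall x y, C x y = C y x.

Section Form.
Variable K : {fset V}.

Definition fset_form (a : V -> R) (phi : field_space R V) : R := \sum_(x <- K) a x * phi x.
Definition bilin (a b : V -> R) : R := \sum_(x <- K) \sum_(y <- K) a x * b y * C x y.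

Lemma bilin_sym a b : bilin a b = bilin b a.
Proof.
rewrite /bilin exchange_big; apply: eq_bigr => x _; apply: eq_bigr => y _.
by rewrite C_sym; ring.
Qed.

Lemma bilinDr a b b' : bilin a (fun x => b x + b' x) = bilin a b + bilin a b'.
Proof.
by rewrite -big_split; apply: eq_bigr => x _; rewrite -big_split; apply: eq_bigr => y _ /=; ring.
Qed.

Lemma bilinZr c a b : bilin a (fun x => c * b x) = c * bilin a b.
Proof.
by rewrite mulr_sumr; apply: eq_bigr => x _; rewrite mulr_sumr; apply: eq_bigr => y _ /=; ring.
Qed.

Lemma bilin_sumr a (I : Type) (s : seq I) (f : I -> V -> R) :
  bilin a (fun x => \sum_(i <- s) f i x) = \sum_(i <- s) bilin a (f i).
Proof.
elim: s => [|i s IH].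
  rewrite big_nil /bilin; apply: big1 => x _; apply: big1 => y _.
  by rewrite big_nil mulr0 mul0r.
by rewrite big_cons -IH -bilinDr; congr bilin; apply/funext => x; rewrite big_cons.
Qed.

Lemma bilinDl a a' b : bilin (fun x => a x + a' x) b = bilin a b + bilin a' b.
Proof. by rewrite bilin_sym bilinDr !(bilin_sym b). Qed.

Lemma bilinZl c a b : bilin (fun x => c * a x) b = c * bilin a b.
Proof. by rewrite bilin_sym bilinZr bilin_sym. Qed.

Lemma measurable_fset_form a : measurable_fun setT (fset_form a).
Proof.
by apply: measurable_sum => x; apply: measurable_funM => //; exact: measurable_coord.
Qed.

Hypothesis bilin_ge0 : forall a, 0 <= bilin a a.

Lemma gauss_law (a : V -> R) (f : R -> R) : bilin a a != 0 -> bounded_measurable f ->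
  \int[P]_phi f (fset_form a phi) = \int[normal_prob (0 : R) (Num.sqrt (bilin a a))]_t f t.
Proof.
move=> an0 bf; rewrite -(@Rintegral_image_prob _ _ _ (measurableTypeR R) R P _ (measurable_fset_form a) _ bf).
congr fine; apply: eq_measure_integral => A mA _.
by have := gaussP K a mA; rewrite /centered_normal (negbTE an0).
Qed.

(** The formula also covers forms of zero variance, whose law is a Dirac mass and not a
    [normal_prob]; hence the two cases. *)
Lemma gauss_cos (a : V -> R) (b : R) :
  \int[P]_phi cos (fset_form a phi + b) = cos b * expR (- bilin a a / 2).
Proof.
have [m bm] := @bounded_measurable_cos R 1 b.
have bc : bounded_measurable (fun t : R => cos (t + b)).
  by have := @bounded_measurable_cos R 1 b; under eq_fun do rewrite mul1r.
have [a0|an0] := eqVneq (bilin a a) 0.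
  rewrite -(@Rintegral_image_prob _ _ _ (measurableTypeR R) R P _ (measurable_fset_form a) _ bc).
  rewrite a0 oppr0 mul0r expR0 mulr1.
  transitivity (fine (\int[@dirac _ (measurableTypeR R) (0:R)%R R]_t (cos (t + b)%R)%:E)%E).
    congr fine; apply: eq_measure_integral => A mA _.
    by have := gaussP K a mA; rewrite /centered_normal [X in X == 0]a0 eqxx.
  rewrite integral_dirac//; last by apply/measurable_EFinP; have [] := bc.
  by rewrite diracT mul1e add0r.
rewrite (gauss_law an0 bc).
have s0 : 0 < Num.sqrt (bilin a a) by rewrite sqrtr_gt0 lt_def an0 bilin_ge0.
have := Rintegral_normal_cos s0 1 b.
under eq_Rintegral do rewrite mul1r.
by move=> ->; rewrite sqr_sqrtr// expr1n mulr1.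
Qed.

Section Independence.
Variables (V' : choiceType) (a0 : V -> R) (a : V' -> V -> R).
Hypothesis var_gt0 : 0 < bilin a0 a0.
Hypothesis uncorrelated : forall w, bilin a0 (a w) = 0.

Local Notation N := (normal_prob (0 : R) (Num.sqrt (bilin a0 a0))).

Definition forms (phi : field_space R V) : field_space R V' := fun w => fset_form (a w) phi.

Lemma measurable_forms : measurable_fun setT forms.
Proof. by apply: measurable_to_field => w; exact: measurable_fset_form. Qed.

(** A family together with one more variable is again a field, indexed by [option V'], so that
    [field_measure_unique] applies to joint laws. *)
Definition extend (p : field_space R V' * R) : field_space R (option V') :=
  fun o => if o is Some w then p.1 w else p.2.

Lemma measurable_extend : measurable_fun setT extend.
Proof.
apply: measurable_to_field => -[w|] /=; last exact: measurable_snd.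
exact: (measurableT_comp (measurable_coord w) measurable_fst).
Qed.

Definition restrict_opt (psi : field_space R (option V')) : field_space R V' * R :=
  ((fun w => psi (Some w)), psi None).

Lemma measurable_restrict_opt : measurable_fun setT restrict_opt.
Proof.
apply: measurable_fun_pair; last exact: measurable_coord.
by apply: measurable_to_field => w; exact: measurable_coord.
Qed.

Let joint (phi : field_space R V) := extend (forms phi, fset_form a0 phi).
Let split (p : field_space R V * R) := extend (forms p.1, p.2).

Let mjoint : measurable_fun setT joint.
Proof.
apply: measurableT_comp; first exact: measurable_extend.
by apply: measurable_fun_pair; [exact: measurable_forms|exact: measurable_fset_form].
Qed.

Let msplit : measurable_fun setT split.
Proof.
apply: measurableT_comp; first exact: measurable_extend.
apply: measurable_fun_pair; last exact: measurable_snd.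
by apply: measurableT_comp; [exact: measurable_forms|exact: measurable_fst].
Qed.

Let c (l : seq (R * option V')) : R := \sum_(i <- l) (if i.2 is Some _ then 0 else i.1).
Let e (l : seq (R * option V')) (x : V) : R :=
  \sum_(i <- l) (if i.2 is Some w then i.1 * a w x else 0).

Let linear_extend l psi t :
  linear_form l (extend (psi, t)) =
  c l * t + \sum_(i <- l) (if i.2 is Some w then i.1 * psi w else 0).
Proof.
rewrite /linear_form /c mulr_suml -big_split; apply: eq_bigr => -[u [w|]] _ /=.
  by rewrite mul0r add0r.
by rewrite addr0.
Qed.

Let form_e l phi :
  \sum_(i <- l) (if i.2 is Some w then i.1 * fset_form (a w) phi else 0) = fset_form (e l) phi.
Proof.
rewrite /fset_form /e; under [RHS]eq_bigr do rewrite mulr_suml.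
rewrite exchange_big /=; apply: eq_bigr => -[u [w|]] _ /=.
  by rewrite mulr_sumr; apply: eq_bigr => x _; rewrite mulrA.
by rewrite big1// => x _; rewrite mul0r.
Qed.

Let bilin_e l : bilin a0 (e l) = 0.
Proof.
rewrite /e bilin_sumr big1// => -[u [w|]] _ /=.
  by rewrite bilinZr uncorrelated mulr0.
by rewrite /bilin big1// => x _; rewrite big1// => y _; rewrite mulr0 mul0r.
Qed.

(** A linear form in the joint field is c times the form of [a0] plus a form uncorrelated with it.
    The cross terms of the variance vanish, so the characteristic function factorizes as for the
    product law. *)
Lemma joint_law A : measurable A ->
  image_prob P mjoint A = image_prob (P \x N)%E msplit A.
Proof.
apply: field_measure_unique => l b.
have bcos := bounded_measurable_cos_form l b.
rewrite !Rintegral_image_prob// Rintegral_prod; last first.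
  have [m [D bD]] := bcos; split; last by exists D => ?; exact: bD.
  exact: (measurableT_comp m msplit).
have s0 : 0 < Num.sqrt (bilin a0 a0) by rewrite sqrtr_gt0.
transitivity (cos b * expR (- bilin (fun x => c l * a0 x + e l x)
   (fun x => c l * a0 x + e l x) / 2)).
  rewrite -gauss_cos; apply: eq_Rintegral => phi _.
  rewrite linear_extend form_e; congr (cos (_ + _)).
  rewrite /fset_form mulr_sumr -big_split; apply: eq_bigr => x _ /=; ring.
transitivity (\int[P]_phi (expR (- (c l ^+ 2 * bilin a0 a0) / 2) * cos (fset_form (e l) phi + b))).
  rewrite RintegralZl//; last first.
    apply: bounded_measurable_integrable.
    have := @bounded_measurable_cos R 1 b => -[m [D bD]]; split; last first.
      by exists D => phi; have := bD (fset_form (e l) phi); rewrite mul1r.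
    apply: measurableT_comp; first exact: (continuous_measurable_fun (@continuous_cos R)).
    by apply: measurable_funD => //; exact: measurable_fset_form.
  rewrite gauss_cos mulrCA -expRD; congr (_ * expR _).
  rewrite !(bilinDl, bilinDr, bilinZl, bilinZr) bilin_e (bilin_sym (e l)) bilin_e.
  by move: (c l) (bilin a0 a0) (bilin (e l) (e l)) => u v z; ring.
apply: eq_Rintegral => phi _.
transitivity (\int[N]_t cos (c l * t + (fset_form (e l) phi + b))).
  by rewrite (Rintegral_normal_cos s0) sqr_sqrtr ?bilin_ge0// mulrC (mulrC (bilin a0 a0)).
by apply: eq_Rintegral => t _; rewrite /split linear_extend form_e addrA.
Qed.

(** Uncorrelated parts of a Gaussian family are independent; [joint_law] is transported through
    [restrict_opt], a left inverse of [extend]. *)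
Lemma gauss_independence (g : field_space R V' * R -> \bar R) :
  measurable_fun setT g -> (forall p, (0 <= g p)%E) ->
  (\int[P]_phi g (forms phi, fset_form a0 phi) =
   \int[P]_phi \int[N]_t g (forms phi, t))%E.
Proof.
move=> mg g0.
have mr : measurable_fun setT (g \o restrict_opt).
  by apply: measurableT_comp => //; exact: measurable_restrict_opt.
have rE psi t : restrict_opt (extend (psi, t)) = (psi, t) by [].
transitivity (\int[image_prob P mjoint]_psi (g \o restrict_opt) psi)%E.
  by rewrite ge0_integral_image_prob//= => y; exact: g0.
transitivity (\int[image_prob (P \x N)%E msplit]_psi (g \o restrict_opt) psi)%E.
  by apply: eq_measure_integral => A mA _; exact: joint_law.
rewrite ge0_integral_image_prob//= fubini_tonelli1//.
exact: (measurableT_comp mr msplit).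
Qed.

End Independence.
End Form.
End GaussianVector.

(** * The four functions theorem for Gaussian fields *)

Section FourFunctions.
Context {R : realType}.
Local Open Scope ereal_scope.
Local Notation mu := (@lebesgue_measure R).

(** From (c - a) (c - b) >= 0 one gets c (a + b) <= c^2 + a b <= c (c + d), and [c] is divided
    out. *)
Lemma lee_four (a b c d : \bar R) : 0 <= a -> 0 <= b -> 0 <= d ->
  a <= c -> b <= c -> a * b <= c * d -> a + b <= c + d.
Proof.
case: c => [c| |] //; last first.
- by move=> a0 _ _ ac; have := le_trans a0 ac.
- by move=> _ _ d0 _ _ _; rewrite addye ?leey// gt_eqF// (lt_le_trans _ d0).
case: a => [a| |]//; case: b => [b| |]//; case: d => [d| |]//.
  rewrite !lee_fin => a0 b0 d0 ac bc abcd.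
  have [c0|c0] := leP c 0%R; first by lra.
  rewrite -(ler_pM2l c0); have := mulr_ge0 (eqbRL (subr_ge0 _ _) ac) (eqbRL (subr_ge0 _ _) bc).
  by nra.
by move=> *; rewrite addey// leey.
Qed.

Lemma lee_double (a b : \bar R) : 0 <= a -> 0 <= b -> a + a <= b + b -> a <= b.
Proof.
case: a => [a| |]//; case: b => [b| |]//; rewrite ?leey// !lee_fin; lra.
Qed.

(** Twice the product of two integrals is the double integral of f(x) g(y) + f(y) g(x). After this
    symmetrization the inequality holds pointwise, so the plane need not be cut along the
    diagonal. *)
Lemma four_functions (f1 f2 f3 f4 : R -> \bar R) :
  measurable_fun setT f1 -> measurable_fun setT f2 ->
  measurable_fun setT f3 -> measurable_fun setT f4 ->
  (forall x, 0 <= f1 x) -> (forall x, 0 <= f2 x) ->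
  (forall x, 0 <= f3 x) -> (forall x, 0 <= f4 x) ->
  (forall x y, f1 x * f2 y <= f3 (Num.max x y) * f4 (Num.min x y)) ->
  (\int[mu]_x f1 x) * (\int[mu]_x f2 x) <= (\int[mu]_x f3 x) * (\int[mu]_x f4 x).
Proof.
move=> m1 m2 m3 m4 p1 p2 p3 p4 H.
have prodE (f g : R -> \bar R) : measurable_fun setT f -> measurable_fun setT g ->
    (forall x, 0 <= f x) -> (forall x, 0 <= g x) ->
    (\int[mu]_x f x) * (\int[mu]_x g x) + (\int[mu]_x f x) * (\int[mu]_x g x) =
    \int[mu]_x \int[mu]_y (f x * g y + f y * g x).
  move=> mf mg f0 g0.
  have If : 0 <= \int[mu]_x f x by exact: integral_ge0.
  have Ig : 0 <= \int[mu]_x g x by exact: integral_ge0.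
  transitivity (\int[mu]_x (f x * \int[mu]_y g y + g x * \int[mu]_y f y)).
    rewrite ge0_integralD//.
    - by rewrite !ge0_integralZr// [X in _ + X]muleC.
    - by move=> x _; rewrite mule_ge0.
    - exact: emeasurable_funM.
    - by move=> x _; rewrite mule_ge0.
    - exact: emeasurable_funM.
  apply: eq_integral => x _; rewrite ge0_integralD//.
  - rewrite ge0_integralZl// ge0_integralZr//; congr (_ + _); exact: muleC.
  - by move=> y _; rewrite mule_ge0.
  - exact: emeasurable_funM.
  - by move=> y _; rewrite mule_ge0.
  - exact: emeasurable_funM.
apply: lee_double.
- by rewrite mule_ge0// integral_ge0.
- by rewrite mule_ge0// integral_ge0.
rewrite (prodE f1 f2 m1 m2 p1 p2) (prodE f3 f4 m3 m4 p3 p4).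
have minner (f g : R -> \bar R) x : measurable_fun setT f -> measurable_fun setT g ->
    measurable_fun setT (fun y => f x * g y + f y * g x).
  by move=> mf mg; apply: emeasurable_funD; apply: emeasurable_funM.
have mouter (f g : R -> \bar R) : measurable_fun setT f -> measurable_fun setT g ->
    (forall x, 0 <= f x) -> (forall x, 0 <= g x) ->
    measurable_fun setT (fun x => \int[mu]_y (f x * g y + f y * g x)).
  move=> mf mg f0 g0.
  apply: (@measurable_fun_fubini_tonelli_F _ _ _ _ R mu
     (fun p : R * R => f p.1 * g p.2 + f p.2 * g p.1)).
    by apply: emeasurable_funD; apply: emeasurable_funM; apply: measurableT_comp.
  by move=> p; rewrite adde_ge0// mule_ge0.
apply: ge0_le_integral => //.
- by move=> x _; apply: integral_ge0 => y _; rewrite adde_ge0// mule_ge0.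
- exact: mouter.
- exact: mouter.
move=> x _; apply: ge0_le_integral => //.
- by move=> y _; rewrite adde_ge0// mule_ge0.
- exact: minner.
- exact: minner.
move=> y _.
wlog xy : x y / (x <= y)%R.
  move=> W; have [|/ltW] := leP x y; first exact: W.
  by move=> /W; rewrite [X in X <= _]addeC [X in _ <= X]addeC.
have Hxx := H x x; have Hyy := H y y; have Hxy := H x y; have Hyx := H y x.
rewrite maxxx minxx in Hxx; rewrite maxxx minxx in Hyy.
rewrite (max_r xy) (min_l xy) in Hxy; rewrite (max_l xy) (min_r xy) in Hyx.
(* For x <= y both left terms are at most f3(y) f4(x), by the hypothesis at (x, y) and (y, x); their
   product is controlled by the hypothesis at (x, x) and (y, y). *)
rewrite [leRHS]addeC; apply: lee_four => //; rewrite ?mule_ge0//.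
have -> : f1 x * f2 y * (f1 y * f2 x) = (f1 x * f2 x) * (f1 y * f2 y).
  by rewrite muleACA [f2 y * f2 x]muleC muleACA.
have -> : f3 y * f4 x * (f3 x * f4 y) = (f3 x * f4 x) * (f3 y * f4 y).
  by rewrite [LHS]muleC muleACA [f4 y * f4 x]muleC muleACA.
by apply: lee_pmul => //; rewrite mule_ge0.
Qed.

End FourFunctions.

(** * Inverse covariances with nonpositive off-diagonal entries *)

Section Precision.
Context {R : realType} {V : choiceType} (C : V -> V -> R).
Hypothesis C_sym : forall x y, C x y = C y x.
Hypothesis C_ge0 : forall K a, 0 <= bilin C K a a.

Definition precision (K : {fset V}) (Q : V -> V -> R) :=
  [/\ {in K &, forall x y, Q x y = Q y x},
      {in K &, forall x z, \sum_(y <- K) Q x y * C y z = (x == z)%:R} &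
      {in K &, forall x y, x != y -> Q x y <= 0}].

(** Rows of [Q] are dual to the coordinates: the form with coefficients [Q n] has covariance 1 with
    coordinate [n] and 0 with the others. Conditioning on the other coordinates rests on this. *)
Lemma precision_row K Q n : precision K Q -> n \in K ->
  forall b, bilin C K (Q n) b = b n.
Proof.
move=> [_ inv _] nK b; rewrite /bilin exchange_big /= (big_fsetD1 n)//=.
rewrite [X in _ + X]big1_fset ?addr0.
  have E : \sum_(y <- K) Q n y * C y n = 1 by rewrite inv// eqxx.
  transitivity (b n * \sum_(y <- K) Q n y * C y n); last by rewrite E mulr1.
  by rewrite mulr_sumr; apply: eq_bigr => x _; ring.
move=> y; rewrite !inE => /andP[yn yK] _.
have := inv n y nK yK; rewrite eq_sym (negbTE yn) => E.
transitivity (b y * \sum_(x <- K) Q n x * C x y).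
  by rewrite mulr_sumr; apply: eq_bigr => x _; ring.
by rewrite E mulr0.
Qed.

Lemma precision_diag_gt0 K Q n : precision K Q -> n \in K -> 0 < Q n n.
Proof.
move=> pQ nK; have row := precision_row pQ nK.
have Q0 : 0 <= Q n n by rewrite -(row (Q n)); exact: C_ge0.
rewrite lt_def Q0 andbT; apply/eqP => Qn0.
pose d (x : V) : R := (x == n)%:R.
have dd : 0 <= bilin C K d d by exact: C_ge0.
set c := bilin C K d d in dd.
(* If [Q n n] were 0, the variance of row [n] plus [t] times coordinate [n] would be 2 t + t^2 c,
   which is negative at this [t]. *)
pose t := - (c + 1)^-1.
have : 0 <= bilin C K (fun x => Q n x + t * d x) (fun x => Q n x + t * d x) by exact: C_ge0.
rewrite !(bilinDl C_sym, bilinDr, bilinZl C_sym, bilinZr) row row (bilin_sym C_sym K d) row.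
rewrite /d eqxx Qn0 -/d -/c /t.
have c1 : c + 1 != 0 by rewrite gt_eqF// ltr_wpDl.
have -> : 0 + - (c + 1)^-1 * 1 + (- (c + 1)^-1 * 1 + - (c + 1)^-1 * (- (c + 1)^-1 * c)) =
   - ((c + 2) / (c + 1) ^+ 2) by field.
rewrite oppr_ge0 leNgt divr_gt0 ?exprn_gt0//; lra.
Qed.

Definition schur (Q : V -> V -> R) n x y := Q x y - Q x n * Q n y / Q n n.

(** Deleting a coordinate from the covariance amounts to taking a Schur complement of its inverse.
    The sign condition survives because a product of two nonpositive entries over a positive pivot
    is subtracted. *)
Lemma precision_schur K Q n : precision K Q -> n \in K ->
  precision (K `\ n)%fset (schur Q n).
Proof.
move=> pQ nK; have Qn := precision_diag_gt0 pQ nK.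
have Qn0 : Q n n != 0 by rewrite gt_eqF.
case: (pQ) => sym inv off; split.
- move=> x y; rewrite !inE => /andP[_ xK] /andP[_ yK].
  by rewrite /schur (sym x y)// (sym x n)// (sym y n)//; ring.
- move=> x z; rewrite !inE => /andP[xn xK] /andP[zn zK].
  have E1 := inv x z xK zK; have E2 := inv n z nK zK.
  rewrite eq_sym (negbTE zn) in E2.
  rewrite (big_fsetD1 n)//= in E1; rewrite (big_fsetD1 n)//= in E2.
  transitivity (\sum_(y <- (K `\ n)%fset) Q x y * C y z -
      Q x n / Q n n * \sum_(y <- (K `\ n)%fset) Q n y * C y z).
    by rewrite mulr_sumr -sumrB; apply: eq_bigr => y _; rewrite /schur; ring.
  have -> : \sum_(y <- (K `\ n)%fset) Q n y * C y z = - (Q n n * C n z) by lra.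
  by rewrite -E1; field.
- move=> x y; rewrite !inE => /andP[xn xK] /andP[yn yK] xy.
  have H1 := off x y xK yK xy; have H2 := off x n xK nK xn.
  have H3 : Q n y <= 0 by apply: off => //; rewrite eq_sym.
  have : 0 <= Q x n * Q n y / Q n n by rewrite divr_ge0 ?mulr_le0// ltW.
  by rewrite /schur; lra.
Qed.

Definition quad (K : {fset V}) (Q : V -> V -> R) (phi : V -> R) : R :=
  \sum_(x <- K) \sum_(y <- K) Q x y * (phi x * phi y).

Lemma quad_schur K Q n phi : precision K Q -> n \in K ->
  quad K Q phi =
  Q n n * (phi n + (\sum_(j <- (K `\ n)%fset) Q n j * phi j) / Q n n) ^+ 2 +
  quad (K `\ n)%fset (schur Q n) phi.
Proof.
move=> pQ nK; have Qn0 : Q n n != 0 by rewrite gt_eqF// (precision_diag_gt0 pQ).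
case: pQ => sym _ _; set l := \sum_(j <- _) _.
have E1 : \sum_(y <- K) Q n y * (phi n * phi y) = Q n n * phi n ^+ 2 + phi n * l.
  rewrite (big_fsetD1 n)//= /l mulr_sumr; congr (_ + _).
  by apply: eq_bigr => y _; ring.
have E2 : \sum_(x <- (K `\ n)%fset) \sum_(y <- K) Q x y * (phi x * phi y) =
    phi n * l + \sum_(x <- (K `\ n)%fset) \sum_(y <- (K `\ n)%fset) Q x y * (phi x * phi y).
  rewrite /l mulr_sumr -big_split; apply: eq_big_seq => x /=.
  rewrite !inE => /andP[xn xK].
  by rewrite (big_fsetD1 n)//= sym//; ring.
have E3 : quad (K `\ n)%fset (schur Q n) phi =
    \sum_(x <- (K `\ n)%fset) \sum_(y <- (K `\ n)%fset) Q x y * (phi x * phi y) - l ^+ 2 / Q n n.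
  have -> : l ^+ 2 / Q n n = \sum_(x <- (K `\ n)%fset) \sum_(y <- (K `\ n)%fset)
      (Q n x * phi x * (Q n y * phi y) / Q n n).
    rewrite expr2 -mulrA {1}/l mulr_suml; apply: eq_bigr => x _.
    by rewrite /l mulr_suml mulr_sumr; apply: eq_bigr => y _; ring.
  rewrite -sumrB; apply: eq_big_seq => x; rewrite !inE => /andP[_ xK].
  rewrite -sumrB; apply: eq_big_seq => y; rewrite !inE => /andP[_ yK].
  by rewrite /schur (sym x n)//; ring.
by rewrite {1}/quad (big_fsetD1 n)//= E1 E2 E3; field.
Qed.

(** By rearrangement, max max + min min exceeds the sum of the two original products; the
    nonpositive off-diagonal entries reverse this, and on the diagonal there is equality. Thus exp(-
    quad / 2) is log-supermodular. *)
Lemma quad_supermodular K Q (phi psi : V -> R) : precision K Q ->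
  quad K Q (fun x => Num.max (phi x) (psi x)) + quad K Q (fun x => Num.min (phi x) (psi x))
  <= quad K Q phi + quad K Q psi.
Proof.
move=> [sym _ off]; rewrite /quad -!big_split /=.
rewrite [leLHS]big_seq [leRHS]big_seq; apply: ler_sum => x xK.
rewrite -!big_split /= [leLHS]big_seq [leRHS]big_seq; apply: ler_sum => y yK.
rewrite -!mulrDr.
have [<-|xy] := eqVneq x y.
  rewrite le_eqVlt; apply/orP; left; apply/eqP; congr (_ * _).
  by have [H|H] := leP (phi x) (psi x); ring.
rewrite ler_wnM2l ?off//.
have [H1|H1] := leP (phi x) (psi x); have [H2|H2] := leP (phi y) (psi y) => //.
- by rewrite addrC.
- have : 0 <= (psi x - phi x) * (phi y - psi y) by rewrite mulr_ge0 ?subr_ge0// ltW.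
  by lra.
- have : 0 <= (phi x - psi x) * (psi y - phi y) by rewrite mulr_ge0 ?subr_ge0// ltW.
  by lra.
Qed.

End Precision.

Lemma scaled_product_le {R : realType} (k a b c d : \bar R) : (0 <= k)%E ->
  (a * b <= c * d)%E -> ((k * a) * (k * b) <= (k * c) * (k * d))%E.
Proof.
by move=> k0 H; rewrite muleACA [leRHS]muleACA lee_wpmul2l// mule_ge0.
Qed.

Section GaussianFourFunctions.
Context {R : realType} {V : choiceType} (C : V -> V -> R).
Variable P : probability (field_space R V) R.
Hypothesis gaussP : centered_gaussian_field C P.
Hypothesis C_sym : forall x y, C x y = C y x.
Hypothesis C_ge0 : forall K a, 0 <= bilin C K a a.
Local Notation F := (field_space R V).

Definition depends_on (K : {fset V}) (T : Type) (g : F -> T) :=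
  forall phi psi : F, {in K, phi =1 psi} -> g phi = g psi.

Definition update (n : V) (p : F * R) : F := fun x => if x == n then p.2 else p.1 x.

Lemma measurable_update n : measurable_fun setT (update n).
Proof.
apply: measurable_to_field => w; rewrite /update; case: (w == n); first exact: measurable_snd.
exact: (measurableT_comp (measurable_coord w) measurable_fst).
Qed.

Definition field_max (phi psi : F) : F := fun x => Num.max (phi x) (psi x).
Definition field_min (phi psi : F) : F := fun x => Num.min (phi x) (psi x).

Section Peel.
Variables (K : {fset V}) (Q : V -> V -> R) (n : V).
Hypothesis pQ : precision C K Q.
Hypothesis nK : n \in K.

Local Notation K' := (K `\ n)%fset.
Let s := Num.sqrt (Q n n)^-1.
Let drift (phi : F) : R := (\sum_(j <- K') Q n j * phi j) / Q n n.

Let Qn : 0 < Q n n. Proof. exact: (precision_diag_gt0 C_sym C_ge0 pQ nK). Qed.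
Let s0 : 0 < s. Proof. by rewrite sqrtr_gt0 invr_gt0. Qed.

(** Conditional expectation of [g] given the coordinates of K other than [n]: coordinate [n] is then
    normal with mean [- drift phi] and variance 1 / Q n n. *)
Definition peel (g : F -> \bar R) (phi : F) : \bar R :=
  (\int[@lebesgue_measure R]_t (g (update n (phi, t)) * (normal_pdf 0 s (t + drift phi)%R)%:E))%E.

Let mdrift : measurable_fun setT drift.
Proof.
apply: measurable_funM => //; apply: measurable_sum => j.
by apply: measurable_funM => //; exact: measurable_coord.
Qed.

Let mint g : measurable_fun setT g -> measurable_fun setT
  (fun p : F * R => (g (update n p) * (normal_pdf 0 s (p.2 + drift p.1)%R)%:E)%E).
Proof.
move=> mg; apply: emeasurable_funM.
  by apply: measurableT_comp => //; exact: measurable_update.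
apply/measurable_EFinP; apply: measurableT_comp; first exact: measurable_normal_pdf.
apply: measurable_funD; first exact: measurable_snd.
by apply: measurableT_comp => //; exact: measurable_fst.
Qed.

Lemma measurable_peel g : measurable_fun setT g -> (forall phi, (0 <= g phi)%E) ->
  measurable_fun setT (peel g).
Proof.
move=> mg g0; apply: (@measurable_fun_fubini_tonelli_F _ _ _ _ R lebesgue_measure
  (fun p : F * R => (g (update n p) * (normal_pdf 0 s (p.2 + drift p.1)%R)%:E)%E)).
  exact: mint.
by move=> p; rewrite mule_ge0// lee_fin normal_pdf_ge0.
Qed.

Lemma peel_ge0 g phi : (forall phi, (0 <= g phi)%E) -> (0 <= peel g phi)%E.
Proof.
by move=> g0; apply: integral_ge0 => t _; rewrite mule_ge0// lee_fin normal_pdf_ge0.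
Qed.

Lemma depends_peel (g : F -> \bar R) : depends_on K g -> depends_on K' (peel g).
Proof.
move=> dg phi psi E.
have dE : drift phi = drift psi.
  by rewrite /drift; congr (_ / _); apply: eq_big_seq => j jK; rewrite E.
apply: eq_integral => t _; rewrite dE; congr (_ * _)%E.
apply: dg => x xK; rewrite /update /=; case: eqP => // /eqP xn.
by apply: E; rewrite !inE xn.
Qed.

(** Row [n] divided by [Q n n] is the form phi n + drift. By [precision_row] it is uncorrelated with
    the other coordinates and has variance 1 / Q n n, so it can be integrated out independently of
    them. *)
Lemma expectation_peel (g : F -> \bar R) : depends_on K g ->
  measurable_fun setT g -> (forall phi, (0 <= g phi)%E) ->
  (\int[P]_phi g phi = \int[P]_phi peel g phi)%E.
Proof.
move=> dg mg g0.
pose a0 (x : V) := (Q n n)^-1 * Q n x.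
pose a (w x : V) : R := ((w \in K') && (x == w))%:R.
have row := precision_row pQ nK.
have var : bilin C K a0 a0 = (Q n n)^-1.
  by rewrite bilinZr (bilinZl C_sym) row mulVf ?mulr1// gt_eqF.
have unc w : bilin C K a0 (a w) = 0.
  rewrite (bilinZl C_sym) row /a !inE; have [<-|wn] := eqVneq w n; first by rewrite mulr0.
  by rewrite andbF mulr0.
have var0 : 0 < bilin C K a0 a0 by rewrite var invr_gt0.
pose G (p : F * R) := g (update n (p.1, p.2 - drift p.1)).
have mG : measurable_fun setT G.
  apply: measurableT_comp => //; apply: measurableT_comp; first exact: measurable_update.
  apply: measurable_fun_pair; first exact: measurable_fst.
  apply: measurable_funB; first exact: measurable_snd.
  by apply: measurableT_comp => //; exact: measurable_fst.
have formsE phi w : w \in K' -> forms K a phi w = phi w.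
  move=> wK'; have wK : w \in K by move: wK'; rewrite !inE => /andP[].
  rewrite /forms /= /fset_form (big_fsetD1 w)//= big1_fset ?addr0.
    by rewrite /a wK' eqxx mul1r.
  by move=> x; rewrite !inE /a => /andP[xw _] _; rewrite (negbTE xw) andbF mul0r.
have driftE phi : drift (forms K a phi) = drift phi.
  by rewrite /drift; congr (_ / _); apply: eq_big_seq => j jK; rewrite formsE.
have form0E phi : fset_form K a0 phi = phi n + drift phi.
  rewrite /fset_form (big_fsetD1 n)//= /a0 mulVf ?gt_eqF// mul1r; congr (_ + _).
  by rewrite /drift mulrC mulr_sumr; apply: eq_bigr => x _; rewrite mulrA.
transitivity (\int[P]_phi G (forms K a phi, fset_form K a0 phi))%E.
  apply: eq_integral => phi _; apply: dg => x xK.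
  rewrite /update /= driftE form0E addrK; case: eqP => [->//|/eqP xn].
  by rewrite formsE// !inE xn.
rewrite (gauss_independence gaussP C_sym (C_ge0 K) var0 unc mG); last by move=> p; exact: g0.
apply: eq_integral => phi _; rewrite var -/s.
have mGf : measurable_fun setT (fun t : R => G (forms K a phi, t)).
  exact: measurableT_comp.
rewrite (integral_normal s mGf).
have mp : measurable_fun setT (fun t : R => (G (forms K a phi, t) * (normal_pdf 0 s t)%:E)%E).
  by apply: emeasurable_funM => //; apply/measurable_EFinP; exact: measurable_normal_pdf.
rewrite -(integral_translation (drift phi) mp) /peel.
apply: eq_integral => t _; congr (_ * _)%E; rewrite /G /= driftE addrK.
apply: dg => x xK; rewrite /update /=; case: eqP => // /eqP xn.
by rewrite formsE// !inE xn.
Qed.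

Definition gibbs (L : {fset V}) (S : V -> V -> R) (phi : F) : R := expR (- quad L S phi / 2).

(** Completing the square ([quad_schur]) factors the joint weight into the conditional density and
    the marginal weight. The constant [normal_peak s] involves neither [g] nor [phi], so it cancels
    from the four functions inequality. *)
Lemma peel_gibbs (g : F -> \bar R) phi : measurable_fun setT g ->
  (forall phi, (0 <= g phi)%E) ->
  (peel g phi * (gibbs K' (schur Q n) phi)%:E =
   (normal_peak s)%:E * \int[@lebesgue_measure R]_t
     (g (update n (phi, t)) * (gibbs K Q (update n (phi, t)))%:E))%E.
Proof.
move=> mg g0.
have mu' : measurable_fun setT (fun t : R => g (update n (phi, t))).
  apply: measurableT_comp => //; apply: measurableT_comp => //; exact: measurable_update.
have E t : gibbs K Q (update n (phi, t)) * normal_peak s =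
    normal_pdf 0 s (t + drift phi) * gibbs K' (schur Q n) phi.
  rewrite normal_pdfE0// /gibbs (quad_schur C_sym C_ge0 _ pQ nK) [in RHS]mulrAC.
  rewrite mulrC -mulrA -expRD; congr (_ * expR _).
  rewrite sqr_sqrtr ?invr_ge0 ?ltW//.
  have -> : update n (phi, t) n = t by rewrite /update eqxx.
  have -> : \sum_(j <- K') Q n j * update n (phi, t) j = drift phi * Q n n.
    rewrite divfK ?gt_eqF//; apply: eq_big_seq => j.
    by rewrite !inE /update => /andP[/negbTE ->].
  have -> : quad K' (schur Q n) (update n (phi, t)) = quad K' (schur Q n) phi.
    apply: eq_big_seq => x; rewrite !inE => /andP[/negbTE xn _].
    apply: eq_big_seq => y; rewrite !inE => /andP[/negbTE yn _].
    by rewrite /update xn yn.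
  have Qn0 : Q n n != 0 by rewrite gt_eqF.
  by rewrite mulfK// -mulr_natr; field.
rewrite /peel -ge0_integralZr//; last 3 first.
- by apply: (measurableT_comp (mint mg)).
- by move=> t _; rewrite mule_ge0// lee_fin normal_pdf_ge0.
- by rewrite lee_fin expR_ge0.
rewrite -ge0_integralZl//; last 3 first.
- apply: emeasurable_funM => //; apply/measurable_EFinP.
  under [X in measurable_fun _ X]funext => t do
    rewrite -[gibbs _ _ _](@mulfK _ (normal_peak s)) ?gt_eqF ?normal_peak_gt0 ?gt_eqF// E.
  apply: measurable_funM => //; apply: measurable_funM => //.
  by apply: measurableT_comp; [exact: measurable_normal_pdf|exact: measurable_addr].
- by move=> t _; rewrite mule_ge0// lee_fin expR_ge0.
- by rewrite lee_fin normal_peak_ge0.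
apply: eq_integral => t _.
by rewrite -muleA -EFinM -E EFinM muleA muleC.
Qed.

End Peel.

(** The Gibbs weights are part of the pointwise hypothesis so that it is inherited by the peeled
    functions: by [peel_gibbs], their weighted inequality is the one-dimensional theorem in
    coordinate [n]. *)
Lemma gaussian_four_functions_aux K Q (g1 g2 g3 g4 : F -> \bar R) :
  precision C K Q ->
  depends_on K g1 -> depends_on K g2 -> depends_on K g3 -> depends_on K g4 ->
  measurable_fun setT g1 -> measurable_fun setT g2 ->
  measurable_fun setT g3 -> measurable_fun setT g4 ->
  (forall phi, (0 <= g1 phi)%E) -> (forall phi, (0 <= g2 phi)%E) ->
  (forall phi, (0 <= g3 phi)%E) -> (forall phi, (0 <= g4 phi)%E) ->
  (forall phi psi,
    (g1 phi * (gibbs K Q phi)%:E) * (g2 psi * (gibbs K Q psi)%:E) <=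
    (g3 (field_max phi psi) * (gibbs K Q (field_max phi psi))%:E) *
    (g4 (field_min phi psi) * (gibbs K Q (field_min phi psi))%:E))%E ->
  ((\int[P]_phi g1 phi) * (\int[P]_phi g2 phi) <=
   (\int[P]_phi g3 phi) * (\int[P]_phi g4 phi))%E.
Proof.
elim: {K}#|` K| {-2}K (erefl #|` K|) Q g1 g2 g3 g4 => [|k IH] K cK Q g1 g2 g3 g4
  pQ d1 d2 d3 d4 m1 m2 m3 m4 p1 p2 p3 p4 H.
  have K0 : K = fset0 by apply/eqP; rewrite -cardfs_eq0 cK.
  have const (g : F -> \bar R) : depends_on K g -> (\int[P]_phi g phi = g (fun=> 0%R))%E.
    move=> dg; transitivity (\int[P]_phi cst (g (fun=> 0%R)) phi)%E.
      by apply: eq_integral => phi _; apply: dg => x; rewrite K0 inE.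
    rewrite integral_cst; last exact: measurableT.
    rewrite -[RHS]mule1; congr (_ * _)%E; exact: probability_setT.
  rewrite !const//; have := H (fun=> 0) (fun=> 0).
  have -> : field_max (fun=> 0) (fun=> 0) = (fun=> 0) by apply/funext => x; rewrite /field_max maxxx.
  have -> : field_min (fun=> 0) (fun=> 0) = (fun=> 0) by apply/funext => x; rewrite /field_min minxx.
  by rewrite /gibbs /quad K0 big_seq_fset0 oppr0 mul0r expR0 !mule1.
have [n nK] : exists n, n \in K by apply/fset0Pn; rewrite -cardfs_gt0 cK.
have Qn := precision_diag_gt0 C_sym C_ge0 pQ nK.
rewrite (expectation_peel pQ nK d1 m1 p1).
rewrite (expectation_peel pQ nK d2 m2 p2).
rewrite (expectation_peel pQ nK d3 m3 p3).
rewrite (expectation_peel pQ nK d4 m4 p4).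
apply: (IH (K `\ n)%fset _ (schur Q n)).
- by move: cK; rewrite (cardfsD1 n) nK => -[].
- exact: precision_schur.
- exact: depends_peel.
- exact: depends_peel.
- exact: depends_peel.
- exact: depends_peel.
- exact: measurable_peel.
- exact: measurable_peel.
- exact: measurable_peel.
- exact: measurable_peel.
- by move=> phi; exact: peel_ge0.
- by move=> phi; exact: peel_ge0.
- by move=> phi; exact: peel_ge0.
- by move=> phi; exact: peel_ge0.
move=> phi psi.
rewrite [X in (X * _ <= _)%E](peel_gibbs pQ nK phi m1 p1).
rewrite [X in (_ * X <= _)%E](peel_gibbs pQ nK psi m2 p2).
rewrite [X in (_ <= X * _)%E](peel_gibbs pQ nK (field_max phi psi) m3 p3).
rewrite [X in (_ <= _ * X)%E](peel_gibbs pQ nK (field_min phi psi) m4 p4).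
apply: scaled_product_le; first by rewrite lee_fin normal_peak_ge0.
have mg g chi : measurable_fun setT g -> measurable_fun setT
    (fun t : R => (g (update n (chi, t)) * (gibbs K Q (update n (chi, t)))%:E)%E).
  move=> mg; have mu' : measurable_fun setT (fun t : R => update n (chi, t)).
    by apply: measurableT_comp => //; exact: measurable_update.
  apply: emeasurable_funM; first exact: measurableT_comp.
  apply/measurable_EFinP; apply: (measurableT_comp _ mu').
  apply: measurableT_comp => //; apply: measurable_funM => //.
  apply: measurableT_comp => //; apply: measurable_sum => x; apply: measurable_sum => y.
  by apply: measurable_funM => //; apply: measurable_funM; exact: measurable_coord.
apply: four_functions.
- exact: mg.
- exact: mg.
- exact: mg.
- exact: mg.
- by move=> t; rewrite mule_ge0// lee_fin expR_ge0.
- by move=> t; rewrite mule_ge0// lee_fin expR_ge0.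
- by move=> t; rewrite mule_ge0// lee_fin expR_ge0.
- by move=> t; rewrite mule_ge0// lee_fin expR_ge0.
move=> t u; have := H (update n (phi, t)) (update n (psi, u)).
have -> : field_max (update n (phi, t)) (update n (psi, u)) =
    update n (field_max phi psi, Num.max t u).
  by apply/funext => x; rewrite /field_max /update /=; case: eqP.
have -> : field_min (update n (phi, t)) (update n (psi, u)) =
    update n (field_min phi psi, Num.min t u).
  by apply/funext => x; rewrite /field_min /update /=; case: eqP.
by [].
Qed.

Theorem gaussian_four_functions K Q (g1 g2 g3 g4 : F -> \bar R) :
  precision C K Q ->
  depends_on K g1 -> depends_on K g2 -> depends_on K g3 -> depends_on K g4 ->
  measurable_fun setT g1 -> measurable_fun setT g2 ->
  measurable_fun setT g3 -> measurable_fun setT g4 ->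
  (forall phi, (0 <= g1 phi)%E) -> (forall phi, (0 <= g2 phi)%E) ->
  (forall phi, (0 <= g3 phi)%E) -> (forall phi, (0 <= g4 phi)%E) ->
  (forall phi psi,
    (g1 phi * g2 psi <= g3 (field_max phi psi) * g4 (field_min phi psi))%E) ->
  ((\int[P]_phi g1 phi) * (\int[P]_phi g2 phi) <=
   (\int[P]_phi g3 phi) * (\int[P]_phi g4 phi))%E.
Proof.
move=> pQ d1 d2 d3 d4 m1 m2 m3 m4 p1 p2 p3 p4 H.
apply: (gaussian_four_functions_aux pQ) => // phi psi.
rewrite muleACA [leRHS]muleACA; apply: lee_pmul => //.
- by rewrite mule_ge0.
- by rewrite mule_ge0// lee_fin expR_ge0.
rewrite -!EFinM lee_fin -!expRD ler_expR.
have := quad_supermodular phi psi pQ.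
by rewrite /field_max /field_min; lra.
Qed.

End GaussianFourFunctions.

(** * The killed Green function *)

Lemma cvg_sum_seq {R : realType} (I : Type) (s : seq I) (f_ : nat -> I -> R) (f : I -> R) :
  (forall i, f_ n i @[n --> \oo] --> f i) ->
  \sum_(i <- s) f_ n i @[n --> \oo] --> \sum_(i <- s) f i.
Proof.
move=> cf; elim: s => [|i s IH].
  rewrite big_nil; under [X in X @ _]funext do rewrite big_nil; exact: cvg_cst.
rewrite big_cons; under [X in X @ _]funext do rewrite big_cons.
exact: cvgD.
Qed.

Section GreenFunction.
Context {R : realType} {Z : nzRingType} {d : nat} (theta : R).
Hypothesis d_gt0 : (0 < d)%N.
Hypothesis theta01 : 0 < theta < 1.
Local Notation V := 'rV[Z]_d.
Local Notation p := (@killed_walk_prob R Z d theta).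
Local Notation g := (@green R Z d theta).

Let c := (1 - theta) / (2 * d)%:R.
Let c_ge0 : 0 <= c.
Proof. by case/andP: theta01 => _ t1; rewrite divr_ge0// subr_ge0 ltW. Qed.

(** The cemetery term of [killed_step] disappears because the functions iterated in
    [killed_walk_prob] vanish at [None]. *)
Definition walk_op (f : V -> R) (x : V) : R :=
  \sum_(i < d) (c * f (x + unit_vec i) + c * f (x - unit_vec i)).

Lemma walk_op_cst b : walk_op (fun=> b) =1 fun=> (1 - theta) * b.
Proof.
move=> x; rewrite /walk_op sumr_const card_ord -mulr2n -mulrnA -mulrnAl /c.
rewrite -[_ *+ (2 * d)]mulr_natr divfK// pnatr_eq0 muln_eq0 /=.
by case: d d_gt0.
Qed.

Lemma ler_walk_op f f' : (forall x, f x <= f' x) -> forall x, walk_op f x <= walk_op f' x.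
Proof. by move=> ff x; apply: ler_sum => i _; rewrite lerD// ler_wpM2l. Qed.

Lemma walk_opD f f' x : walk_op (fun z => f z + f' z) x = walk_op f x + walk_op f' x.
Proof. by rewrite /walk_op -big_split; apply: eq_bigr => i _ /=; ring. Qed.

Lemma walk_opZ b f x : walk_op (fun z => b * f z) x = b * walk_op f x.
Proof. by rewrite /walk_op mulr_sumr; apply: eq_bigr => i _ /=; ring. Qed.

Lemma walk_opN f x : walk_op (fun z => - f z) x = - walk_op f x.
Proof. by rewrite /walk_op -sumrN; apply: eq_bigr => i _ /=; ring. Qed.

Lemma walk_op_sum (I : Type) (s : seq I) (f : I -> V -> R) x :
  walk_op (fun z => \sum_(i <- s) f i z) x = \sum_(i <- s) walk_op (f i) x.
Proof.
elim: s => [|i s IH].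
  rewrite big_nil; transitivity (walk_op (fun=> 0) x); last by rewrite walk_op_cst mulr0.
  by apply: eq_bigr => i _; rewrite !big_nil.
rewrite big_cons -IH -walk_opD.
by apply: eq_bigr => j _; rewrite !big_cons.
Qed.

Lemma killed_walk_prob0 x y : p 0 x y = (x == y)%:R.
Proof. by rewrite /killed_walk_prob /=; congr (_%:R); rewrite (inj_eq Some_inj). Qed.

Lemma killed_walk_probS n x y : p n.+1 x y = walk_op (fun z => p n z y) x.
Proof.
rewrite /killed_walk_prob /=.
have -> : iter n (killed_step theta) (fun v : option V => (v == Some y)%:R) None = 0.
  by elim: n => //= n ->.
by rewrite mulr0 add0r.
Qed.

Lemma killed_walk_prob_bound n x y : 0 <= p n x y <= (1 - theta) ^+ n.
Proof.
elim: n x => [|n IH] x.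
  by rewrite killed_walk_prob0 expr0; case: (x == y); rewrite /= ?lexx ?ler01.
rewrite killed_walk_probS exprS; apply/andP; split.
  by apply: sumr_ge0 => i _; rewrite addr_ge0// mulr_ge0//; case/andP: (IH (x + unit_vec i));
     case/andP: (IH (x - unit_vec i)).
rewrite -(walk_op_cst _ x); apply: ler_walk_op => z; by case/andP: (IH z).
Qed.

Lemma cvg_green x y : series (fun n => p n x y) @ \oo --> g x y.
Proof.
apply: nondecreasing_is_cvgn.
  apply: nondecreasing_series => n _ _; by case/andP: (killed_walk_prob_bound n x y).
exists (theta^-1) => _ [n _ <-].
case/andP: theta01 => t0 t1.
apply: le_trans (_ : \sum_(0 <= i < n) (1 - theta) ^+ i <= _).
  by apply: ler_sum => i _; case/andP: (killed_walk_prob_bound i x y).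
rewrite big_mkord -[leRHS]mul1r ler_pdivlMr//.
have := subrX1 (1 - theta) n.
have -> : 1 - theta - 1 = - theta by ring.
have : 0 <= (1 - theta) ^+ n by rewrite exprn_ge0// subr_ge0 ltW.
by move=> H; rewrite mulNr mulrC; lra.
Qed.

Lemma green_ge0 x y : 0 <= g x y.
Proof.
apply: (cvgr_to_ge (@cvg_green x y)); apply: nearW => n.
by apply: sumr_ge0 => i _; case/andP: (killed_walk_prob_bound i x y).
Qed.

Lemma green_le x y : g x y <= theta^-1.
Proof.
case/andP: theta01 => t0 t1.
apply: (cvgr_to_le (@cvg_green x y)); apply: nearW => n.
apply: le_trans (_ : \sum_(0 <= i < n) (1 - theta) ^+ i <= _).
  by apply: ler_sum => i _; case/andP: (killed_walk_prob_bound i x y).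
rewrite big_mkord -[leRHS]mul1r ler_pdivlMr//.
have := subrX1 (1 - theta) n.
have -> : 1 - theta - 1 = - theta by ring.
have : 0 <= (1 - theta) ^+ n by rewrite exprn_ge0// subr_ge0 ltW.
by move=> H; rewrite mulNr mulrC; lra.
Qed.

Lemma green_eq x y : g x y = (x == y)%:R + walk_op (fun z => g z y) x.
Proof.
have C1 : (fun n => series (fun n => p n x y) n.+1) @ \oo --> g x y.
  by rewrite (cvg_shiftS (series (fun n => p n x y))); exact: (@cvg_green).
apply: (cvg_unique _ C1) => //.
have -> : (fun n => series (fun n => p n x y) n.+1) =
    (fun n => (x == y)%:R + walk_op (fun z => series (fun n => p n z y) n) x).
  apply/funext => n; rewrite /series /= big_nat_recl// killed_walk_prob0; congr (_ + _).
  rewrite walk_op_sum; apply: eq_bigr => i _; exact: killed_walk_probS.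
apply: cvgD; first exact: cvg_cst.
apply: cvg_sum_seq => i.
by apply: cvgD; (apply: cvgM; [exact: cvg_cst|exact: (@cvg_green)]).
Qed.

Lemma green_diag_ge1 x : 1 <= g x x.
Proof.
rewrite green_eq eqxx lerDl; apply: sumr_ge0 => i _.
by rewrite addr_ge0// mulr_ge0// green_ge0.
Qed.

Lemma killed_walk_prob_translate n x y z : p n (x + z) (y + z) = p n x y.
Proof.
elim: n x => [|n IH] x; first by rewrite !killed_walk_prob0 (inj_eq (addIr z)).
rewrite !killed_walk_probS; apply: eq_bigr => i _.
by rewrite -!IH !(addrAC x z).
Qed.

Lemma killed_walk_prob_opp n x y : p n (- x) (- y) = p n x y.
Proof.
elim: n x => [|n IH] x; first by rewrite !killed_walk_prob0 (inj_eq oppr_inj).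
rewrite !killed_walk_probS; apply: eq_bigr => i _.
by rewrite -!IH !opprD opprK addrC.
Qed.

Lemma green_translate x y z : g (x + z) (y + z) = g x y.
Proof.
rewrite /green; congr (limn (series _)); apply/funext => n.
exact: killed_walk_prob_translate.
Qed.

(** The map z |-> x + y - z exchanges [x] and [y] and preserves the walk. *)
Lemma green_sym x y : g x y = g y x.
Proof.
rewrite /green; congr (limn (series _)); apply/funext => n.
rewrite -killed_walk_prob_opp -(killed_walk_prob_translate n _ _ (x + y)).
by rewrite addKr [x + y]addrC addKr.
Qed.

(* One step of the walk contracts lower bounds by the factor [1 - theta], so
   that the maximum principle holds for bounded functions on infinite graphs. *)
Lemma maximum_principle (K : {fset V}) (u : V -> R) (B : R) :
  (forall x, - B <= u x) -> {in K, forall x, 0 <= u x} ->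
  (forall x, x \notin K -> walk_op u x <= u x) -> forall x, 0 <= u x.
Proof.
move=> uB uK uKc; have /andP[t0 t1] := theta01.
have B0 : 0 <= `|B| by [].
have low n x : - ((1 - theta) ^+ n * `|B|) <= u x.
  elim: n x => [|n IH] x.
    by rewrite expr0 mul1r; apply: le_trans (uB x); rewrite lerN2 ler_norm.
  have [xK|xK] := boolP (x \in K).
    apply: le_trans (uK _ xK); rewrite oppr_le0 mulr_ge0// exprn_ge0// subr_ge0 ltW//.
  apply: le_trans (uKc _ xK); rewrite exprS -mulrA -mulrN -(walk_op_cst _ x).
  exact: ler_walk_op.
move=> x; have : (fun n => - ((1 - theta) ^+ n * `|B|)) @ \oo --> - (0 * `|B|).
  apply: cvgN; apply: cvgM; last exact: cvg_cst.
  by apply: cvg_expr; rewrite ger0_norm; lra.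
rewrite mul0r oppr0 => H; apply: (cvgr_to_le H); exact: nearW.
Qed.

Section Inverse.
Variable K : {fset V}.

Definition potential (a : V -> R) (z : V) : R := \sum_(y <- K) a y * g z y.

Lemma potential_bounded a : exists B, forall z, `|potential a z| <= B.
Proof.
exists (\sum_(y <- K) `|a y| * theta^-1) => z.
apply: le_trans (ler_norm_sum _ _ _) _; apply: ler_sum => y _.
by rewrite normrM ler_wpM2l// ger0_norm ?green_ge0// green_le.
Qed.

Lemma potential_eq a z :
  potential a z - walk_op (potential a) z = if z \in K then a z else 0.
Proof.
have -> : walk_op (potential a) z = \sum_(y <- K) a y * walk_op (fun w => g w y) z.
  by rewrite walk_op_sum; apply: eq_bigr => y _; rewrite walk_opZ.
rewrite -sumrB.
have -> : \sum_(y <- K) (a y * g z y - a y * walk_op (fun w => g w y) z) =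
    \sum_(y <- K) a y * (z == y)%:R.
  by apply: eq_bigr => y _; rewrite [g z y]green_eq; ring.
have [zK|zK] := boolP (z \in K).
  rewrite (big_fsetD1 z)//= eqxx mulr1 big1_fset ?addr0// => y.
  by rewrite !inE => /andP[yz _] _; rewrite eq_sym (negbTE yz) mulr0.
rewrite big1_fset// => y yK _; have [zy|] := eqVneq z y; last by rewrite mulr0.
by rewrite zy yK in zK.
Qed.

Lemma potential_ge0 a : {in K, forall x, 0 <= potential a x} ->
  forall x, 0 <= potential a x.
Proof.
move=> H; have [B bB] := potential_bounded a.
apply: (@maximum_principle K _ B) => // x; first by have := bB x; rewrite ler_norml => /andP[].
by move=> xK; have := potential_eq a x; rewrite (negbTE xK) => /eqP; rewrite subr_eq0 => /eqP ->.
Qed.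

(** Off K the potential is a fixed point of [walk_op], whereas [walk_op] lowers the constant 1 to 1
    - theta; hence 1 - potential satisfies the hypotheses of the maximum principle. *)
Lemma potential_le1 a : {in K, forall x, potential a x = 1} ->
  forall x, potential a x <= 1.
Proof.
move=> H x; have [B bB] := potential_bounded a; have /andP[t0 t1] := theta01.
rewrite -subr_ge0.
apply: (@maximum_principle K (fun x => 1 - potential a x) (B - 1)) => [z|z zK|z zK].
- by have := bB z; rewrite ler_norml; lra.
- by rewrite H// subrr.
- rewrite walk_opD walk_opN walk_op_cst.
  by have := potential_eq a z; rewrite (negbTE zK); lra.
Qed.

(** The maximum principle applied to [a] and [- a] shows that the potential vanishes everywhere, and
    [potential_eq] recovers [a] from it. This makes the Green matrix on K invertible. *)
Lemma potential_inj a : {in K, forall x, potential a x = 0} ->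
  {in K, forall x, a x = 0}.
Proof.
move=> H; have P0 x : 0 <= potential a x by apply: potential_ge0 => z zK; rewrite H.
have N0 x : 0 <= potential (fun x => - a x) x.
  apply: potential_ge0 => z zK; rewrite /potential.
  by under eq_bigr do rewrite mulNr; rewrite sumrN oppr_ge0 -/(potential a z) H.
have E x : potential a x = 0.
  apply/eqP; rewrite eq_le P0 andbT -oppr_ge0; have := N0 x; rewrite /potential.
  by under eq_bigr do rewrite mulNr; rewrite sumrN.
move=> x xK; have := potential_eq a x; rewrite xK => <-; rewrite E sub0r.
have -> : potential a = fun=> 0 by apply/funext.
by rewrite walk_op_cst mulr0 oppr0.
Qed.

Let n := size (enum_fset K).
Let pt (i : 'I_n) : V := nth 0 (enum_fset K) i.
Let mx : 'M[R]_n := \matrix_(i, j) g (pt i) (pt j).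

Let pt_in i : pt i \in K. Proof. exact: mem_nth. Qed.
Let pt_inj : injective pt.
Proof.
by move=> i j /eqP; rewrite nth_uniq ?fset_uniq// => /eqP ij; apply: val_inj.
Qed.

Let sum_pt (f : V -> R) : \sum_(x <- K) f x = \sum_i f (pt i).
Proof. by rewrite (big_nth 0) big_mkord. Qed.

Let idx x (xK : x \in K) : exists i, x = pt i.
Proof.
have xi : (index x (enum_fset K) < n)%N by rewrite index_mem.
by exists (Ordinal xi); rewrite /pt /= nth_index.
Qed.

Let pt_index i : index (pt i) (enum_fset K) = i.
Proof. by rewrite /pt index_uniq ?fset_uniq. Qed.

Let mx_unit : mx \in unitmx.
Proof.
rewrite -row_free_unit; apply: inj_row_free => v vmx.
pose a x := if insub (index x (enum_fset K)) is Some i then v 0 i else 0.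
have aE i : a (pt i) = v 0 i.
  rewrite /a pt_index; case: insubP => [j _ ji|]; last by rewrite ltn_ord.
  by congr (v 0 _); apply: val_inj.
apply/rowP => i; rewrite mxE -aE; apply: potential_inj (pt_in i) => _ /idx[j ->].
rewrite /potential sum_pt; have /rowP/(_ j) := vmx; rewrite !mxE => E.
by rewrite -[RHS]E; apply: eq_bigr => k _; rewrite aE mxE green_sym.
Qed.

(** The inverse matrix is carried back to vertices through their positions in the enumeration of K,
    with value 0 outside K. *)
Definition green_inverse (x y : V) : R :=
  if insub (index x (enum_fset K)) is Some i then
    if insub (index y (enum_fset K)) is Some j then invmx mx i j else 0
  else 0.

Let green_inverseE i j : green_inverse (pt i) (pt j) = invmx mx i j.
Proof.
rewrite /green_inverse !pt_index.
case: insubP => [i' _ ii|]; last by rewrite ltn_ord.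
case: insubP => [j' _ jj|]; last by rewrite ltn_ord.
by congr (invmx mx _ _); apply: val_inj.
Qed.

Lemma green_inverse_sym : {in K &, forall x y, green_inverse x y = green_inverse y x}.
Proof.
move=> x y /idx[i ->] /idx[j ->]; rewrite !green_inverseE.
have -> : invmx mx i j = (invmx mx)^T j i by rewrite mxE.
rewrite trmx_inv; congr (invmx _ _ _); apply/matrixP => k l; rewrite !mxE.
exact: green_sym.
Qed.

Lemma green_inverse_mul :
  {in K &, forall x z, \sum_(y <- K) green_inverse x y * g y z = (x == z)%:R}.
Proof.
move=> x z /idx[i ->] /idx[j ->]; rewrite sum_pt.
have /matrixP/(_ i j) := mulVmx mx_unit; rewrite !mxE (inj_eq pt_inj) => <-.
by apply: eq_bigr => k _; rewrite green_inverseE mxE.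
Qed.

Lemma potential_inverse_col y x : y \in K -> x \in K ->
  potential (fun z => green_inverse z y) x = (x == y)%:R.
Proof.
move=> yK xK; rewrite eq_sym -green_inverse_mul//; apply: eq_big_seq => z zK.
by rewrite (green_inverse_sym zK yK) green_sym.
Qed.

(** The potential u of column [y] is nonnegative and equals 1 at [y] and 0 on the rest of K. By
    [potential_eq] the entry at x != y is u(x) minus the walk average of u at x, that is, minus a
    nonnegative number. *)
Lemma green_inverse_offdiag : {in K &, forall x y, x != y -> green_inverse x y <= 0}.
Proof.
move=> x y xK yK xy.
have := potential_eq (fun z => green_inverse z y) x.
rewrite xK => <-; rewrite potential_inverse_col// (negbTE xy) sub0r oppr_le0.
have u0 z : 0 <= potential (fun z => green_inverse z y) z.
  by apply: potential_ge0 => w wK; rewrite potential_inverse_col.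
by apply: sumr_ge0 => i _; rewrite addr_ge0// mulr_ge0.
Qed.

(** The potential of the row sums is 1 on K, hence at most 1 everywhere. By [potential_eq] the row
    sum at x is 1 minus a walk average, which is at most 1 - theta. *)
Lemma green_inverse_rowsum : {in K, forall x, theta <= \sum_(y <- K) green_inverse x y}.
Proof.
move=> x xK; pose a x := \sum_(y <- K) green_inverse x y.
have w1 : {in K, forall z, potential a z = 1}.
  move=> z zK; rewrite /potential /a; under eq_bigr do rewrite mulr_suml.
  rewrite exchange_big /= (big_fsetD1 z)//=.
  have E y : y \in K -> \sum_(x <- K) green_inverse x y * g z x = (z == y)%:R.
    by move=> yK; rewrite -(potential_inverse_col yK zK).
  rewrite E// eqxx big1_fset ?addr0// => y; rewrite !inE => /andP[yz yK] _.
  by rewrite E// eq_sym (negbTE yz).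
have := potential_eq a x; rewrite xK w1// => Ex; rewrite -/(a x) -Ex.
rewrite lerBrDr -lerBrDl.
apply: le_trans (ler_walk_op (potential_le1 w1) x) _.
by rewrite walk_op_cst mulr1.
Qed.

(** With u the potential of [a], the form equals the sum of Q x y u(x) u(y). Twice this is 2 sum
    rowsum(x) u(x)^2 minus the sum of Q x y (u(x) - u(y))^2, and both parts have the right sign. *)
Lemma green_bilin_ge0 (a : V -> R) : 0 <= bilin g K a a.
Proof.
pose u z := potential a z; pose Q := green_inverse.
have aE : {in K, forall x, a x = \sum_(y <- K) Q x y * u y}.
  move=> x xK; under eq_bigr do rewrite /u /potential mulr_sumr.
  rewrite exchange_big /= (big_fsetD1 x)//=.
  have E z : z \in K -> \sum_(y <- K) Q x y * (a z * g y z) = a z * (x == z)%:R.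
    move=> zK; rewrite -green_inverse_mul// mulr_sumr; apply: eq_bigr => y _.
    by rewrite mulrCA.
  rewrite E// eqxx mulr1 big1_fset ?addr0// => y; rewrite !inE => /andP[yx yK] _.
  by rewrite E// eq_sym (negbTE yx) mulr0.
have -> : bilin g K a a = \sum_(x <- K) \sum_(y <- K) Q x y * (u x * u y).
  rewrite /bilin; apply: eq_big_seq => x xK.
  transitivity (a x * u x).
    by rewrite /u /potential mulr_sumr; apply: eq_bigr => y _; rewrite mulrA.
  by rewrite {1}aE// mulr_suml; apply: eq_bigr => y _; ring.
have D : \sum_(x <- K) \sum_(y <- K) Q x y * (u x ^+ 2 + u y ^+ 2) =
    2 * \sum_(x <- K) u x ^+ 2 * \sum_(y <- K) Q x y.
  transitivity (\sum_(x <- K) \sum_(y <- K) Q x y * u x ^+ 2 +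
      \sum_(x <- K) \sum_(y <- K) Q x y * u y ^+ 2).
    by rewrite -big_split; apply: eq_bigr => x _; rewrite -big_split; apply: eq_bigr => y _ /=; ring.
  rewrite [X in _ + X]exchange_big /= mulr_natl mulr2n; congr (_ + _).
    by apply: eq_bigr => x _; rewrite mulr_sumr; apply: eq_bigr => y _; rewrite mulrC.
  apply: eq_big_seq => x xK; rewrite mulr_sumr; apply: eq_big_seq => y yK.
  by rewrite mulrC /Q (green_inverse_sym yK xK).
have D2 : \sum_(x <- K) \sum_(y <- K) Q x y * (u x - u y) ^+ 2 <= 0.
  rewrite big_seq; apply: sumr_le0 => x xK; rewrite big_seq; apply: sumr_le0 => y yK.
  have [<-|xy] := eqVneq x y; first by rewrite subrr expr0n mulr0.
  by rewrite mulr_le0_ge0 ?sqr_ge0//; exact: green_inverse_offdiag.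
have D3 : 0 <= \sum_(x <- K) u x ^+ 2 * \sum_(y <- K) Q x y.
  rewrite big_seq; apply: sumr_ge0 => x xK; rewrite mulr_ge0 ?sqr_ge0//.
  by apply: le_trans (green_inverse_rowsum xK); case/andP: theta01 => /ltW.
have : \sum_(x <- K) \sum_(y <- K) Q x y * (u x - u y) ^+ 2 =
   \sum_(x <- K) \sum_(y <- K) Q x y * (u x ^+ 2 + u y ^+ 2) -
   2 * \sum_(x <- K) \sum_(y <- K) Q x y * (u x * u y).
  rewrite mulr_sumr -sumrB; apply: eq_bigr => x _; rewrite mulr_sumr -sumrB.
  by apply: eq_bigr => y _; ring.
lra.
Qed.

Lemma green_precision : precision g K green_inverse.
Proof.
split; [exact: green_inverse_sym|exact: green_inverse_mul|exact: green_inverse_offdiag].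
Qed.

End Inverse.

End GreenFunction.

(** * Influences and the derivative of level probabilities *)

Section NormalMoments.
Context {R : realType} (s : R).
Hypothesis s0 : 0 < s.
Local Notation N := (normal_prob (0 : R) s).

Lemma normal_mean : \int[N]_t t = 0.
Proof.
have D := is_derive_normal_shift s0 0 (@bounded_measurable_cst _ (measurableTypeR R) R 1).
have D0 : is_derive (0 : R) 1 (fun h : R => \int[N]_t (1 : R)) 0 by exact: is_derive_cst.
have := @derive_val _ _ _ _ _ _ _ D; rewrite (@derive_val _ _ _ _ _ _ _ D0).
have -> : \int[N]_t (1 * t) = \int[N]_t t by apply: eq_Rintegral => t _; rewrite mul1r.
move/eqP; rewrite eq_sym mulf_eq0 oppr_eq0 invr_eq0 expf_eq0 gt_eqF//= => /eqP; exact.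
Qed.

(** The density is bounded below on an interval of length 1: s^2 <= 1 / theta controls the peak, and
    s^2 >= 1 controls the exponent. *)
Lemma normal_mass_lower (a theta M : R) : 0 < theta -> 1 <= s ^+ 2 <= theta^-1 -> 0 < M ->
  (forall t, t \in `]a, a + 1[ -> t ^+ 2 <= (M + 1) ^+ 2) ->
  (Num.sqrt (2 * pi / theta))^-1 * expR (- (M + 1) ^+ 2 / 2) <= fine (N `]a, a + 1[%classic).
Proof.
move=> th0 /andP[s1 sth] M0 aM.
set c := _^-1 * _.
have c0 : 0 <= c by rewrite mulr_ge0 ?invr_ge0 ?expR_ge0.
rewrite -lee_fin fineK ?fin_num_measure// /normal_prob.
have -> : c%:E = (\int[lebesgue_measure]_(x in `]a, (a + 1)%R[) c%:E)%E.
  rewrite integral_cst//= lebesgue_measure_itv/= lte_fin ltrDl ltr01 -EFinD.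
  by rewrite addrAC subrr add0r mule1.
apply: ge0_le_integral => //.
- by apply/measurable_EFinP; apply: measurable_funTS; exact: measurable_normal_pdf.
move=> t ta; rewrite lee_fin normal_pdfE0// /c.
have t2 := aM t ta.
have s20 : 0 < s ^+ 2 by rewrite exprn_gt0.
rewrite ler_pM ?invr_ge0 ?expR_ge0//.
  rewrite /normal_peak lef_pV2 ?posrE ?sqrtr_gt0; last 2 first.
  - by rewrite divr_gt0// mulr_gt0// pi_gt0.
  - by rewrite pmulrn_lgt0// mulr_gt0// pi_gt0.
  rewrite ler_sqrt; last by rewrite divr_ge0 ?mulr_ge0 ?pi_ge0// ltW.
  have : s ^+ 2 * pi <= theta^-1 * pi by rewrite ler_wpM2r ?pi_ge0.
  by rewrite -mulr_natl; lra.
rewrite ler_expR -mulr_natl !mulNr lerN2 ler_pdivrMr; last by rewrite pmulrn_lgt0.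
have : (M + 1) ^+ 2 * 1 <= (M + 1) ^+ 2 * s ^+ 2 by rewrite ler_wpM2l ?sqr_ge0.
by rewrite -mulr_natl; lra.
Qed.

Lemma normal_integrableMindic (A : set R) : measurable A ->
  (N : measure _ R).-integrable setT (EFin \o (fun x : R => \1_A x * x)).
Proof.
move=> mA; apply: (bounded_measurableM_integrable s0).
exact: (@bounded_measurable_indic _ (measurableTypeR R) R A mA).
Qed.

Lemma normal_upper_mean (theta M h : R) : 0 < theta -> 1 <= s ^+ 2 <= theta^-1 -> 0 < M ->
  - M < h < M ->
  M * ((Num.sqrt (2 * pi / theta))^-1 * expR (- (M + 1) ^+ 2 / 2)) <=
  \int[N]_t (\1_(`[h, +oo[) t * t).
Proof.
move=> th0 s1 M0 /andP[hM1 hM2].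
have I := normal_integrableMindic.
have lower (a : R) (f : R -> R) : (N : measure _ R).-integrable setT (EFin \o f) ->
    (forall t, t \in `]a, a + 1[ -> t ^+ 2 <= (M + 1) ^+ 2) ->
    (forall t, M * \1_(`]a, a + 1[%classic) t <= f t) ->
    M * ((Num.sqrt (2 * pi / theta))^-1 * expR (- (M + 1) ^+ 2 / 2)) <= \int[N]_t f t.
  move=> If aM Hf.
  have bi := @bounded_measurable_indic _ (measurableTypeR R) R `]a, a + 1[%classic
    (measurable_itv _).
  have Ii := bounded_measurable_integrable N bi.
  apply: le_trans (_ : \int[N]_t (M * \1_(`]a, a + 1[%classic) t) <= _); last first.
    apply: le_Rintegral => //; first exact: (integrableZl measurableT M Ii).
  rewrite RintegralZl// ler_wpM2l ?(ltW M0)//.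
  apply: le_trans (normal_mass_lower th0 s1 M0 aM) _.
  by rewrite /Rintegral integral_indic// setIT.
(* For h >= 0 the integrand is nonnegative and at least [M] on ]M, M + 1[. For h < 0, centering
   turns the integral into that of - t over t < h, which is at least [M] on ]- M - 1, - M[. *)
have [h0|h0] := leP 0 h.
  apply: (lower M); first exact: I.
  - by move=> t; rewrite in_itv /= => /andP[Mt tM]; rewrite ler_sqr ?nnegrE; lra.
  - move=> t; rewrite !indicE !mem_setE !in_itv /= andbT.
    have [/andP[Mt tM]|_] := boolP (_ < t < _).
      by have -> : h <= t by [lra]; rewrite /= mul1r mulr1; lra.
    by rewrite mulr0; case: (leP h t) => th; rewrite /= ?mul0r// mul1r; lra.
have -> : \int[N]_t (\1_(`[h, +oo[) t * t) = \int[N]_t (- (\1_(`]-oo, h[) t * t)).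
  have := normal_mean.
  have -> : \int[N]_t t = \int[N]_t (\1_(`[h, +oo[) t * t + \1_(`]-oo, h[) t * t).
    apply: eq_Rintegral => t _; rewrite -mulrDl !indicE !mem_setE !in_itv /= andbT ltNge.
    by case: (h <= t); rewrite ?addr0 ?add0r mul1r.
  rewrite RintegralD//; [|exact: I|exact: I].
  move/eqP; rewrite addr_eq0 => /eqP ->.
  rewrite -mulN1r -RintegralZl//; last exact: I.
  by apply: eq_Rintegral => t _; rewrite mulN1r.
apply: (lower (- M - 1)).
- have := integrableN (I `]-oo, h[%classic (measurable_itv _)).
  by apply: eq_integrable => // t _ /=.
- move=> t; rewrite in_itv /= => /andP[Mt tM].
  rewrite -(sqrrN t) ler_sqr ?nnegrE; lra.
- move=> t; rewrite !indicE !mem_setE !in_itv /=.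
  have [/andP[Mt tM]|_] := boolP (_ < t < _).
    by have -> : t < h by [lra]; rewrite /= mul1r mulr1; lra.
  by rewrite mulr0; case: (ltP t h) => th; rewrite /= ?mul0r ?oppr0// mul1r; lra.
Qed.

End NormalMoments.

Lemma fine_prob_indic d (T : measurableType d) (R : realType) (P : probability T R)
  (A : set T) : measurable A -> fine (P A) = \int[P]_x \1_A x.
Proof. by move=> mA; rewrite /Rintegral integral_indic// setIT. Qed.

Section GaussianEvents.
Context {R : realType} {V : choiceType} (C : V -> V -> R).
Variable P : probability (field_space R V) R.
Hypothesis gaussP : centered_gaussian_field C P.
Hypothesis C_sym : forall x y, C x y = C y x.
Hypothesis C_ge0 : forall K a, 0 <= bilin C K a a.
Local Notation F := (field_space R V).

Section FormLaw.
Variables (K : {fset V}) (a : V -> R).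
Hypothesis var_gt0 : 0 < bilin C K a a.
Local Notation N := (normal_prob (0 : R) (Num.sqrt (bilin C K a a))).

Let law (A : set (measurableTypeR R)) : measurable A ->
  @image_prob _ _ _ (measurableTypeR R) _ P _ (measurable_fset_form K a) A = N A.
Proof.
move=> mA; have := gaussP K a mA.
by rewrite /centered_normal [X in X == 0](_ : _ = bilin C K a a)// gt_eqF.
Qed.

Lemma form_integral (f : R -> \bar R) : measurable_fun setT f -> (forall t, (0 <= f t)%E) ->
  (\int[P]_phi f (fset_form K a phi) = \int[N]_t f t)%E.
Proof.
move=> mf f0.
rewrite -(@ge0_integral_image_prob _ _ _ (measurableTypeR R) _ P _ (measurable_fset_form K a))//.
by apply: eq_measure_integral => A mA _; exact: law.
Qed.

Lemma form_integrable (f : R -> R) : measurable_fun setT f ->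
  (N : measure _ R).-integrable setT (EFin \o f) ->
  P.-integrable setT (fun phi => (f (fset_form K a phi))%:E).
Proof.
move=> mf /integrableP[_ fi]; apply/integrableP; split.
  by apply/measurable_EFinP; exact: (measurableT_comp mf (measurable_fset_form K a)).
apply: le_lt_trans fi.
rewrite (form_integral (f := fun t => `|(f t)%:E|%E))//.
by apply: measurableT_comp => //; exact/measurable_EFinP.
Qed.

Lemma form_Rintegral (f : R -> R) : measurable_fun setT f ->
  (N : measure _ R).-integrable setT (EFin \o f) ->
  \int[P]_phi f (fset_form K a phi) = \int[N]_t f t.
Proof.
move=> mf fi; congr fine.
transitivity (\int[@image_prob _ _ _ (measurableTypeR R) _ P _ (measurable_fset_form K a)]_t
   (f t)%:E)%E; last by apply: eq_measure_integral => A mA _; exact: law.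
rewrite /image_prob integral_distribution//; first exact/measurable_EFinP.
exact: form_integrable.
Qed.

End FormLaw.

Section Coordinate.
Variable x : V.
Hypothesis Cx : 0 < C x x.
Local Notation N := (normal_prob (0 : R) (Num.sqrt (C x x))).

Let form1 (phi : F) : fset_form [fset x]%fset (fun=> 1) phi = phi x.
Proof. by rewrite /fset_form big_seq_fset1 mul1r. Qed.

Let bilin1 : bilin C [fset x]%fset (fun=> 1) (fun=> 1) = C x x.
Proof. by rewrite /bilin !big_seq_fset1 !mul1r. Qed.

Lemma coord_integrable (f : R -> R) : measurable_fun setT f ->
  (N : measure _ R).-integrable setT (EFin \o f) ->
  P.-integrable setT (fun phi : F => (f (phi x))%:E).
Proof.
move=> mf; rewrite -bilin1 => fi.
have -> : (fun phi : F => (f (phi x))%:E) =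
    (fun phi => (f (fset_form [fset x]%fset (fun=> 1) phi))%:E).
  by apply/funext => phi; rewrite form1.
by apply: form_integrable => //; rewrite bilin1.
Qed.

Lemma coord_Rintegral (f : R -> R) : measurable_fun setT f ->
  (N : measure _ R).-integrable setT (EFin \o f) ->
  \int[P]_phi f (phi x) = \int[N]_t f t.
Proof.
move=> mf; rewrite -bilin1 => fi; rewrite -form_Rintegral// ?bilin1//.
by apply: eq_Rintegral => phi _; rewrite form1.
Qed.

Let sqrt0 : 0 < Num.sqrt (C x x). Proof. by rewrite sqrtr_gt0. Qed.

Lemma coord_integrable_bounded (g : F -> R) : bounded_measurable g ->
  P.-integrable setT (EFin \o (fun phi => g phi * phi x)).
Proof.
move=> [mg [D gD]].
have I := integrableZl measurableT D (coord_integrable (@measurable_id _ _ _)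
  (normal_integrable_id sqrt0)).
apply: le_integrable I => //.
  by apply/measurable_EFinP; apply: measurable_funM => //; exact: measurable_coord.
move=> phi _ /=; rewrite !lee_fin !normrM ler_wpM2r//.
exact: le_trans (gD phi) (ler_norm _).
Qed.

Lemma coord_mean : \int[P]_phi phi x = 0.
Proof.
rewrite (coord_Rintegral (f := fun t => t)) ?normal_mean//.
exact: (normal_integrable_id sqrt0).
Qed.

End Coordinate.

Section Association.
Variables (K : {fset V}) (Q : V -> V -> R).
Hypothesis pQ : precision C K Q.

Lemma four_functions_real (g1 g2 g3 g4 : F -> R) :
  depends_on K g1 -> depends_on K g2 -> depends_on K g3 -> depends_on K g4 ->
  P.-integrable setT (EFin \o g1) -> P.-integrable setT (EFin \o g2) ->
  P.-integrable setT (EFin \o g3) -> P.-integrable setT (EFin \o g4) ->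
  (forall phi, 0 <= g1 phi) -> (forall phi, 0 <= g2 phi) ->
  (forall phi, 0 <= g3 phi) -> (forall phi, 0 <= g4 phi) ->
  (forall phi psi,
    g1 phi * g2 psi <= g3 (field_max phi psi) * g4 (field_min phi psi)) ->
  (\int[P]_phi g1 phi) * (\int[P]_phi g2 phi) <=
  (\int[P]_phi g3 phi) * (\int[P]_phi g4 phi).
Proof.
move=> d1 d2 d3 d4 i1 i2 i3 i4 p1 p2 p3 p4 H.
have D (g : F -> R) : depends_on K g -> depends_on K (EFin \o g).
  by move=> dg phi psi E /=; rewrite (dg _ _ E).
have M (g : F -> R) : P.-integrable setT (EFin \o g) -> measurable_fun setT (EFin \o g).
  by move=> /integrableP[].
have Z (g : F -> R) : (forall phi, 0 <= g phi) -> forall phi, (0 <= (EFin \o g) phi)%E.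
  by move=> g0 phi; rewrite lee_fin.
have := gaussian_four_functions gaussP C_sym C_ge0 pQ
  (D _ d1) (D _ d2) (D _ d3) (D _ d4) (M _ i1) (M _ i2) (M _ i3) (M _ i4)
  (Z _ p1) (Z _ p2) (Z _ p3) (Z _ p4).
have E (g : F -> R) : P.-integrable setT (EFin \o g) ->
    (\int[P]_phi (EFin \o g) phi = (\int[P]_phi g phi)%:E)%E.
  by move=> ig; rewrite /Rintegral fineK//; exact: integrable_fin_num.
rewrite (E _ i1) (E _ i2) (E _ i3) (E _ i4) -!EFinM lee_fin; apply.
by move=> phi psi; rewrite -!EFinM lee_fin.
Qed.

End Association.

(** Coordinates are peeled one at a time: strict positivity on a cell survives because the
    conditional normal density is positive on each side of [h]. *)
Lemma positive_on_cell (K : {fset V}) Q (h : R) (b : V -> bool) (g : F -> \bar R) :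
  precision C K Q -> depends_on K g -> measurable_fun setT g ->
  (forall phi, (0 <= g phi)%E) ->
  (forall phi, {in K, forall x, (h <= phi x) = b x} -> (0 < g phi)%E) ->
  (0 < \int[P]_phi g phi)%E.
Proof.
elim: {K}#|` K| {-2}K (erefl #|` K|) Q g => [|k IH] K cK Q g pQ dg mg g0 gpos.
  have K0 : K = fset0 by apply/eqP; rewrite -cardfs_eq0 cK.
  have -> : (\int[P]_phi g phi = \int[P]_phi cst (g (fun=> 0%R)) phi)%E.
    by apply: eq_integral => phi _; apply: dg => x; rewrite K0 inE.
  rewrite integral_cst; last exact: measurableT.
  rewrite mule_gt0//; first by apply: gpos => x; rewrite K0 inE.
  apply: lt_le_trans (lte01) _; rewrite le_eqVlt; apply/orP; left; apply/eqP/esym.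
  exact: probability_setT.
have [n nK] : exists n, n \in K by apply/fset0Pn; rewrite -cardfs_gt0 cK.
have Qn := precision_diag_gt0 C_sym C_ge0 pQ nK.
rewrite (expectation_peel gaussP C_sym C_ge0 pQ nK dg mg g0).
apply: (IH (K `\ n)%fset _ (schur Q n)).
- by move: cK; rewrite (cardfsD1 n) nK => -[].
- exact: precision_schur.
- exact: depends_peel.
- exact: measurable_peel.
- by move=> phi; exact: peel_ge0.
move=> phi phib.
have s0 : 0 < Num.sqrt (Q n n)^-1 by rewrite sqrtr_gt0 invr_gt0.
pose c := (\sum_(j <- (K `\ n)%fset) Q n j * phi j) / Q n n.
pose f (t : R) := (g (update n (phi, t)) * (normal_pdf 0 (Num.sqrt (Q n n)^-1) (t + c)%R)%:E)%E.
have mf : measurable_fun setT f.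
  apply: emeasurable_funM.
    have mu' : measurable_fun setT (fun t : R => update n (phi, t)).
      apply: (measurableT_comp (measurable_update n)).
      by apply: measurable_fun_pair; [exact: measurable_cst|exact: measurable_id].
    exact: (measurableT_comp mg mu').
  apply/measurable_EFinP; apply: measurableT_comp; first exact: measurable_normal_pdf.
  exact: measurable_addr.
have f0 t : (0 <= f t)%E by rewrite mule_ge0// lee_fin normal_pdf_ge0.
rewrite -/(peel K Q n g phi) lt_def peel_ge0// andbT; apply/eqP => I0.
have /ae_eq_integral_abs : (\int[@lebesgue_measure R]_t `|f t| = 0)%E.
  by rewrite -[RHS]I0; apply: eq_integral => t _; rewrite gee0_abs.
move=> /(_ measurableT mf).
(* A unit interval on the side of [h] prescribed for [n]: a vanishing integral would force it to be
   Lebesgue-null. *)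
pose J : set R := if b n then `[h, h + 1]%classic else `[h - 1, h[%classic.
have Jpos t : J t -> (0 < f t)%E.
  rewrite /J => Jt; rewrite mule_gt0//; last by rewrite lte_fin (normal_pdfE0 s0) mulr_gt0 ?expR_gt0 ?normal_peak_gt0 ?gt_eqF.
  apply: gpos => x xK; rewrite /update /=; case: eqP => [->|/eqP xn]; last by apply: phib; rewrite !inE xn.
  by move: Jt; case: (b n); rewrite /= in_itv /= => /andP[]; [move=> ->|move=> _; rewrite ltNge => /negbTE].
move=> [Z [mZ Z0 JZ]].
have : (lebesgue_measure J <= lebesgue_measure Z)%E.
  apply: le_measure; rewrite ?inE//; first by rewrite /J; case: (b n).
  move=> t Jt; apply: JZ => /(_ I) ft0; have := Jpos t Jt; rewrite ft0.
  by rewrite ltxx.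
rewrite Z0 /J; case: (b n); rewrite lebesgue_measure_itv /= lte_fin.
  by rewrite ltrDl ltr01 -EFinD lee_fin; lra.
by rewrite gtrBl ltr01 -EFinD lee_fin; lra.
Qed.

End GaussianEvents.

(** * Influences bounded by covariances *)

Section InfluenceCovariance.
Context {R : realType} {V : choiceType} (C : V -> V -> R).
Variable P : probability (field_space R V) R.
Hypothesis gaussP : centered_gaussian_field C P.
Hypothesis C_sym : forall x y, C x y = C y x.
Hypothesis C_ge0 : forall K a, 0 <= bilin C K a a.
Local Notation F := (field_space R V).
Variables (K : {fset V}) (Q : V -> V -> R).
Hypothesis pQ : precision C K Q.

Lemma measurable_coord_ge (x : V) (h : R) : measurable [set phi : F | h <= phi x].
Proof.
have := measurable_coord x measurableT (measurable_itv `[h, +oo[).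
by rewrite setTI; congr measurable; apply/seteqP; split => phi /=; rewrite in_itv /= andbT.
Qed.

Section Event.
Variables (E : set F) (x : V) (h : R).
Hypothesis mE : measurable E.
Hypothesis dE : depends_on K (\1_E : F -> R).
Hypothesis E_incr : forall phi psi : F, (forall y, phi y <= psi y) -> E phi -> E psi.
Hypothesis xK : x \in K.
Hypothesis Cx : 0 < C x x.

Let f (phi : F) : R := \1_E phi.
Let b (phi : F) : R := (h <= phi x)%R%:R.
Let b' (phi : F) : R := (phi x < h)%R%:R.
Let T (phi : F) : R := phi x.

Let in_up phi : (phi \in [set phi : F | h <= phi x]) = (h <= phi x).
Proof. by apply/idP/idP; rewrite inE. Qed.

Let bE : b = \1_[set phi : F | h <= phi x].
Proof. by apply/funext => phi; rewrite /b indicE in_up. Qed.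

Let b'E : b' = \1_(~` [set phi : F | h <= phi x]).
Proof. by apply/funext => phi; rewrite /b' indicE in_setC in_up ltNge. Qed.

Let bb : bounded_measurable b.
Proof. by rewrite bE; apply: bounded_measurable_indic; exact: measurable_coord_ge. Qed.

Let bb' : bounded_measurable b'.
Proof. by rewrite b'E; apply: bounded_measurable_indic; exact: (measurableC (measurable_coord_ge _ _)). Qed.

Let bf : bounded_measurable f.
Proof. exact: bounded_measurable_indic. Qed.

Let db : depends_on K b. Proof. by move=> phi psi e; rewrite /b e. Qed.
Let db' : depends_on K b'. Proof. by move=> phi psi e; rewrite /b' e. Qed.
Let dT : depends_on K T. Proof. by move=> phi psi e; rewrite /T e. Qed.

Let f_mono phi psi : (forall y, phi y <= psi y) -> f phi <= f psi.
Proof.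
move=> le; rewrite /f !indicE; have [Ep|] := boolP (phi \in E); last by rewrite ler0n.
by rewrite (mem_set (E_incr le (set_mem Ep))).
Qed.

Let f01 phi : f phi = 0 \/ f phi = 1.
Proof. by rewrite /f indicE; case: (_ \in _); [right|left]. Qed.

Let integ (u : F -> R) : bounded_measurable u -> P.-integrable setT (EFin \o u).
Proof. exact: bounded_measurable_integrable. Qed.

Let integT (u : F -> R) : bounded_measurable u ->
  P.-integrable setT (EFin \o (fun phi => u phi * T phi)).
Proof. exact: (coord_integrable_bounded gaussP C_sym Cx). Qed.

Let integ_up u : bounded_measurable u ->
  P.-integrable setT (EFin \o (fun phi => u phi * (T phi - h))).
Proof.
move=> bu; have I := integrableB measurableT (integT bu) (integ (bounded_measurableM bu (bounded_measurable_cst _ h))).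
by apply: eq_integrable I => // phi _ /=; rewrite -EFinB mulrBr.
Qed.

Let integ_down u : bounded_measurable u ->
  P.-integrable setT (EFin \o (fun phi => u phi * (h - T phi))).
Proof.
move=> bu; have I := integrableB measurableT (integ (bounded_measurableM bu (bounded_measurable_cst _ h))) (integT bu).
by apply: eq_integrable I => // phi _ /=; rewrite -EFinB mulrBr.
Qed.

Let mean_up u : bounded_measurable u ->
  \int[P]_phi (u phi * (T phi - h)) = \int[P]_phi (u phi * T phi) - h * \int[P]_phi u phi.
Proof.
move=> bu; rewrite -RintegralZl//; last exact: integ.
rewrite -RintegralB//; last 2 first.
- exact: integT.
- by apply: integ; apply: bounded_measurableM => //; exact: bounded_measurable_cst.
by apply: eq_Rintegral => phi _; ring.
Qed.

Let mean_down u : bounded_measurable u ->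
  \int[P]_phi (u phi * (h - T phi)) = h * \int[P]_phi u phi - \int[P]_phi (u phi * T phi).
Proof.
move=> bu; rewrite -RintegralZl//; last exact: integ.
rewrite -RintegralB//; last 2 first.
- by apply: integ; apply: bounded_measurableM => //; exact: bounded_measurable_cst.
- exact: integT.
by apply: eq_Rintegral => phi _; ring.
Qed.

(** Association on phi x >= h, stated with [T - h], which is nonnegative there, because the four
    functions theorem requires nonnegative functions. The terms in [h] cancel afterwards. *)
Let upper : (\int[P]_phi (f phi * b phi)) * (\int[P]_phi (b phi * (T phi - h))) <=
  (\int[P]_phi (f phi * b phi * (T phi - h))) * (\int[P]_phi b phi).
Proof.
have bfb := bounded_measurableM bf bb.
apply: (four_functions_real gaussP C_sym C_ge0 pQ).
- by move=> phi psi e; rewrite /f (dE e) (db e).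
- by move=> phi psi e; rewrite (db e) (dT e).
- by move=> phi psi e; rewrite /f (dE e) (db e) (dT e).
- exact: db.
- exact: integ.
- exact: integ_up.
- exact: integ_up.
- exact: integ.
- by move=> phi; rewrite mulr_ge0// ler0n.
- move=> phi; rewrite /b /T; case: (leP h (phi x)) => hx; rewrite ?mul0r// mul1r subr_ge0//.
- move=> phi; rewrite /b /T; case: (leP h (phi x)) => hx; rewrite ?mulr0 ?mul0r// mulr1.
  by rewrite mulr_ge0 ?subr_ge0// ler0n.
- by move=> phi; rewrite ler0n.
move=> phi psi; rewrite /b /T /field_max /field_min le_max le_min.
case: (leP h (phi x)) => hx; last by rewrite /= ?andbF /= !(mulr0, mul0r).
case: (leP h (psi x)) => hy; last by rewrite /= ?andbF /= !(mulr0, mul0r).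
rewrite /= !mulr1 mul1r.
apply: ler_pM; rewrite ?ler0n ?subr_ge0//.
  by apply: f_mono => y; rewrite le_max lexx.
by rewrite lerD2r le_max lexx orbT.
Qed.

Let lower : (\int[P]_phi (f phi * b' phi * (h - T phi))) * (\int[P]_phi b' phi) <=
  (\int[P]_phi (f phi * b' phi)) * (\int[P]_phi (b' phi * (h - T phi))).
Proof.
have bfb := bounded_measurableM bf bb'.
apply: (four_functions_real gaussP C_sym C_ge0 pQ).
- by move=> phi psi e; rewrite /f (dE e) (db' e) (dT e).
- exact: db'.
- by move=> phi psi e; rewrite /f (dE e) (db' e).
- by move=> phi psi e; rewrite (db' e) (dT e).
- exact: integ_down.
- exact: integ.
- exact: integ.
- exact: integ_down.
- move=> phi; rewrite /b' /T; case: (ltP (phi x) h) => hx; rewrite ?mulr0 ?mul0r// mulr1.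
  by rewrite mulr_ge0 ?subr_ge0 ?(ltW hx)// ler0n.
- by move=> phi; rewrite ler0n.
- by move=> phi; rewrite mulr_ge0// ler0n.
- by move=> phi; rewrite /b' /T; case: (ltP (phi x) h) => hx; rewrite ?mul0r// mul1r subr_ge0 ltW.
move=> phi psi; rewrite /b' /T /field_max /field_min gt_max gt_min.
case: (ltP (phi x) h) => hx; last by rewrite /= ?andbF /= !(mulr0, mul0r).
case: (ltP (psi x) h) => hy; last by rewrite /= ?andbF /= !(mulr0, mul0r).
rewrite /= !mulr1 mul1r.
apply: ler_pM; rewrite ?ler0n ?subr_ge0 ?(ltW hx)//.
  by apply: f_mono => y; rewrite le_max lexx.
by rewrite lerD2l lerN2 ge_min lexx.
Qed.

(** Both conditioning events thus have positive probability, and the quotients in [influence] are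
    true conditional probabilities. *)
Lemma prob_half_line : 0 < \int[P]_phi b phi < 1.
Proof.
have pos (u : F -> R) (c : V -> bool) : bounded_measurable u -> depends_on K u ->
    (forall phi, 0 <= u phi) -> (forall phi : F, (h <= phi x) = c x -> 0 < u phi) ->
    0 < \int[P]_phi u phi.
  move=> bu du u0 up; rewrite -lte_fin /Rintegral fineK; last first.
    by apply: integrable_fin_num => //; exact: integ.
  apply: (positive_on_cell gaussP C_sym C_ge0 (h := h) (b := c) pQ).
  - by move=> phi psi e; rewrite (du _ _ e).
  - by apply/measurable_EFinP; case: bu.
  - by move=> phi; rewrite lee_fin.
  - by move=> phi e; rewrite lte_fin; apply: up; exact: e.
apply/andP; split.
  apply: (pos b (fun=> true) bb db) => [phi|phi e]; first by rewrite ler0n.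
  by move: e; rewrite /b; case: (h <= phi x) => // _; exact: ltr01.
have : 0 < \int[P]_phi b' phi.
  apply: (pos b' (fun=> false) bb' db') => [phi|phi e]; first by rewrite ler0n.
  have e' : (h <= phi x) = false := e.
  by rewrite /b' (ltNge (phi x)) e'; exact: ltr01.
have -> : \int[P]_phi b' phi = \int[P]_phi (1 - b phi).
  by apply: eq_Rintegral => phi _; rewrite /b' /b ltNge; case: (h <= phi x); rewrite ?subrr ?subr0.
rewrite RintegralB//; [|exact: integ (bounded_measurable_cst _ _)|exact: integ].
rewrite Rintegral_cst; last exact: measurableT.
have -> : fine (P setT) = 1 by have := probability_setT P => /(congr1 fine).
by rewrite mulr1 subr_gt0.
Qed.

Let split_below (u : F -> R) : P.-integrable setT (EFin \o (fun phi => u phi * b phi)) ->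
    P.-integrable setT (EFin \o (fun phi => u phi * b' phi)) ->
    \int[P]_phi u phi = \int[P]_phi (u phi * b phi) + \int[P]_phi (u phi * b' phi).
Proof.
move=> i1 i2; rewrite -RintegralD//; apply: eq_Rintegral => phi _.
by rewrite /b /b' ltNge; case: (h <= phi x); rewrite ?mulr1 ?mulr0 ?addr0 ?add0r.
Qed.

Let prob_below : \int[P]_phi b' phi = 1 - \int[P]_phi b phi.
Proof.
have := split_below (u := fun=> 1); have E1 : \int[P]_phi (1 : R) = 1.
  rewrite Rintegral_cst; last exact: measurableT.
  by have := probability_setT P => /(congr1 fine) /= ->; rewrite mulr1.
rewrite E1 => ->; last 2 first.
- by apply: integ; apply: bounded_measurableM => //; exact: bounded_measurable_cst.
- by apply: integ; apply: bounded_measurableM => //; exact: bounded_measurable_cst.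
have -> : \int[P]_phi (1 * b phi) = \int[P]_phi b phi by apply: eq_Rintegral => ? _; rewrite mul1r.
have -> : \int[P]_phi (1 * b' phi) = \int[P]_phi b' phi by apply: eq_Rintegral => ? _; rewrite mul1r.
by rewrite addrAC subrr add0r.
Qed.

Lemma influenceE : influence P E h x =
  \int[P]_phi (f phi * b phi) / \int[P]_phi b phi -
  \int[P]_phi (f phi * b' phi) / (1 - \int[P]_phi b phi).
Proof.
rewrite -prob_below /influence /cond_prob; congr (_ / _ - _ / _).
- rewrite fine_prob_indic; last by apply: measurableI => //; exact: measurable_coord_ge.
  by apply: eq_Rintegral => phi _; rewrite bE indicI.
- by rewrite fine_prob_indic ?bE//; exact: measurable_coord_ge.
- have -> : [set phi : F | phi x < h] = ~` [set phi : F | h <= phi x].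
    by apply/seteqP; split => phi /=; rewrite ltNge => /negP.
  rewrite fine_prob_indic; last by apply: measurableI => //; exact: (measurableC (measurable_coord_ge _ _)).
  by apply: eq_Rintegral => phi _; rewrite b'E indicI.
- have -> : [set phi : F | phi x < h] = ~` [set phi : F | h <= phi x].
    by apply/seteqP; split => phi /=; rewrite ltNge => /negP.
  by rewrite fine_prob_indic ?b'E//; exact: (measurableC (measurable_coord_ge _ _)).
Qed.

(* The covariance of [1_E] and [phi x] splits over the events [phi x >= h] and
   [phi x < h]; on each of them positive association applies. *)
Lemma covariance_ge_influence :
  influence P E h x * (\int[P]_phi (b phi * T phi)) <= \int[P]_phi (f phi * T phi).
Proof.
have /andP[p0 p1] := prob_half_line.
have bfb := bounded_measurableM bf bb; have bfb' := bounded_measurableM bf bb'.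
have q := prob_below.
have q0 : 0 < 1 - \int[P]_phi b phi by rewrite subr_gt0.
have swap (u v : F -> R) : \int[P]_phi (u phi * v phi) = \int[P]_phi (v phi * u phi).
  by apply: eq_Rintegral => ? _; rewrite mulrC.
(* The coordinate is centered, so both halves carry the same constant; this makes the difference of
   conditional probabilities appear. *)
have tau : \int[P]_phi (b' phi * T phi) = - \int[P]_phi (b phi * T phi).
  have H : \int[P]_phi T phi = \int[P]_phi (T phi * b phi) + \int[P]_phi (T phi * b' phi).
    apply: split_below.
    - by apply: eq_integrable (integT bb) => // phi _ /=; rewrite mulrC.
    - by apply: eq_integrable (integT bb') => // phi _ /=; rewrite mulrC.
  move: H; rewrite (coord_mean gaussP C_sym Cx) !(swap T) => H.
  by apply/eqP; rewrite -addr_eq0 addrC -H.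
have sig : \int[P]_phi (f phi * T phi) =
    \int[P]_phi (f phi * b phi * T phi) + \int[P]_phi (f phi * b' phi * T phi).
  rewrite (split_below (u := fun phi => f phi * T phi)).
  - by congr (_ + _); apply: eq_Rintegral => phi _; rewrite mulrAC.
  - by apply: eq_integrable (integT bfb) => // phi _ /=; rewrite mulrAC.
  - by apply: eq_integrable (integT bfb') => // phi _ /=; rewrite mulrAC.
have := upper; rewrite (mean_up bb) (mean_up bfb).
have := lower; rewrite (mean_down bb') (mean_down bfb') q tau sig.
rewrite influenceE.
set p := \int[P]_phi b phi in p0 p1 q q0 *.
set al := \int[P]_phi (f phi * b phi); set be := \int[P]_phi (f phi * b' phi).
set t := \int[P]_phi (b phi * T phi).
set s1 := \int[P]_phi (f phi * b phi * T phi); set s2 := \int[P]_phi (f phi * b' phi * T phi).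
move=> H2 H1.
have A1 : al / p * t <= s1 by rewrite mulrAC ler_pdivrMr//; lra.
have A2 : - (be / (1 - p) * t) <= s2.
  by rewrite mulrAC -mulNr ler_pdivrMr//; lra.
by rewrite mulrBl; lra.
Qed.

End Event.
End InfluenceCovariance.

(** * Derivative of a level probability *)

Section LevelDerivative.
Context {R : realType} {V : choiceType} (C : V -> V -> R).
Variable P : probability (field_space R V) R.
Hypothesis gaussP : centered_gaussian_field C P.
Hypothesis C_sym : forall x y, C x y = C y x.
Hypothesis C_ge0 : forall K a, 0 <= bilin C K a a.
Local Notation F := (field_space R V).
Variables (T : finType) (site : T -> V) (A : {set {ffun T -> bool}}).

Lemma measurable_level_event h : measurable (level_event site A h : set F).
Proof.
have -> : level_event site A h = \bigcup_(w in [set w | w \in A])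
    \big[setI/setT]_(t : T) [set phi : F | (h <= phi (site t)) = w t].
  apply/seteqP; split => phi /=.
    move=> wA; exists [ffun t => h <= phi (site t)] => //.
    by rewrite -bigcap_seq => t _ /=; rewrite ffunE.
  move=> [w wA]; rewrite -bigcap_seq => phiw; rewrite /level_event /=.
  suff -> : [ffun t => h <= phi (site t)] = w by [].
  by apply/ffunP => t; rewrite ffunE; apply: phiw; rewrite /= mem_index_enum.
apply: fin_bigcup_measurable; first exact: finite_finset.
move=> w _; apply: bigsetI_measurable => t _.
have mt := measurable_coord_ge (R := R) (site t) h.
case: (w t).
  by have -> : [set phi : F | (h <= phi (site t)) = true] = [set phi : F | h <= phi (site t)].
have -> : [set phi : F | (h <= phi (site t)) = false] = ~` [set phi : F | h <= phi (site t)].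
  by apply/seteqP; split => phi /=; [move=> ->|move=> /negP /negbTE].
exact: measurableC.
Qed.

Variables (K : {fset V}) (Q : V -> V -> R) (theta : R).
Hypothesis pQ : precision C K Q.
Hypothesis site_in : forall t, site t \in K.
Hypothesis theta_gt0 : 0 < theta.
Hypothesis rowsum : {in K, forall x, theta <= \sum_(y <- K) Q x y}.
Hypothesis K_neq0 : K != fset0.
Hypothesis C_gt0 : {in K, forall x, 0 < C x x}.

Let q (x : V) : R := \sum_(y <- K) Q x y.
Let v := \sum_(x <- K) q x.

(** Summing [precision_row] over K: the form with coefficients [q] has covariance 1 with every
    coordinate of K. Divided by its variance [v], it becomes the common part Z. *)
Let bilin_q b : bilin C K q b = \sum_(x <- K) b x.
Proof.
transitivity (bilin C K (fun x => \sum_(z <- K) Q z x) b).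
  case: pQ => sym _ _; apply: eq_big_seq => x xK; apply: eq_bigr => y _.
  by congr (_ * _ * _); apply: eq_big_seq => z zK; exact: sym.
rewrite (bilin_sym C_sym) bilin_sumr; apply: eq_big_seq => z zK.
by rewrite (bilin_sym C_sym) (precision_row pQ zK).
Qed.

Let v_gt0 : 0 < v.
Proof.
have [x xK] : exists x, x \in K by exact/fset0Pn.
rewrite /v (big_fsetD1 x)//= ltr_wpDr//; last exact: lt_le_trans (rowsum xK).
rewrite big_seq; apply: sumr_ge0 => y; rewrite !inE => /andP[_ yK].
exact: le_trans (ltW theta_gt0) (rowsum yK).
Qed.

Let a0 x := v^-1 * q x.
(** Coordinate [w] minus Z. The first factor makes the form zero outside K, where Z alone would be
    correlated with itself. *)
Let a (w x : V) : R := (w \in K)%:R * ((x == w)%:R + (- 1) * a0 x).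

Let var : bilin C K a0 a0 = v^-1.
Proof.
rewrite (bilinZl C_sym) bilinZr bilin_q -/v mulVf ?mulr1// gt_eqF//.
Qed.

Let var_gt0 : 0 < bilin C K a0 a0. Proof. by rewrite var invr_gt0. Qed.

Let unc w : bilin C K a0 (a w) = 0.
Proof.
rewrite bilinZr bilinDr bilinZr var (bilinZl C_sym) bilin_q.
have [wK|] := boolP (w \in K); last by rewrite mul0r.
rewrite (big_fsetD1 w)//= eqxx big1_fset ?addr0; first by rewrite /=; ring.
by move=> y; rewrite !inE => /andP[yw _] _; rewrite (negbTE yw).
Qed.

Let Z (phi : F) : R := fset_form K a0 phi.

Let formsE phi w : w \in K -> forms K a phi w = phi w - Z phi.
Proof.
move=> wK; rewrite /forms /fset_form.
transitivity (\sum_(x <- K) (x == w)%:R * phi x - \sum_(x <- K) a0 x * phi x).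
  by rewrite -sumrB; apply: eq_bigr => x _; rewrite /a wK /=; ring.
congr (_ - _); rewrite (big_fsetD1 w)//= eqxx mul1r big1_fset ?addr0// => y.
by rewrite !inE => /andP[yw _] _; rewrite (negbTE yw) mul0r.
Qed.

Local Notation s := (Num.sqrt (bilin C K a0 a0)).
Local Notation N := (normal_prob (0 : R) s).
Let s_gt0 : 0 < s. Proof. by rewrite sqrtr_gt0. Qed.

Let raise (p : F * R) : F := fun w => p.1 w + p.2.

Let measurable_raise : measurable_fun setT raise.
Proof.
apply: measurable_to_field => w; apply: measurable_funD; last exact: measurable_snd.
exact: (measurableT_comp (measurable_coord w) measurable_fst).
Qed.

Let E0 := level_event site A 0 : set F.

Let raiseE h phi : (\1_(level_event site A h) phi : R) = \1_E0 (raise (forms K a phi, Z phi - h)).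
Proof.
rewrite !indicE; congr (nat_of_bool _)%:R; apply/idP/idP; rewrite !inE /E0 /level_event /=.
  suff -> : [ffun t => 0 <= raise (forms K a phi, Z phi - h) (site t)] = [ffun t => h <= phi (site t)] by [].
  apply/ffunP => t; rewrite !ffunE /raise /= formsE//.
  by rewrite addrA subrK subr_ge0.
suff -> : [ffun t => 0 <= raise (forms K a phi, Z phi - h) (site t)] = [ffun t => h <= phi (site t)] by [].
apply/ffunP => t; rewrite !ffunE /raise /= formsE//.
by rewrite addrA subrK subr_ge0.
Qed.

Let k (u : R) : \bar R := (\int[P]_phi (\1_E0 (raise (forms K a phi, u)))%:E)%E.
Let Fs (u : R) : R := fine (k u).

Let mind : measurable_fun setT (fun p : F * R => (\1_E0 (raise p) : R)).
Proof.
apply: (measurableT_comp _ measurable_raise); apply: measurable_indic.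
exact: measurable_level_event.
Qed.

Let mforms : measurable_fun setT (fun p : F * R => (forms K a p.1, p.2)).
Proof.
apply: measurable_fun_pair; last exact: measurable_snd.
exact: (measurableT_comp (measurable_forms K a) measurable_fst).
Qed.

Let msnd u : measurable_fun setT (fun phi : F => (forms K a phi, u) : F * R).
Proof.
by apply: measurable_fun_pair; [exact: measurable_forms|exact: measurable_cst].
Qed.

Let bind u : bounded_measurable (fun phi => (\1_E0 (raise (forms K a phi, u)) : R)).
Proof.
split; first exact: (measurableT_comp mind (msnd u)).
by exists 1 => phi; rewrite indicE; case: (_ \in _); rewrite /= ?normr1 ?normr0.
Qed.

Let kE u : k u = (Fs u)%:E.
Proof.
rewrite /Fs fineK//; apply: integrable_fin_num => //.
exact: (bounded_measurable_integrable P (bind u)).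
Qed.

Let mk : measurable_fun setT k.
Proof.
apply: (@measurable_fun_fubini_tonelli_G _ _ _ _ R P
   (fun p : F * R => (\1_E0 (raise (forms K a p.1, p.2)))%:E)).
  apply/measurable_EFinP; exact: (measurableT_comp mind mforms).
by move=> p; rewrite lee_fin.
Qed.

Let bFs : bounded_measurable Fs.
Proof.
split.
  have : measurable_fun setT (EFin \o Fs).
    have -> : EFin \o Fs = k by apply/funext => u; rewrite kE.
    exact: mk.
  by move/measurable_EFinP.
exists 1 => u; rewrite ger0_norm; last first.
  by apply: fine_ge0; apply: integral_ge0 => phi _; rewrite lee_fin.
rewrite -lee_fin -kE; apply: le_trans (_ : \int[P]_phi cst 1%E phi <= _)%E.
  apply: ge0_le_integral => //.
  - by apply/measurable_EFinP; case: (bind u).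
  - by move=> phi _; rewrite lee_fin indicE; case: (_ \in _).
rewrite integral_cst; last exact: measurableT.
rewrite mul1e le_eqVlt; apply/orP; left; apply/eqP; exact: probability_setT.
Qed.

Let disintegrate h (r : R -> R) : measurable_fun setT r -> (forall t, 0 <= r t) ->
  \int[P]_phi (\1_(level_event site A h) phi * r (Z phi)) = \int[N]_t (Fs (t - h) * r t).
Proof.
move=> mr r0; congr fine.
pose g (p : F * R) : \bar R := (\1_E0 (raise (p.1, p.2 - h)) * r p.2)%:E.
have msh : measurable_fun setT (fun p : F * R => (p.1, p.2 - h)).
  apply: measurable_fun_pair; first exact: measurable_fst.
  by apply: measurable_funB; [exact: measurable_snd|exact: measurable_cst].
have mg : measurable_fun setT g.
  apply/measurable_EFinP; apply: measurable_funM.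
    exact: (measurableT_comp mind msh).
  exact: (measurableT_comp mr measurable_snd).
have g0 p : (0 <= g p)%E by rewrite lee_fin mulr_ge0.
transitivity (\int[P]_phi g (forms K a phi, fset_form K a0 phi))%E.
  by apply: eq_integral => phi _; rewrite raiseE.
rewrite (gauss_independence gaussP C_sym (C_ge0 K) var_gt0 unc mg g0).
transitivity (\int[N]_t \int[P]_phi g (forms K a phi, t))%E.
  apply: (@fubini_tonelli _ _ _ _ R P N (fun p : F * R => g (forms K a p.1, p.2))).
    exact: (measurableT_comp mg mforms).
  by move=> p; exact: g0.
apply: eq_integral => t _; rewrite EFinM -kE /k muleC.
rewrite -ge0_integralZl//.
- by apply: eq_integral => phi _; rewrite /g /= EFinM muleC.
- by apply/measurable_EFinP; case: (bind (t - h)).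
- by rewrite lee_fin r0.
Qed.

Let level_probE h : level_prob P site A h = \int[N]_t Fs (t - h).
Proof.
rewrite /level_prob fine_prob_indic; last exact: measurable_level_event.
have := @disintegrate h (fun=> 1) (measurable_cst _) (fun _ => ler01).
have -> : \int[N]_t (Fs (t - h) * 1) = \int[N]_t Fs (t - h).
  by apply: eq_Rintegral => t _; rewrite mulr1.
by move=> <-; apply: eq_Rintegral => phi _; rewrite mulr1.
Qed.

Let mmax : measurable_fun setT (fun t : R => Num.max t 0).
Proof. by apply: measurable_maxr; [exact: measurable_id|exact: measurable_cst]. Qed.
Let mmaxN : measurable_fun setT (fun t : R => Num.max (- t) 0).
Proof. exact: (measurableT_comp mmax (@oppr_measurable R setT)). Qed.

Let pos_neg (t : R) : t = Num.max t 0 - Num.max (- t) 0.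
Proof. by have [t0|t0] := leP 0 t; [rewrite max_r ?oppr_le0// subr0|rewrite max_l ?oppr_ge0 1?ltW// opprK add0r]. Qed.

Let max_le (t : R) : `|Num.max t 0| <= `|t|.
Proof. by have [t0|t0] := leP t 0; rewrite ?normr0. Qed.

Let Zint : P.-integrable setT (EFin \o Z).
Proof.
exact: (form_integrable gaussP var_gt0 (@measurable_id _ _ _) (normal_integrable_id s_gt0)).
Qed.

(** [disintegrate] is stated for nonnegative functions of Z, so Z is split into its positive and
    negative parts. *)
Let mean_Z h : \int[P]_phi (\1_(level_event site A h) phi * Z phi) = \int[N]_t (Fs (t - h) * t).
Proof.
have bi : bounded_measurable (\1_(level_event site A h) : F -> R).
  by apply: bounded_measurable_indic; exact: measurable_level_event.
have bs : bounded_measurable (fun t : R => Fs (t - h)).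
  by apply: bounded_measurable_shift; exact: bFs.
have IP (r : R -> R) : measurable_fun setT r -> (forall t, `|r t| <= `|t|) ->
    P.-integrable setT (EFin \o (fun phi => \1_(level_event site A h) phi * r (Z phi))).
  move=> mr rt; apply: le_integrable Zint => //.
    apply/measurable_EFinP; apply: measurable_funM; first by case: bi.
    exact: (measurableT_comp mr (measurable_fset_form K a0)).
  move=> phi _ /=; rewrite lee_fin normrM -[leRHS]mul1r ler_pM//.
  by rewrite indicE; case: (_ \in _); rewrite /= ?normr1 ?normr0.
have IN (r : R -> R) : measurable_fun setT r -> (forall t, `|r t| <= `|t|) ->
    (N : measure _ R).-integrable setT (EFin \o (fun t : R => Fs (t - h) * r t)).
  move=> mr rt; apply: le_integrable (bounded_measurableM_integrable s_gt0 bs) => //.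
    by apply/measurable_EFinP; apply: measurable_funM => //; case: bs.
  by move=> t _ /=; rewrite lee_fin !normrM ler_wpM2l.
have max_leN (t : R) : `|Num.max (- t) 0| <= `|t| by rewrite -(normrN t).
transitivity (\int[P]_phi (\1_(level_event site A h) phi * Num.max (Z phi) 0) -
              \int[P]_phi (\1_(level_event site A h) phi * Num.max (- Z phi) 0)).
  rewrite -RintegralB//; [|exact: (IP _ mmax)|exact: (IP _ mmaxN)].
  by apply: eq_Rintegral => phi _; rewrite -mulrBr -pos_neg.
rewrite (@disintegrate h _ mmax); last by move=> t; rewrite le_max lexx orbT.
rewrite (@disintegrate h _ mmaxN); last by move=> t; rewrite le_max lexx orbT.
rewrite -RintegralB//; [|exact: (IN _ mmax)|exact: (IN _ mmaxN)].
by apply: eq_Rintegral => t _; rewrite -mulrBr -pos_neg.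
Qed.

Theorem level_prob_derivative (h : R) :
  is_derive h (1 : R) (level_prob P site A)
    (- \sum_(x <- K) (\sum_(y <- K) Q x y) *
       \int[P]_phi (\1_(level_event site A h) phi * phi x)).
Proof.
have -> : level_prob P site A = (fun h => \int[N]_t Fs (t - h)).
  by apply/funext => u; exact: level_probE.
have D := is_derive_normal_shift s_gt0 h bFs.
apply: is_derive_eq.
(* Z has variance 1 / v, so the factor of Stein's identity is [v], and v Z is the sum of q x phi
   x. *)
rewrite -mean_Z sqr_sqrtr ?(ltW var_gt0)// var invrK mulNr; congr (- _).
have bi : bounded_measurable (\1_(level_event site A h) : F -> R).
  by apply: bounded_measurable_indic; exact: measurable_level_event.
have IZ : P.-integrable setT (EFin \o (fun phi => \1_(level_event site A h) phi * Z phi)).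
  apply: le_integrable Zint => //.
    apply/measurable_EFinP; apply: measurable_funM; first by case: bi.
    exact: measurable_fset_form.
  move=> phi _ /=; rewrite lee_fin normrM -[leRHS]mul1r ler_pM//.
  by rewrite indicE; case: (_ \in _); rewrite /= ?normr1 ?normr0.
rewrite -RintegralZl//.
have sumE (L : seq V) : {subset L <= K} ->
    P.-integrable setT (EFin \o (fun phi => \sum_(x <- L) q x * (\1_(level_event site A h) phi * phi x))) /\
    \int[P]_phi (\sum_(x <- L) q x * (\1_(level_event site A h) phi * phi x)) =
    \sum_(x <- L) q x * \int[P]_phi (\1_(level_event site A h) phi * phi x).
  elim: L => [|x L IH] LK.
    rewrite big_nil; split.
      under [X in _.-integrable _ (_ \o X)]funext do rewrite big_nil.
      exact: (bounded_measurable_integrable P (bounded_measurable_cst _ 0)).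
    under eq_Rintegral do rewrite big_nil.
    by rewrite Rintegral_cst ?mul0r.
  have [IL EL] := IH (fun y yL => LK y (mem_behead (s := x :: L) yL)).
  have xK : x \in K by apply: LK; rewrite inE eqxx.
  have Ix := coord_integrable_bounded gaussP C_sym (C_gt0 xK) bi.
  have IqX : P.-integrable setT (EFin \o (fun phi => q x * (\1_(level_event site A h) phi * phi x))).
    have := integrableZl measurableT (q x) Ix.
    by apply: eq_integrable => // phi _ /=.
  split.
    under [X in _.-integrable _ (_ \o X)]funext do rewrite big_cons.
    have := integrableD measurableT IqX IL.
    by apply: eq_integrable => // phi _ /=.
  under eq_Rintegral do rewrite big_cons.
  by rewrite big_cons RintegralD// EL RintegralZl.
have [_ <-] := sumE K (fun _ => id).
apply: eq_Rintegral => phi _; rewrite /Z /fset_form !mulr_sumr.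
apply: eq_bigr => x _; rewrite /a0; have vn : v != 0 by rewrite gt_eqF.
by field.
Qed.

End LevelDerivative.

(** * The exploration of the level bits *)

Section LevelTree.
Context {R : realType} {V : choiceType} (C : V -> V -> R).
Variable P : probability (field_space R V) R.
Hypothesis gaussP : centered_gaussian_field C P.
Hypothesis C_sym : forall x y, C x y = C y x.
Hypothesis C_ge0 : forall K a, 0 <= bilin C K a a.
Local Notation F := (field_space R V).
Variables (T : finType) (site : T -> V) (A : {set {ffun T -> bool}}) (h : R).
Hypothesis site_inj : injective site.
Hypothesis A_incr : increasing A.
Variables (K : {fset V}) (Q : V -> V -> R).
Hypothesis pQ : precision C K Q.
Hypothesis site_in : forall t, site t \in K.
Variable t0 : T.

Let N := #|T|.
Let x (k : nat) : V := site (nth t0 (enum T) k).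
Let xK k : x k \in K. Proof. exact: site_in. Qed.
Let E : set F := level_event site A h.
Let mE : measurable E. Proof. exact: measurable_level_event. Qed.

(* The bits of the first [k] sites, the most recently revealed first. *)
Let bits k (phi : F) : seq bool := rev (mkseq (fun i => h <= phi (x i)) k).

Let bitsS k phi : bits k.+1 phi = (h <= phi (x k)) :: bits k phi.
Proof. by rewrite /bits mkseqS rev_rcons. Qed.

Let up (k : nat) (phi : F) : R := (h <= phi (x k))%R%:R.
Let cell (w : seq bool) (phi : F) : R := (bits (size w) phi == w)%:R.

Let cell_true w phi : cell (true :: w) phi = cell w phi * up (size w) phi.
Proof.
by rewrite /cell /up /= bitsS eqseq_cons; case: (h <= phi _); rewrite ?mulr1 ?mulr0.
Qed.

Let cell_false w phi : cell (false :: w) phi = cell w phi * (1 - up (size w) phi).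
Proof.
rewrite /cell /up /= bitsS eqseq_cons.
by case: (h <= phi _); rewrite ?subrr ?subr0 ?mulr1 ?mulr0.
Qed.

Let cell_nil phi : cell [::] phi = 1. Proof. by []. Qed.

Let bup k : bounded_measurable (up k).
Proof.
have -> : up k = \1_[set phi : F | h <= phi (x k)].
  apply/funext => phi; rewrite /up indicE; congr (nat_of_bool _)%:R.
  by apply/idP/idP; rewrite inE.
by apply: bounded_measurable_indic; exact: measurable_coord_ge.
Qed.

Let bdown k : bounded_measurable (fun phi => 1 - up k phi).
Proof. by apply: bounded_measurableB; [exact: bounded_measurable_cst|exact: bup]. Qed.

Let bcell w : bounded_measurable (cell w).
Proof.
elim: w => [|[] w IH].
- by have -> : cell [::] = cst 1 by []; exact: bounded_measurable_cst.
- have -> : cell (true :: w) = (fun phi => cell w phi * up (size w) phi).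
    by apply/funext => phi; rewrite cell_true.
  by apply: bounded_measurableM.
have -> : cell (false :: w) = (fun phi => cell w phi * (1 - up (size w) phi)).
  by apply/funext => phi; rewrite cell_false.
by apply: bounded_measurableM.
Qed.

Let bE : bounded_measurable (\1_E : F -> R).
Proof. exact: bounded_measurable_indic. Qed.

Let integ (u : F -> R) : bounded_measurable u -> P.-integrable setT (EFin \o u).
Proof. exact: bounded_measurable_integrable. Qed.

Let bits_ext k (phi psi : F) : {in K, forall y, phi y = psi y} -> bits k phi = bits k psi.
Proof. by move=> e; congr rev; apply: eq_mkseq => i; rewrite e. Qed.

Let dcell w : depends_on K (cell w).
Proof. by move=> phi psi e; rewrite /cell (bits_ext _ e). Qed.

Let cell_ge0 w phi : 0 <= cell w phi. Proof. exact: ler0n. Qed.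

Let mass w := \int[P]_phi cell w phi.

Let split_mean (X : F -> R) w : bounded_measurable X ->
  \int[P]_phi (cell w phi * X phi) =
  \int[P]_phi (cell (true :: w) phi * X phi) + \int[P]_phi (cell (false :: w) phi * X phi).
Proof.
move=> bX; rewrite -RintegralD//; last 2 first.
- by apply: integ; exact: bounded_measurableM.
- by apply: integ; exact: bounded_measurableM.
by apply: eq_Rintegral => phi _; rewrite cell_true cell_false; ring.
Qed.

Let mass_split w : mass w = mass (true :: w) + mass (false :: w).
Proof.
have := split_mean w (bounded_measurable_cst _ 1).
have c u : \int[P]_phi (cell u phi * 1) = mass u.
  by apply: eq_Rintegral => phi _; rewrite mulr1.
by rewrite !c.
Qed.

Let mass_ge0 w : 0 <= mass w.
Proof. by apply: Rintegral_ge0 => phi _. Qed.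

(** The default of [nth] prescribes a value below [h] at the sites not yet revealed and at the
    vertices of K that are not sites. This full pattern on K refines the cell of [w], as
    [positive_on_cell] demands. *)
Let bits_pattern w (phi : F) : (size w <= N)%N ->
  (forall v, v \in K -> (h <= phi v) = nth false (rev w) (index v (map site (enum T)))) ->
  bits (size w) phi = w.
Proof.
move=> wN H; rewrite /bits -[RHS]revK; congr rev.
apply: (@eq_from_nth _ false); rewrite ?size_mkseq ?size_rev// => i iw.
rewrite nth_mkseq// H//; congr nth.
have iN : (i < size (enum T))%N by rewrite -cardE (leq_trans iw).
have -> : x i = nth (site t0) (map site (enum T)) i by rewrite (nth_map t0).
have U : uniq (map site (enum T)) by rewrite map_inj_uniq// enum_uniq.
by rewrite index_uniq//; rewrite size_map.
Qed.

Let mass_gt0 w : (size w <= N)%N -> 0 < mass w.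
Proof.
move=> wN; rewrite -lte_fin /mass /Rintegral fineK; last first.
  by apply: integrable_fin_num => //; exact: integ.
pose b v := nth false (rev w) (index v (map site (enum T))).
apply: (positive_on_cell gaussP C_sym C_ge0 (h := h) (b := b) pQ).
- by move=> phi psi e; rewrite (dcell w e).
- by apply/measurable_EFinP; case: (bcell w).
- by move=> phi; rewrite lee_fin.
by move=> phi e; rewrite lte_fin /cell (bits_pattern wN)// eqxx ltr01.
Qed.

(** Past the last site the value 0 keeps [p01] and [p_mono] valid for histories of every length. *)
Let p (w : seq bool) : R := if (size w < N)%N then mass (true :: w) / mass w else 0.

Let p_true w : (size w < N)%N -> p w * mass w = mass (true :: w).
Proof. by move=> wN; rewrite /p wN divfK// gt_eqF// mass_gt0// ltnW. Qed.

Let p_false w : (size w < N)%N -> (1 - p w) * mass w = mass (false :: w).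
Proof. by move=> wN; rewrite mulrBl p_true// mul1r (mass_split w); ring. Qed.

Let p01 w : 0 <= p w <= 1.
Proof.
rewrite /p; case: ifP => [wN|_]; last by rewrite lexx ler01.
rewrite divr_ge0//= ler_pdivrMr ?mass_gt0 1?ltnW// mul1r (mass_split w) lerDl.
exact: mass_ge0.
Qed.

Let bits_lattice w w' (phi psi : F) : dominates w w' ->
  bits (size w) phi = w' -> bits (size w) psi = w ->
  bits (size w) (field_max phi psi) = w /\ bits (size w) (field_min phi psi) = w'.
Proof.
elim: w w' => [|b w IH] [|b' w']//= /andP[bb' dw].
rewrite !bitsS => -[eb' ew'] [eb ew].
have [-> ->] := IH _ dw ew' ew; rewrite /field_max /field_min le_max le_min eb eb'.
by move: bb'; case: b {eb}; case: b' {eb'}.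
Qed.

(** Cross-multiplied, this is the four functions inequality for cells: if phi lies in the cell of
    [true :: w'] and psi in that of [w], their maximum lies in the cell of [true :: w] and their
    minimum in that of [w']. *)
Let p_mono w w' : dominates w w' -> p w' <= p w.
Proof.
move=> dw; have sw := dominates_size dw; rewrite /p -sw.
case: ifP => // wN.
rewrite ler_pdivrMr; last by rewrite mass_gt0// -sw ltnW.
rewrite mulrAC ler_pdivlMr; last by rewrite mass_gt0// ltnW.
apply: (four_functions_real gaussP C_sym C_ge0 pQ).
- exact: dcell.
- exact: dcell.
- exact: dcell.
- exact: dcell.
- exact: integ (bcell _).
- exact: integ (bcell _).
- exact: integ (bcell _).
- exact: integ (bcell _).
- by move=> phi; exact: cell_ge0.
- by move=> phi; exact: cell_ge0.
- by move=> phi; exact: cell_ge0.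
- by move=> phi; exact: cell_ge0.
move=> phi psi; rewrite !cell_true -!sw /cell -!sw /up.
case: eqP => [ew'|_]; last by rewrite !mul0r !mulr_ge0.
case: eqP => [ew|_]; last by rewrite mulr0 !mulr_ge0.
have [-> ->] := bits_lattice dw ew' ew; rewrite !eqxx !mulr1 !mul1r.
by rewrite ler_nat /field_max le_max; case: (h <= phi _).
Qed.

(** Tower property: once [G] is the conditional mean of [X] on the cells of depth [k], tree means
    compute its conditional means on all shallower cells. *)
Let disintegrate (X : F -> R) (G : seq bool -> R) k : bounded_measurable X -> (k <= N)%N ->
  (forall w, size w = k -> G w * mass w = \int[P]_phi (cell w phi * X phi)) ->
  forall n w, (n + size w = k)%N ->
  tree_mean p n w G * mass w = \int[P]_phi (cell w phi * X phi).
Proof.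
move=> bX kN HG; elim=> [|n IH] w nw /=; first exact: HG.
have wN : (size w < N)%N by apply: leq_trans kN; rewrite -nw addSn ltnS leq_addl.
rewrite mulrDl mulrAC p_true// [X in _ + X]mulrAC p_false// split_mean//.
rewrite -(IH (true :: w)); last by rewrite /= addnS.
rewrite -(IH (false :: w)); last by rewrite /= addnS.
by ring.
Qed.

Let mass_nil : mass [::] = 1.
Proof.
have -> : mass [::] = \int[P]_phi (1 : R) by apply: eq_Rintegral.
rewrite Rintegral_cst; last exact: measurableT.
by have := probability_setT P => /(congr1 fine) /= ->; rewrite mulr1.
Qed.

Let disintegrate_nil (X : F -> R) (G : seq bool -> R) k : bounded_measurable X -> (k <= N)%N ->
  (forall w, size w = k -> G w * mass w = \int[P]_phi (cell w phi * X phi)) ->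
  tree_mean p k [::] G = \int[P]_phi X phi.
Proof.
move=> bX kN HG; have := @disintegrate X G k bX kN HG k [::] (addn0 k).
rewrite mass_nil mulr1 => ->; apply: eq_Rintegral => phi _.
by rewrite cell_nil mul1r.
Qed.

Let config w : {ffun T -> bool} := [ffun t => nth false (rev w) (index t (enum T))].
Let f w : R := (config w \in A)%:R.

Let config_bits phi : config (bits N phi) = [ffun t => h <= phi (site t)].
Proof.
apply/ffunP => t; rewrite !ffunE /bits revK nth_mkseq; last first.
  by rewrite /N cardE index_mem mem_enum.
by rewrite /x nth_index// mem_enum.
Qed.

Let cell_event w phi : size w = N -> cell w phi * \1_E phi = f w * cell w phi.
Proof.
move=> wN; rewrite /cell; case: eqP => [<-|_]; last by rewrite mul0r mulr0.
rewrite mulr1 mul1r /f wN config_bits indicE; congr (nat_of_bool _)%:R.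
by apply/idP/idP; rewrite inE.
Qed.

Let f01 v : f v = 0 \/ f v = 1.
Proof. by rewrite /f; case: (_ \in _); [right|left]. Qed.

Let dominates_nth v v' i : dominates v v' ->
  nth false (rev v') i ==> nth false (rev v) i.
Proof.
move=> d; have s := dominates_size d.
have [iv|iv] := ltnP i (size v); last by rewrite nth_default// size_rev -s.
rewrite !nth_rev -?s//; move: (_ - _)%N => {}i {s iv}.
elim: v v' i d => [|b v IH] [|b' v'] // [|i] //= /andP[bb' d] //; exact: IH.
Qed.

Let f_mono v v' : dominates v v' -> f v' <= f v.
Proof.
move=> d; rewrite /f ler_nat; case: (boolP (config v' \in A)) => // v'A.
by rewrite (A_incr v'A)// => t; rewrite !ffunE dominates_nth.
Qed.

Let mart := mart p N f.

Let mart_mass w : (size w <= N)%N -> mart w * mass w = \int[P]_phi (cell w phi * \1_E phi).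
Proof.
move=> wN; apply: (disintegrate (k := N)) => //; last by rewrite subnK.
move=> v vN; rewrite -RintegralZl//; last exact: integ.
by apply: eq_Rintegral => phi _; rewrite cell_event.
Qed.

Let mart_nil : mart [::] = level_prob P site A h.
Proof.
have := @mart_mass [::] isT; rewrite mass_nil mulr1 => ->.
rewrite /level_prob fine_prob_indic//; apply: eq_Rintegral => phi _.
by rewrite cell_nil mul1r.
Qed.

(** The tree means in [pivotality_le_influence] are identified, through [disintegrate_nil], with the
    integrals in [influenceE]. *)
Let pivotality_le_cond k : (k < N)%N ->
  tree_mean p k [::] (pivotality p N f) <= influence P E h (x k).
Proof.
move=> kN; have kN' := ltnW kN.
have tE : tree_mean p k [::] p = \int[P]_phi up k phi.
  apply: (disintegrate_nil (X := up k)) => // w wk; rewrite p_true ?wk//.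
  by apply: eq_Rintegral => phi _; rewrite cell_true wk.
have t01 := prob_half_line gaussP C_sym C_ge0 pQ h (xK k).
have := @pivotality_le_influence R p p01 p_mono N f f_mono k.
rewrite /= tE => /(_ t01) H; apply: (le_trans H); rewrite influenceE//.
rewrite le_eqVlt; apply/orP; left; apply/eqP; congr (_ / _ - _ / _).
  apply: (disintegrate_nil (X := fun phi => \1_E phi * up k phi)) => //.
    exact: bounded_measurableM.
  move=> w wk; rewrite mulrAC p_true ?wk// mulrC mart_mass /= ?wk//.
  by apply: eq_Rintegral => phi _; rewrite cell_true wk; ring.
apply: (disintegrate_nil (X := fun phi => \1_E phi * (phi (x k) < h)%R%:R)) => //.
  have -> : (fun phi : F => \1_E phi * (phi (x k) < h)%R%:R) =
      (fun phi => \1_E phi * (1 - up k phi)).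
    by apply/funext => phi; rewrite /up ltNge; case: (h <= phi _); rewrite ?subrr ?subr0.
  exact: bounded_measurableM.
move=> w wk; rewrite mulrAC p_false ?wk// mulrC mart_mass /= ?wk//.
apply: eq_Rintegral => phi _; rewrite cell_false wk /up ltNge.
by case: (h <= phi _); rewrite /= ?subrr ?subr0; ring.
Qed.

Let sum_sites (J : V -> R) : \sum_(i < N) J (x i) = \sum_(t : T) J (site t).
Proof.
rewrite -(big_mkord xpredT (fun i => J (x i))) -[RHS]big_enum /=.
by rewrite (big_nth t0) -cardE.
Qed.

Let pivotality_mean_ge0 i : 0 <= tree_mean p i [::] (pivotality p N f).
Proof.
rewrite -(tree_mean_cst p i [::] 0); apply: (ler_tree_mean p01) => v _.
exact: (pivotality_ge0 p01 p_mono N f_mono).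
Qed.

Let var_level : var_indicator P E = mart [::] - mart [::] ^+ 2.
Proof.
have p1 : P E = (level_prob P site A h)%:E by rewrite /level_prob fineK// fin_num_measure.
have idem : ((\1_E : F -> R) * \1_E)%R = \1_E.
  by apply/funext => phi; rewrite fctE indicE; case: (_ \in _); rewrite ?mulr1 ?mulr0.
have L1 : (\1_E : F -> R) \in Lfun P 1 by apply/Lfun1_integrable; exact: integ.
rewrite /var_indicator /variance covarianceE ?idem// expectation_indic// p1 mart_nil.
by rewrite -EFinM -EFinB /= expr2.
Qed.

Theorem influence_ge0 t : 0 <= influence P E h (site t).
Proof.
have iN : (index t (enum T) < N)%N by rewrite /N cardE index_mem mem_enum.
have <- : x (index t (enum T)) = site t by rewrite /x nth_index// mem_enum.
exact: le_trans (pivotality_mean_ge0 _) (pivotality_le_cond iN).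
Qed.

Theorem var_indicator_ge0 : 0 <= var_indicator P E.
Proof.
by rewrite /var_indicator fine_ge0// variance_ge0.
Qed.

Theorem var_indicator_le1 : var_indicator P E <= 1.
Proof. by rewrite var_level; have := sqr_ge0 (mart [::] - 2^-1); nra. Qed.

Theorem variance_ln_le_sum_influence (m : R) : 0 < m ->
  (forall t, influence P E h (site t) <= m) ->
  var_indicator P E * ln (4 / m) <= 2 * \sum_(t : T) influence P E h (site t).
Proof.
move=> m0 Hm; rewrite var_level -(sum_sites (influence P E h)).
apply: le_trans (influence_sum p01 p_mono f01 f_mono m0 _) _.
  by move=> i iN; exact: le_trans (pivotality_le_cond iN) (Hm _).
by rewrite ler_wpM2l//; apply: ler_sum => i _; exact: pivotality_le_cond.
Qed.

End LevelTree.

(** * Translations, and the main inequality *)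

Section Symmetry.
Context {R : realType} {V : choiceType} (C : V -> V -> R).
Variable P : probability (field_space R V) R.
Hypothesis gaussP : centered_gaussian_field C P.
Hypothesis C_ge0 : forall K a, 0 <= bilin C K a a.
Local Notation F := (field_space R V).

Let weight (l : seq (R * V)) (x : V) : R := \sum_(i <- l) (x == i.2)%:R * i.1.

Let sum_weight (l : seq (R * V)) (g : V -> R) (K : {fset V}) :
  {subset [seq i.2 | i <- l] <= K} ->
  \sum_(x <- K) weight l x * g x = \sum_(i <- l) i.1 * g i.2.
Proof.
move=> lK.
transitivity (\sum_(i <- l) \sum_(x <- K) (x == i.2)%:R * (i.1 * g x)).
  rewrite exchange_big; apply: eq_bigr => x _; rewrite mulr_suml.
  by apply: eq_bigr => i _; rewrite mulrA.
apply: eq_big_seq => i il; rewrite (big_fsetD1 i.2)/=; last by apply: lK; exact: map_f.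
rewrite eqxx mul1r big1_fset ?addr0// => y.
by rewrite !inE => /andP[yi _] _; rewrite (negbTE yi) mul0r.
Qed.

Lemma gauss_cos_linear_form (l : seq (R * V)) (b : R) :
  \int[P]_phi cos (linear_form l phi + b) =
  cos b * expR (- (\sum_(i <- l) \sum_(j <- l) i.1 * j.1 * C i.2 j.2) / 2).
Proof.
pose K := [fset x in [seq i.2 | i <- l]]%fset.
have lK : {subset [seq i.2 | i <- l] <= K} by move=> x; rewrite inE.
transitivity (\int[P]_phi cos (fset_form K (weight l) phi + b)).
  by apply: eq_Rintegral => phi _; rewrite /fset_form sum_weight.
rewrite (gauss_cos gaussP (C_ge0 K)); congr (_ * expR (- _ / 2)).
transitivity (\sum_(x <- K) weight l x * \sum_(j <- l) j.1 * C x j.2).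
  apply: eq_bigr => x _; rewrite -(sum_weight _ lK) mulr_sumr.
  by apply: eq_bigr => y _; rewrite mulrA.
rewrite (sum_weight _ lK); apply: eq_bigr => i _; rewrite mulr_sumr.
by apply: eq_bigr => j _; rewrite mulrA.
Qed.

Variable sigma : V -> V.
Hypothesis C_sigma : forall x y, C (sigma x) (sigma y) = C x y.

Let relabel (phi : F) : F := fun x => phi (sigma x).

Let mrelabel : measurable_fun setT relabel.
Proof. by apply: measurable_to_field => x; exact: measurable_coord. Qed.

(** The mean cosine of a linear form depends only on the covariances of its sites, which [sigma]
    preserves; uniqueness of laws concludes. *)
Lemma gaussian_relabel (B : set F) : measurable B ->
  P [set phi : F | B (fun x => phi (sigma x))] = P B.
Proof.
move=> mB; rewrite -(image_probE P mrelabel).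
apply: field_measure_unique => // l b.
rewrite Rintegral_image_prob; last exact: bounded_measurable_cos_form.
pose l' := [seq (i.1, sigma i.2) | i <- l].
transitivity (\int[P]_phi cos (linear_form l' phi + b)).
  by apply: eq_Rintegral => phi _; rewrite /linear_form big_map.
rewrite !gauss_cos_linear_form big_map; congr (_ * expR (- _ / 2)).
by apply: eq_bigr => i _; rewrite big_map; apply: eq_bigr => j _; rewrite /= C_sigma.
Qed.

End Symmetry.

Section TranslationInvariance.
Context {R : realType} {V : finZmodType} (C : V -> V -> R).
Variable P : probability (field_space R V) R.
Hypothesis gaussP : centered_gaussian_field C P.
Hypothesis C_ge0 : forall K a, 0 <= bilin C K a a.
Hypothesis C_translate : forall x y z, C (x + z) (y + z) = C x y.
Local Notation F := (field_space R V).
Variables (A : {set {ffun V -> bool}}) (h : R).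
Hypothesis A_inv : translation_invariant A.

Let E : set F := level_event id A h.

Let shift_in (u : V) (w : {ffun V -> bool}) : (Defs.shift u w \in A) = (w \in A).
Proof.
apply/idP/idP => [|wA]; last by rewrite (A_inv u); exact: imset_f.
rewrite {1}(A_inv u) => /imsetP[w' w'A e].
suff -> : w = w' by [].
by apply/ffunP => y; move/ffunP/(_ (y - u)): e; rewrite !ffunE addrC subrK.
Qed.

Lemma influence_translate (x u : V) : influence P E h (u + x) = influence P E h x.
Proof.
have mE : measurable E by exact: measurable_level_event.
have EE (phi : F) : E (fun y => phi (u + y)) = E phi.
  apply/propext; rewrite /E /level_event /=.
  suff -> : [ffun y : V => h <= phi (u + y)] = Defs.shift u [ffun y => h <= phi y].
    by rewrite shift_in.
  by apply/ffunP => y; rewrite !ffunE.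
have inv (B : set F) : measurable B -> P [set phi : F | B (fun y => phi (u + y))] = P B.
  by apply: (gaussian_relabel gaussP C_ge0) => y z; rewrite !(addrC u) C_translate.
have mU := @measurable_coord_ge R V x h.
have mD : measurable [set phi : F | phi x < h].
  have -> : [set phi : F | phi x < h] = ~` [set phi : F | h <= phi x].
    by apply/seteqP; split => phi /=; rewrite ltNge => /negP.
  exact: measurableC.
have cond (B : set F) : measurable B ->
    cond_prob P E [set phi : F | B (fun y => phi (u + y))] = cond_prob P E B.
  move=> mB; rewrite /cond_prob inv//; congr (fine _ / _).
  rewrite -(inv (E `&` B)); last exact: measurableI.
  by congr (P _); apply/seteqP; split => phi /=; rewrite EE.
by rewrite /influence -(cond _ mU) -(cond _ mD).
Qed.

End TranslationInvariance.

Lemma influence_le_max {R : realType} {V : choiceType} (P : probability (field_space R V) R)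
  (T : finType) (site : T -> V) A h t :
  influence P (level_event site A h) h (site t) <= max_influence P site A h.
Proof. exact: (le_bigmax _ (fun t => influence P (level_event site A h) h (site t))). Qed.

(** * The differential inequality for the killed Green function *)

Section LevelDerivativeBound.
Context {R : realType} {Z : nzRingType} {d : nat} (theta M h : R).
Local Notation V := 'rV[Z]_d.
Local Notation F := (field_space R V).
Hypothesis d_gt0 : (0 < d)%N.
Hypothesis theta01 : 0 < theta < 1.
Hypothesis M_gt0 : 0 < M.
Hypothesis hM : - M < h < M.
Variable P : probability F R.
Hypothesis gaussP : centered_gaussian_field (green theta) P.
Variables (T : finType) (site : T -> V) (A : {set {ffun T -> bool}}).
Hypothesis site_inj : injective site.
Hypothesis A_incr : increasing A.
Variable t0 : T.

Let theta_gt0 : 0 < theta. Proof. by case/andP: theta01. Qed.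
Let K := [fset site t | t in T]%fset.
Let site_in t : site t \in K. Proof. exact: in_imfset. Qed.
Let pQ := green_precision d_gt0 theta01 K.
Let C_ge0 (K' : {fset V}) a : 0 <= bilin (green theta) K' a a.
Proof. exact: green_bilin_ge0. Qed.
Let C_sym : forall x y : V, green theta x y = green theta y x.
Proof. exact: green_sym. Qed.
Let C_gt0 (x : V) : 0 < green theta x x.
Proof. exact: lt_le_trans ltr01 (green_diag_ge1 d_gt0 theta01 x). Qed.
Let E : set F := level_event site A h.

(** The bound of [normal_upper_mean]. It involves neither [h] nor the vertex nor the graph, since
    all variances lie between 1 and 1 / theta. *)
Definition half_line_mean_bound : R :=
  M * ((Num.sqrt (2 * pi / theta))^-1 * expR (- (M + 1) ^+ 2 / 2)).

Let half_line_mean x :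
  half_line_mean_bound <= \int[P]_phi ((h <= phi x)%R%:R * phi x).
Proof.
have s0 : 0 < Num.sqrt (green theta x x) by rewrite sqrtr_gt0.
have mI : measurable (`[h, +oo[%classic : set R) by exact: measurable_itv.
have -> : \int[P]_phi ((h <= phi x)%R%:R * phi x) =
    \int[P]_phi ((fun t : R => \1_(`[h, +oo[) t * t) (phi x)).
  by apply: eq_Rintegral => phi _; rewrite /= indicE mem_setE in_itv /= andbT.
rewrite (coord_Rintegral gaussP C_sym (C_gt0 x) (f := fun t : R => \1_(`[h, +oo[) t * t)).
- apply: normal_upper_mean => //; rewrite sqr_sqrtr ?(ltW (C_gt0 x))//.
  by rewrite green_diag_ge1// green_le.
- by apply: measurable_funM => //; exact: measurable_indic.
exact: normal_integrableMindic.
Qed.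

Lemma level_influence_ge0 t : 0 <= influence P E h (site t).
Proof. exact: (influence_ge0 gaussP C_sym C_ge0 _ site_inj A_incr pQ site_in t0). Qed.

Lemma half_line_mean_bound_gt0 : 0 < half_line_mean_bound.
Proof.
rewrite mulr_gt0// mulr_gt0 ?expR_gt0// invr_gt0 sqrtr_gt0 divr_gt0//.
by rewrite mulr_gt0// pi_gt0.
Qed.

(** In the derivative formula each row sum is at least theta, and [covariance_ge_influence] bounds
    each mean from below by the influence times the half-line mean. *)
Theorem level_derivative_ge :
  derivable (level_prob P site A) h 1 /\
  theta * half_line_mean_bound * \sum_(t : T) influence P E h (site t) <=
  - derive1 (level_prob P site A) h.
Proof.
have K0 : K != fset0 by apply/fset0Pn; exists (site t0).
have rs : {in K, forall x, theta <= \sum_(y <- K) green_inverse theta K x y}.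
  by move=> x; exact: green_inverse_rowsum.
have D := level_prob_derivative gaussP C_sym C_ge0 A pQ site_in theta_gt0 rs K0
  (fun x _ => C_gt0 x) h.
split; first exact: ex_derive.
rewrite derive1E derive_val opprK.
have -> : \sum_(t : T) influence P E h (site t) = \sum_(x <- K) influence P E h x.
  rewrite big_imfset /=; first by rewrite big_enum.
  by move=> ? ? _ _; exact: site_inj.
rewrite mulr_sumr [leLHS]big_seq [leRHS]big_seq; apply: ler_sum => x xK.
have I0 : 0 <= influence P E h x by have /imfsetP[t _ ->] := xK; exact: level_influence_ge0.
have cov : influence P E h x * (\int[P]_phi ((h <= phi x)%R%:R * phi x)) <=
    \int[P]_phi (\1_E phi * phi x).
  apply: (covariance_ge_influence gaussP C_sym C_ge0 pQ) => //.
  - exact: measurable_level_event.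
  - move=> phi psi e; rewrite !indicE; congr (nat_of_bool _)%:R.
    have eE : [ffun t => h <= phi (site t)] = [ffun t => h <= psi (site t)].
      by apply/ffunP => t; rewrite !ffunE e.
    by apply/idP/idP; rewrite !inE /E /level_event /= eE.
  - move=> phi psi le; rewrite /E /level_event /= => /A_incr; apply=> t.
    by rewrite !ffunE; apply/implyP => /le_trans; apply.
have c0 := ltW half_line_mean_bound_gt0.
rewrite -mulrA; apply: ler_pM; [exact: ltW|exact: mulr_ge0|exact: rs|].
by apply: le_trans cov; rewrite mulrC; exact: ler_wpM2l.
Qed.

Theorem level_derivative_ge_ln (m : R) : 0 < m ->
  (forall t, influence P E h (site t) <= m) ->
  theta * half_line_mean_bound / 2 * (var_indicator P E * ln (4 / m)) <=
  - derive1 (level_prob P site A) h.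
Proof.
move=> m0 Im; have [_] := level_derivative_ge; apply: le_trans.
have := variance_ln_le_sum_influence gaussP C_sym C_ge0 site_inj A_incr pQ site_in t0 m0 Im.
rewrite mulrAC ler_pdivrMr// -(mulrA _ _ 2) (mulrC _ 2) => H.
by rewrite ler_wpM2l// mulr_ge0// ltW// half_line_mean_bound_gt0.
Qed.

Lemma level_variance01 : 0 <= var_indicator P E <= 1.
Proof.
rewrite var_indicator_ge0.
exact: (var_indicator_le1 gaussP C_sym C_ge0 _ _ site_inj pQ site_in t0).
Qed.

End LevelDerivativeBound.

Theorem corollary3p3 (R : realType) (d : nat) (theta M : R) :
  (3 <= d)%N -> 0 < theta < 1 -> 0 < M ->
  exists c2 : R, 0 < c2 /\
    (forall (G : graph) (P : probability (field_space R 'rV[coord_ring G]_d) R),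
       centered_gaussian_field (green theta) P ->
       forall (K : {fset 'rV[coord_ring G]_d}) (A : {set {ffun K -> bool}})
              (h : R),
         K != fset0 -> increasing A -> - M < h < M ->
         let m := max_influence P val A h in
         derivable (level_prob P val A) h 1 /\
         - derive1 (level_prob P val A) h >=
           (if m == 0 then 0 else
            c2 * var_indicator P (level_event val A h) * ln (1 / (2 * m)))) /\
    (forall (L : nat) (P : probability (field_space R 'rV['Z_(2 * L)]_d) R),
       (1 <= L)%N ->
       centered_gaussian_field (green theta) P ->
       forall (A : {set {ffun 'rV['Z_(2 * L)]_d -> bool}}) (h : R),
         - M < h < M -> increasing A -> translation_invariant A ->
         derivable (level_prob P id A) h 1 /\
         - derive1 (level_prob P id A) h >=
           c2 * var_indicator P (level_event id A h) *
           ln (#|{: 'rV['Z_(2 * L)]_d}|%:R)).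
Proof.
move=> d3 th01 M0; have d0 : (0 < d)%N by exact: leq_trans d3.
have [th0 _] := andP th01.
have c0 : 0 < half_line_mean_bound theta M by exact: half_line_mean_bound_gt0.
have k0 : 0 < theta * half_line_mean_bound theta M by exact: mulr_gt0.
(* One factor 1/2 is that of [variance_ln_le_sum_influence]; the other pays, in (ii), for ln N = 2
   ln (sqrt N). *)
exists (theta * half_line_mean_bound theta M / 4); split; first by rewrite divr_gt0.
split.
  move=> G P gP K A h /fset0Pn[x xK] iA hM m.
  have [D dge] := level_derivative_ge d0 th01 M0 hM gP val_inj iA [` xK]%fset.
  split=> //.
  have I0 := level_influence_ge0 h d0 th01 gP val_inj iA [` xK]%fset.
  have v01 := level_variance01 h d0 th01 gP A val_inj [` xK]%fset.
  case: ifPn => [_|mn0].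
    by apply: le_trans dge; apply: mulr_ge0; [exact: ltW|exact: sumr_ge0].
  have Im (t : K) : influence P (level_event val A h) h (val t) <= m.
    exact: influence_le_max.
  have m0 : 0 < m by rewrite lt_def mn0 (le_trans (I0 [` xK]%fset)).
  have [v0 v1] := andP v01.
  (* If the logarithm is nonpositive, the derivative bound by a nonnegative sum is enough; otherwise
     1 / (2 m) <= 4 / m. *)
  have [l0|l0] := leP (ln (1 / (2 * m))) 0.
    apply: le_trans dge; apply: le_trans (_ : 0 <= _).
      by rewrite mulr_ge0_le0// mulr_ge0// divr_ge0// ltW.
    by apply: mulr_ge0; [exact: ltW|exact: sumr_ge0].
  apply: le_trans (level_derivative_ge_ln d0 th01 M0 hM gP val_inj iA [` xK]%fset m0 Im).
  have L : ln (1 / (2 * m)) <= ln (4 / m).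
    rewrite ler_ln ?posrE ?divr_gt0 ?mulr_gt0// invfM mulrA ler_wpM2r ?invr_ge0 ?(ltW m0)//.
    by lra.
  rewrite -[leLHS]mulrA; apply: ler_pM.
  - by rewrite divr_ge0// ltW.
  - by rewrite mulr_ge0// ltW.
  - by rewrite ler_wpM2l ?(ltW k0)//; lra.
  exact: ler_wpM2l.
move=> L P L1 gP A h hM iA tA.
set I := influence P (level_event id A h) h.
have [D dge] := level_derivative_ge d0 th01 M0 hM gP (@inj_id _) iA 0.
split=> //.
have v01 := level_variance01 h d0 th01 gP A (@inj_id _) 0.
have [v0 v1] := andP v01.
have IE t : I t = I 0.
  have C_ge0 (K : {fset 'rV['Z_(2 * L)]_d}) a : 0 <= bilin (green theta) K a a := green_bilin_ge0 d0 th01 K a.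
  have := influence_translate gP C_ge0 (green_translate theta) h tA 0 t.
  by rewrite addr0.
have N1 : 1 <= #|{: 'rV['Z_(2 * L)]_d}|%:R :> R.
  by rewrite ler1n; apply/card_gt0P; exists 0.
move: N1; set N : R := _%:R => N1.
have N0 : 0 < N by exact: lt_le_trans N1.
have s0 : 0 < Num.sqrt N by rewrite sqrtr_gt0.
have ss : Num.sqrt N * Num.sqrt N = N by rewrite -expr2 sqr_sqrtr// ltW.
have lnN : ln N = 2 * ln (Num.sqrt N) by rewrite -{1}ss lnM ?posrE// mulr2n mulrDl !mul1r.
have ln0 : 0 <= ln (Num.sqrt N).
  by have := ln_ge0 N1; rewrite lnN; lra.
have lns := ln_le_subr1 s0.
(* In the first case [m] is taken to be N^(-1/2), and ln (4 / m) >= ln (sqrt N). *)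
have [Is|Is] := leP (I 0) (Num.sqrt N)^-1.
  have m0 : 0 < (Num.sqrt N)^-1 by rewrite invr_gt0.
  have Im t : I t <= (Num.sqrt N)^-1 by rewrite IE.
  apply: le_trans (level_derivative_ge_ln d0 th01 M0 hM gP (@inj_id _) iA 0 m0 Im).
  rewrite invrK lnM ?posrE// lnN.
  have l4 : 0 <= ln (4 : R) by apply: ln_ge0; lra.
  move: (var_indicator _ _) (ln (Num.sqrt N)) (ln 4) v0 ln0 l4 => v l l' v0 ln0 l4.
  have -> : theta * half_line_mean_bound theta M / 4 * v * (2 * l) =
    theta * half_line_mean_bound theta M / 2 * (v * l) by field.
  by rewrite ler_wpM2l ?ler_wpM2l ?divr_ge0 ?(ltW k0)// lerDr.
apply: le_trans dge.
rewrite (eq_bigr (fun=> I 0)) => [|t _]; last exact: IE.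
rewrite sumr_const -(mulr_natl (I 0)) lnN.
rewrite [X in X%:R * I 0](_ : _ = #|{: 'rV['Z_(2 * L)]_d}|) -/N; last exact: eq_card.
(* Here the sum of the influences alone suffices: the variance is at most 1 and ln (sqrt N) <= sqrt
   N - 1. *)
have Ns : Num.sqrt N <= N * I 0.
  rewrite -[X in _ <= X * _]ss -mulrA ler_peMr ?(ltW s0)//.
  by rewrite -ler_pdivrMl// mulr1 ltW.
move: (var_indicator _ _) (ln (Num.sqrt N)) v0 v1 ln0 lns => v l v0 v1 ln0 lns.
have -> : theta * half_line_mean_bound theta M / 4 * v * (2 * l) =
  theta * half_line_mean_bound theta M * (v * l / 2) by field.
rewrite ler_wpM2l ?(ltW k0)//; apply: le_trans Ns.
have vl : v * l <= 1 * l by rewrite ler_wpM2r.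
by lra.
Qed.
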